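(* Let $R$ be a commutative ring with identity and let $n,d\ge 0$ be integers. Then: (1) $R$ is a $G$-$(0,0)$-ring if and only if $R$ is G-semisimple. (2) $R$ is a $G$-$(0,1)$-ring if and only if $R$ is G-hereditary. (3) $R$ is a $G$-$(0,d)$-ring if and only if $\mathrm{G\text{-}gldim}(R)\le d$. (4) $R$ is a $G$-$(1,0)$-ring if and only if $R$ is G-Von Neumann regular. (5) If $R$ is coherent, then $R$ is a $G$-$(1,1)$-ring if and only if $R$ is G-semi-hereditary. (6) $R$ is a $G$-$(0,1)$-domain (an integral domain that is a $G$-$(0,1)$-ring) if and only if $R$ is G-Dedekind. (7) If $R$ is coherent, then $R$ is a $G$-$(1,1)$-domain (an integral domain that is a $G$-$(1,1)$-ring) if and only if $R$ is G-Prüfer. (8) If $R$ is Noetherian, then $R$ is a $G$-$(n,d)$-ring if and only if $\mathrm{G\text{-}gldim}(R)\le d$.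
   Context: All rings are commutative with identity and all modules are unital. An $R$-module $M$ is Gorenstein projective if there is an exact sequence of projective modules $\mathbf P=\cdots\to P_1\to P_0\to P^0\to P^1\to\cdots$ with $M\cong \mathrm{Im}(P_0\to P^0)$ such that $\mathrm{Hom}_R(-,Q)$ leaves $\mathbf P$ exact for every projective module $Q$. An $R$-module $M$ is Gorenstein flat if there is an exact sequence of flat modules $\mathbf F=\cdots\to F_1\to F_0\to F^0\to F^1\to\cdots$ with $M\cong \mathrm{Im}(F_0\to F^0)$ such that $-\otimes_R I$ leaves $\mathbf F$ exact for every injective module $I$. The Gorenstein projective dimension $\mathrm{Gpd}_R(M)$ is the minimal length of a resolution of $M$ by Gorenstein projective modules ($\infty$ if there is no finite one), and $\mathrm{G\text{-}gldim}(R)=\sup\{\mathrm{Gpd}_R(M)\mid M \text{ an } R\text{-module}\}$. For an integer $n\ge 0$, an $R$-module $M$ is $n$-presented if there is an exact sequence $F_n\to F_{n-1}\to\cdots\to F_0\to M\to 0$ with each $F_i$ a finitely generated free $R$-module. For integers $n,d\ge 0$, $R$ is a $G$-$(n,d)$-ring if every $n$-presented $R$-module $M$ satisfies $\mathrm{Gpd}_R(M)\le d$. $R$ is G-semisimple if every $R$-module is Gorenstein projective (equivalently, $R$ is quasi-Frobenius). $R$ is G-Von Neumann regular if every $R$-module is Gorenstein flat (equivalently, $R$ is an IF-ring). $R$ is G-hereditary if $\mathrm{G\text{-}gldim}(R)\le 1$, and G-Dedekind if it is a G-hereditary integral domain. $R$ is G-semi-hereditary if $R$ is coherent and every submodule of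 a flat $R$-module is Gorenstein flat, and G-Prüfer if it is a G-semi-hereditary integral domain. *)

(* Defs.v *)
From HB Require Import structures.
From mathcomp Require Import all_boot all_order all_algebra.
From mathcomp Require Import boolp.

Set Implicit Arguments.
Unset Strict Implicit.
Unset Printing Implicit Defensive.

Import GRing.Theory.
Local Open Scope ring_scope.
Local Open Scope quotient_scope.

(** [tensor U V] is the quotient of the free commutative monoid on [U * V]
  (finite formal sums, encoded as sequences) by the congruence generated by
  the usual bilinearity relations.  This monoid is already a group, with
  [- (u, v)] represented by [(- u, v)]. *)

Section TensorDef.
Variables (R : comPzRingType) (U V : lmodType R).

Inductive tensor_rel : seq (U * V) -> seq (U * V) -> Prop :=
| tensor_refl s : tensor_rel s s
| tensor_sym s t : tensor_rel s t -> tensor_rel t s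
| tensor_trans s t r : tensor_rel s t -> tensor_rel t r -> tensor_rel s r
| tensor_cat s s' t t' :
    tensor_rel s s' -> tensor_rel t t' -> tensor_rel (s ++ t) (s' ++ t')
| tensor_catC s t : tensor_rel (s ++ t) (t ++ s)
| tensor_0l v : tensor_rel [:: (0, v)] [::]
| tensor_Dl u u' v : tensor_rel [:: (u + u', v)] [:: (u, v); (u', v)]
| tensor_Dr u v v' : tensor_rel [:: (u, v + v')] [:: (u, v); (u, v')]
| tensor_Z a u v : tensor_rel [:: (a *: u, v)] [:: (u, a *: v)].

Definition tensor_relb (s t : seq (U * V)) : bool := `[< tensor_rel s t >].

Lemma tensor_relb_refl : reflexive tensor_relb.
Proof. by move=> s; apply/asboolP; constructor. Qed.

Lemma tensor_relb_sym : symmetric tensor_relb.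
Proof. by move=> s t; apply/asboolP/asboolP => h; apply: tensor_sym. Qed.

Lemma tensor_relb_trans : transitive tensor_relb.
Proof.
move=> t s r /asboolP h1 /asboolP h2.
by apply/asboolP; apply: tensor_trans h1 h2.
Qed.

Canonical tensor_equiv :=
  EquivRel tensor_relb tensor_relb_refl tensor_relb_sym tensor_relb_trans.

Definition tensor := {eq_quot tensor_equiv}.
HB.instance Definition _ := Choice.on tensor.
HB.instance Definition _ := Quotient.on tensor.

Lemma tensor_piP (s t : seq (U * V)) :
  (\pi_tensor s = \pi_tensor t) <-> tensor_rel s t.
Proof.
by split=> [/eqmodP/asboolP//|h]; apply/eqmodP/asboolP.
Qed.

Lemma tensor_reprP (s : seq (U * V)) :
  tensor_rel (repr (\pi_tensor s)) s.
Proof. by apply/tensor_piP; rewrite reprK. Qed.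

Lemma tensor_map_rel (f : U -> U) (s t : seq (U * V)) :
  f 0 = 0 -> {morph f : x y / x + y} -> (forall a, {morph f : x / a *: x}) ->
  tensor_rel s t ->
  tensor_rel [seq (f p.1, p.2) | p <- s] [seq (f p.1, p.2) | p <- t].
Proof.
move=> f0 fD fZ; elim=> /= [r|r r' _|r r1 r2 _ h1 _|r r' t1 t1' _ h1 _ h2|r r'|v
  |u u' v|u v v'|a u v]; rewrite ?map_cat ?f0 ?fD ?fZ; try by constructor.
exact: tensor_trans.
Qed.

Definition tensor_add (x y : tensor) : tensor := \pi_tensor (repr x ++ repr y).
Definition tensor_scale (a : R) (x : tensor) : tensor :=
  \pi_tensor [seq (a *: p.1, p.2) | p <- repr x].

Lemma tensor_add_pi s t :
  tensor_add (\pi_tensor s) (\pi_tensor t) = \pi_tensor (s ++ t).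
Proof. by apply/tensor_piP; apply: tensor_cat; apply: tensor_reprP. Qed.

Lemma tensor_scale_pi a s :
  tensor_scale a (\pi_tensor s) = \pi_tensor [seq (a *: p.1, p.2) | p <- s].
Proof.
apply/tensor_piP; apply: tensor_map_rel (tensor_reprP s).
- exact: scaler0.
- by move=> x y; rewrite scalerDr.
- by move=> b x; rewrite !scalerA mulrC.
Qed.

Lemma tensor_addA : associative tensor_add.
Proof.
move=> x y z; elim/quotW: x => x; elim/quotW: y => y; elim/quotW: z => z.
rewrite (tensor_add_pi y z) (tensor_add_pi x y).
by rewrite (tensor_add_pi x (y ++ z)) (tensor_add_pi (x ++ y) z) catA.

Qed.

Lemma tensor_addC : commutative tensor_add.
Proof. by move=> x y; apply/tensor_piP; apply: tensor_catC. Qed.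

Lemma tensor_add0 : left_id (\pi_tensor [::]) tensor_add.
Proof. by move=> x; elim/quotW: x => x; rewrite tensor_add_pi. Qed.

Lemma tensor_rel_cons p s t : tensor_rel s t -> tensor_rel (p :: s) (p :: t).
Proof. by rewrite -(cat1s p s) -(cat1s p t); apply: tensor_cat; constructor. Qed.

Lemma tensor_split (f g h : U -> U) s :
  (forall u, h u = f u + g u) ->
  tensor_rel [seq (h p.1, p.2) | p <- s]
    ([seq (f p.1, p.2) | p <- s] ++ [seq (g p.1, p.2) | p <- s]).
Proof.
move=> hE; elim: s => [|[u v] s ih] /=; first by constructor.
rewrite hE -cat1s.
apply: (tensor_trans (tensor_cat (tensor_Dl _ _ _) ih)) => /=.
apply: tensor_rel_cons; rewrite -cat1s catA -[X in tensor_rel _ (_ ++ X)]cat1s.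
rewrite [X in tensor_rel _ X]catA; apply: tensor_cat; last by constructor.
exact: tensor_catC.
Qed.

Lemma tensor_map0 s : tensor_rel [seq ((0 : U), p.2) | p <- (s : seq (U * V))] [::].
Proof.
elim: s => [|p s ih] /=; first by constructor.
by rewrite -cat1s; apply: (tensor_cat (tensor_0l _) ih).
Qed.

Lemma tensor_addN :
  left_inverse (\pi_tensor [::]) (tensor_scale (-1)) tensor_add.
Proof.
move=> x; elim/quotW: x => s; rewrite tensor_scale_pi tensor_add_pi.
apply/tensor_piP.
rewrite -[X in tensor_rel (_ ++ X)](_ : [seq (idfun p.1, p.2) | p <- s] = s);
  last by rewrite -[RHS]map_id; apply: eq_map => -[].
apply: tensor_trans (tensor_map0 s).
apply/tensor_sym/(tensor_split (h := fun=> 0)) => u.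
by rewrite scaleN1r addNr.
Qed.

HB.instance Definition _ := GRing.isZmodule.Build tensor
  tensor_addA tensor_addC tensor_add0 tensor_addN.

Lemma tensor_scaleA a b (x : tensor) :
  tensor_scale a (tensor_scale b x) = tensor_scale (a * b) x.
Proof.
elim/quotW: x => s; rewrite (tensor_scale_pi b s) (tensor_scale_pi (a * b) s).
rewrite (tensor_scale_pi a [seq (b *: p.1, p.2) | p <- s]) -map_comp.
by congr (\pi_tensor _); apply: eq_map => p /=; rewrite scalerA.
Qed.

Lemma tensor_scale1 : left_id 1 tensor_scale.
Proof.
move=> x; rewrite -[x in RHS]reprK; congr (\pi_tensor _).
by rewrite -[RHS]map_id; apply: eq_map => -[u v] /=; rewrite scale1r.
Qed.

Lemma tensor_scaleDr : right_distributive tensor_scale +%R.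
Proof.
move=> a x y; elim/quotW: x => s; elim/quotW: y => t.
rewrite [\pi_tensor s + \pi_tensor t](tensor_add_pi s t).
rewrite (tensor_scale_pi a (s ++ t)) (tensor_scale_pi a s) (tensor_scale_pi a t).
by rewrite map_cat -tensor_add_pi.
Qed.

Lemma tensor_scaleDl (x : tensor) :
  {morph tensor_scale^~ x : a b / a + b}.
Proof.
move=> a b; elim/quotW: x => s.
rewrite (tensor_scale_pi (a + b) s) (tensor_scale_pi a s) (tensor_scale_pi b s).
rewrite [RHS]tensor_add_pi.
by apply/tensor_piP/tensor_split => u; rewrite scalerDl.
Qed.

HB.instance Definition _ := GRing.Zmodule_isLmodule.Build R tensor
  tensor_scaleA tensor_scale1 tensor_scaleDr tensor_scaleDl.

Definition tens (u : U) (v : V) : tensor := \pi_tensor [:: (u, v)].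

Lemma tensor_piE s : \pi_tensor s = \sum_(p <- s) tens p.1 p.2.
Proof.
elim: s => [|[u v] s ih]; first by rewrite big_nil.
by rewrite big_cons -ih [RHS]tensor_add_pi.
Qed.

Lemma tensDl u u' v : tens (u + u') v = tens u v + tens u' v.
Proof. by rewrite [RHS]tensor_add_pi; apply/tensor_piP; constructor. Qed.

Lemma tensDr u v v' : tens u (v + v') = tens u v + tens u v'.
Proof. by rewrite [RHS]tensor_add_pi; apply/tensor_piP; constructor. Qed.

Lemma tensZl a u v : tens (a *: u) v = a *: tens u v.
Proof. by rewrite [RHS]tensor_scale_pi. Qed.

Lemma tensZr a u v : tens u (a *: v) = a *: tens u v.
Proof. by rewrite -tensZl; apply/tensor_piP/tensor_sym; constructor. Qed.

End TensorDef.

Section TensorLift.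
Variables (R : comPzRingType) (U V W : lmodType R) (b : U -> V -> W).
Hypotheses (bDl : forall u u' v, b (u + u') v = b u v + b u' v)
  (bDr : forall u v v', b u (v + v') = b u v + b u v')
  (bZl : forall a u v, b (a *: u) v = a *: b u v)
  (bZr : forall a u v, b u (a *: v) = a *: b u v).

Lemma tensor_rel_sum s t : tensor_rel s t ->
  \sum_(p <- s) b p.1 p.2 = \sum_(p <- t) b p.1 p.2.
Proof.
elim=> //= [r t' t2 _ -> _ ->|r r' t1 t1' _ h1 _ h2|r r'|v|u u' v|u v v'|a u v] //.
- by rewrite !big_cat /= h1 h2.
- by rewrite !big_cat /= addrC.
- by rewrite unlock /= addr0 -(scale0r 0) bZl scale0r.
- by rewrite unlock /= !addr0 bDl.
- by rewrite unlock /= !addr0 bDr.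
- by rewrite unlock /= !addr0 bZl bZr.
Qed.

Theorem tensor_universal :
  exists f : {linear tensor U V -> W},
    (forall u v, f (tens u v) = b u v) /\
    (forall g : {linear tensor U V -> W},
       (forall u v, g (tens u v) = b u v) -> g =1 f).
Proof.
pose f (x : tensor U V) := \sum_(p <- repr x) b p.1 p.2.
have fE s : f (\pi_(tensor _ _) s) = \sum_(p <- s) b p.1 p.2.
  exact: tensor_rel_sum (tensor_reprP s).
have f_lin : linear f.
  move=> a x y; elim/quotW: x => x; elim/quotW: y => y.
  rewrite [a *: _]tensor_scale_pi [_ + _]tensor_add_pi !fE big_cat big_map /=.
  by rewrite scaler_sumr; congr (_ + _); apply: eq_bigr => p _; rewrite bZl.
pose fL := GRing.isLinear.Build R _ _ _ f f_lin.
pose F : {linear tensor U V -> W} := HB.pack f fL.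
exists F; split=> [u v|g gE x]; first by rewrite /= fE big_seq1.
rewrite /= -[x]reprK fE tensor_piE linear_sum.
by apply: eq_bigr => p _; rewrite gE.
Qed.

End TensorLift.

Section TensorMap.
Variables (R : comPzRingType) (A B : lmodType R) (f : {linear A -> B}).
Variable V : lmodType R.

(** The map [f (x) V : A (x) V -> B (x) V], see [tensor_mapE]. *)
Definition tensor_map (x : tensor A V) : tensor B V :=
  \sum_(p <- repr x) tens (f p.1) p.2.

Lemma tensor_map_pi s :
  tensor_map (\pi_(tensor _ _) s) = \sum_(p <- s) tens (f p.1) p.2.
Proof.
apply: (tensor_rel_sum (b := fun u v => tens (f u) v)) (tensor_reprP s).
- by move=> u u' v; rewrite linearD tensDl.
- by move=> u v v'; rewrite tensDr.
- by move=> a u v; rewrite linearZ tensZl.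
- by move=> a u v; rewrite tensZr.
Qed.

Lemma tensor_map_linear : linear tensor_map.
Proof.
move=> a x y; elim/quotW: x => x; elim/quotW: y => y.
rewrite [a *: _]tensor_scale_pi [_ + _]tensor_add_pi !tensor_map_pi.
rewrite big_cat big_map /= scaler_sumr; congr (_ + _).
by apply: eq_bigr => p _; rewrite linearZ tensZl.
Qed.

HB.instance Definition _ :=
  GRing.isLinear.Build R (tensor A V) (tensor B V) _ tensor_map
    tensor_map_linear.

Lemma tensor_mapE u v : tensor_map (tens u v) = tens (f u) v.
Proof. by rewrite tensor_map_pi big_seq1. Qed.

End TensorMap.

Arguments tensor_map {R A B} f V x.

Section Modules.
Variable R : comPzRingType.

Definition surj (A B : Type) (f : A -> B) : Prop := forall y, exists x, f x = y.

Definition exact_at (A B C : lmodType R)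
    (f : {linear A -> B}) (g : {linear B -> C}) : Prop :=
  forall y : B, g y = 0 <-> exists x : A, f x = y.

Definition projective (P : lmodType R) : Prop :=
  forall (A B : lmodType R) (p : {linear A -> B}) (f : {linear P -> B}),
    surj p -> exists h : {linear P -> A}, forall x, p (h x) = f x.

Definition injective_module (I : lmodType R) : Prop :=
  forall (A B : lmodType R) (i : {linear A -> B}) (f : {linear A -> I}),
    injective i -> exists h : {linear B -> I}, forall x, h (i x) = f x.

Definition flat (F : lmodType R) : Prop :=
  forall (A B : lmodType R) (i : {linear A -> B}),
    injective i -> injective (tensor_map i F).

(** [... -> P_1 -> P_0 -> P^0 -> P^1 -> ...] with [lterm i] for [P_i] and
  [rterm i] for [P^i]. *)
Record biseq := Biseq {
  lterm : nat -> lmodType R;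
  rterm : nat -> lmodType R;
  lmap : forall i, {linear lterm i.+1 -> lterm i};
  mmap : {linear lterm 0%N -> rterm 0%N};
  rmap : forall i, {linear rterm i -> rterm i.+1} }.

Definition biseq_all (P : lmodType R -> Prop) (S : biseq) : Prop :=
  (forall i, P (lterm S i)) /\ (forall i, P (rterm S i)).

Definition biseq_exact (S : biseq) : Prop :=
  [/\ forall i, exact_at (lmap S i.+1) (lmap S i),
      exact_at (lmap S 0) (mmap S),
      exact_at (mmap S) (rmap S 0) &
      forall i, exact_at (rmap S i) (rmap S i.+1)].

(** Exactness of [Hom(C, Q) -> Hom(B, Q) -> Hom(A, Q)]. *)
Definition hom_exact_at (Q A B C : lmodType R)
    (f : {linear A -> B}) (g : {linear B -> C}) : Prop :=
  forall h : {linear B -> Q},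
    (forall x, h (f x) = 0) <-> exists k : {linear C -> Q}, forall y, k (g y) = h y.

Definition biseq_hom_exact (S : biseq) (Q : lmodType R) : Prop :=
  [/\ forall i, hom_exact_at Q (lmap S i.+1) (lmap S i),
      hom_exact_at Q (lmap S 0) (mmap S),
      hom_exact_at Q (mmap S) (rmap S 0) &
      forall i, hom_exact_at Q (rmap S i) (rmap S i.+1)].

Definition biseq_tensor (S : biseq) (I : lmodType R) : biseq :=
  @Biseq (fun i => tensor (lterm S i) I) (fun i => tensor (rterm S i) I)
    (fun i => tensor_map (lmap S i) I) (tensor_map (mmap S) I)
    (fun i => tensor_map (rmap S i) I).

(** [M] is isomorphic to the image of [f]: some embedding of [M] into the
  codomain of [f] has the same range as [f]. *)
Definition iso_image (M A B : lmodType R) (f : {linear A -> B}) : Prop :=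
  exists j : {linear M -> B}, injective j /\
    forall y, (exists m, j m = y) <-> (exists x, f x = y).

Definition Gorenstein_projective (M : lmodType R) : Prop :=
  exists S : biseq,
    [/\ biseq_all projective S, biseq_exact S, iso_image M (mmap S) &
        forall Q, projective Q -> biseq_hom_exact S Q].

Definition Gorenstein_flat (M : lmodType R) : Prop :=
  exists S : biseq,
    [/\ biseq_all flat S, biseq_exact S, iso_image M (mmap S) &
        forall I, injective_module I -> biseq_exact (biseq_tensor S I)].

(** The minimum in [nat + {oo}] of a set of natural numbers; [None] is [oo]. *)
Definition least (P : nat -> Prop) : option nat :=
  if pselect (exists n, `[< P n >]) is left h then Some (ex_minn h) else None.

Definition dim_le (x : option nat) (d : nat) : bool :=
  if x is Some k then (k <= d)%N else false.

(** [0 -> G_n -> ... -> G_0 -> M -> 0] exact, with [G_i = 0] for [i > n]. *)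
Definition Gproj_resolution (M : lmodType R) (n : nat) : Prop :=
  exists (G : nat -> lmodType R) (eps : {linear G 0%N -> M})
         (dG : forall i, {linear G i.+1 -> G i}),
    [/\ forall i, Gorenstein_projective (G i),
        forall i, (n < i)%N -> forall x : G i, x = 0,
        surj eps, exact_at (dG 0%N) eps &
        forall i, exact_at (dG i.+1) (dG i)].

Definition Gpd (M : lmodType R) : option nat := least (Gproj_resolution M).

(** The supremum of all [Gpd M], as their least upper bound. *)
Definition Ggldim : option nat :=
  least (fun d => forall M : lmodType R, dim_le (Gpd M) d).

(** [F_n -> ... -> F_0 -> M -> 0] exact with [F_i = R^(k i)]; the maps
  [dF i] with [i >= n] are irrelevant. *)
Definition n_presented (n : nat) (M : lmodType R) : Prop :=
  exists (k : nat -> nat) (eps : {linear 'rV[R]_(k 0%N) -> M})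
         (dF : forall i, {linear 'rV[R]_(k i.+1) -> 'rV[R]_(k i)}),
    [/\ surj eps, (0 < n)%N -> exact_at (dF 0%N) eps &
        forall i, (i.+1 < n)%N -> exact_at (dF i.+1) (dF i)].

Definition G_nd_ring (n d : nat) : Prop :=
  forall M : lmodType R, n_presented n M -> dim_le (Gpd M) d.

(** Below, ideals and submodules are given by their inclusion map: an injective linear
  map into [R^o], resp. into the ambient module. *)

Definition domain_axiom : Prop :=
  (1 : R) <> 0 /\ forall x y : R, x * y = 0 -> x = 0 \/ y = 0.

Definition noetherian : Prop :=
  forall (I : lmodType R) (j : {linear I -> R^o}),
    injective j -> n_presented 0 I.

Definition coherent : Prop :=
  forall (I : lmodType R) (j : {linear I -> R^o}),
    injective j -> n_presented 0 I -> n_presented 1 I.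

Definition G_semisimple : Prop :=
  forall M : lmodType R, Gorenstein_projective M.

Definition G_von_Neumann_regular : Prop :=
  forall M : lmodType R, Gorenstein_flat M.

Definition G_hereditary : Prop := dim_le Ggldim 1.

Definition G_Dedekind : Prop := G_hereditary /\ domain_axiom.

Definition G_semi_hereditary : Prop :=
  coherent /\
  forall (F N : lmodType R) (j : {linear N -> F}),
    flat F -> injective j -> Gorenstein_flat N.

Definition G_Pruefer : Prop := G_semi_hereditary /\ domain_axiom.

Definition G_nd_domain (n d : nat) : Prop := G_nd_ring n d /\ domain_axiom.

End Modules.

Arguments Ggldim : clear implicits.
Arguments G_nd_ring : clear implicits.
Arguments G_nd_domain : clear implicits.
Arguments domain_axiom : clear implicits.
Arguments noetherian : clear implicits.
Arguments coherent : clear implicits.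
Arguments G_semisimple : clear implicits.
Arguments G_von_Neumann_regular : clear implicits.
Arguments G_hereditary : clear implicits.
Arguments G_Dedekind : clear implicits.
Arguments G_semi_hereditary : clear implicits.
Arguments G_Pruefer : clear implicits.

(* Main.v *)
Require Import Defs.
From HB Require Import structures.
From mathcomp Require Import all_boot all_order all_algebra.
From mathcomp Require Import boolp wochoice.

(** The eight equivalences rest on three independent arguments.

  _Arbitrary modules versus cyclic modules_ (parts 1, 2, 3, 6, 8).  The point
  is that [Gpd M <= d] for all cyclic [M] forces it for all [M].  The
  condition [Gpd M <= d] is first turned into a datum that can be glued: a
  projective resolution of [M] which, from degree [d] on, is the left half of
  a totally acyclic complex of projectives ([cres]).  Now well-order [M]; the
  submodules generated by initial segments filter [M] with cyclic factors.
  Choose such a datum for each factor and take the direct sum of all the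
  complexes involved, with differentials that are triangular for the order
  and have the chosen differentials on the diagonal.  To the left they are
  built with projectivity ([tri_left]); to the right by recursion along the
  well-order, each step extending a map with values in a projective module,
  which is possible because the factors are [Hom]-exact ([tri_right]).
  Exactness and [Hom]-exactness of the sum are read off on leading components
  ([tri_exact], [tri_hom]).  The result is a datum for [M] ([cres_filtered],
  [cyclic_filtration]).  The same gluing over the order [false < true] shows
  that Gorenstein projectives are closed under extensions ([GP_extension]),
  which is what is needed to replace a resolution by Gorenstein projectives by
  a datum in the above sense ([Gproj_resolution_cres]).  Over a Noetherian
  ring finitely generated modules are [n]-presented, whence part 8.

  _G-Von Neumann regularity_ (part 4).  Both sides are equivalent to the
  flatness of all injectives.  If injectives are flat, a free resolution of
  [M] followed by an injective coresolution is a complete flat resolution.  If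
  finitely presented modules are Gorenstein projective, every map from such a
  module to an injective [E] extends to a projective module, and this is the
  equational criterion for the flatness of [E].  Conversely, if every module
  embeds in a flat one then, by the same criterion, every finitely presented
  module embeds in a finitely generated free one; applied to a matrix and to
  its transpose this makes every exact sequence of matrices exact for rows and
  columns at once, so finitely presented modules have complete resolutions by
  matrices ([coexact_GP]).

  _G-semi-heredity_ (parts 5, 7).  For a coherent ring both sides are
  equivalent to each of: [Ext^2(M, R) = 0] for finitely presented [M]
  ([ext2_vanishes]); injectives have flat dimension at most one
  ([injectives_fd1]).  The two conditions are dual to each other by
  [Hom(-, E)] for [E] injective ([ext2_fd1], [fd1_ext2]).  The first follows
  from [Gpd M <= 1], and it makes finitely generated submodules of free modules
  Gorenstein projective ([ext2_GP]); the second makes submodules of flat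
  modules Gorenstein flat ([fd1_GF]), and follows from it because a Gorenstein
  flat module has no [Tor] with injectives ([GF_fd1]).

  Complexes other than the glued ones are produced by splicing short exact
  sequences inside a class of modules that can be continued on both sides
  ([biseq_build]). *)

Set Implicit Arguments.
Unset Strict Implicit.
Unset Printing Implicit Defensive.

Import Order.TTheory GRing.Theory Num.Theory.
Local Open Scope ring_scope.
Local Open Scope quotient_scope.

(** * Linear maps, submodules and quotients *)

Section Linear.
Variable R : comPzRingType.

(** Maps are mostly obtained by diagram chasing, that is, as functional relations
  compatible with the operations. *)
Lemma lin_of_rel (A B : lmodType R) (G : A -> B -> Prop) :
  (forall a, exists b, G a b) ->
  (forall a b b', G a b -> G a b' -> b = b') ->
  (forall c a a' b b', G a b -> G a' b' -> G (c *: a + a') (c *: b + b')) ->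
  exists f : {linear A -> B}, forall a, G a (f a).
Proof.
move=> tot fn lin; have [f fP] := choice tot.
have fl : linear f by move=> c a a'; apply: fn (fP _) (lin _ _ _ _ _ (fP _) (fP _)).
pose fL := GRing.isLinear.Build R _ _ _ f fl.
pose F : {linear A -> B} := HB.pack f fL.
by exists F.
Qed.

Lemma lin_comp (A B C : lmodType R) (g : {linear B -> C}) (f : {linear A -> B}) :
  exists h : {linear A -> C}, forall a, h a = g (f a).
Proof. by exists (g \o f : {linear A -> C}). Qed.

Lemma factor_inj (K M A : lmodType R) (i : {linear K -> M}) (f : {linear A -> M}) :
  injective i -> (forall a, exists k, i k = f a) ->
  exists g : {linear A -> K}, forall a, i (g a) = f a.
Proof.
move=> ii im; apply: (lin_of_rel (G := fun a k => i k = f a)) => //.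
- by move=> a b b' hb hb'; apply: ii; rewrite hb hb'.
- by move=> c a a' b b' hb hb'; rewrite !linearP hb hb'.
Qed.

Lemma factor_surj (M C A : lmodType R) (p : {linear M -> C}) (f : {linear M -> A}) :
  surj p -> (forall m, p m = 0 -> f m = 0) ->
  exists g : {linear C -> A}, forall m, g (p m) = f m.
Proof.
move=> ps kp.
have [|||g gP] := @lin_of_rel C A (fun c a => exists2 m, p m = c & f m = a).
- by move=> c; have [m <-] := ps c; exists (f m), m.
- move=> _ _ _ [m <- <-] [m' e <-]; apply/eqP; rewrite -subr_eq0 -linearB.
  by apply/eqP/kp; rewrite linearB e subrr.
- move=> c a a' b b' [m <- <-] [m' <- <-].
  by exists (c *: m + m'); rewrite linearP.
exists g => m; have [m' e <-] := gP (p m).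
by apply/eqP; rewrite -subr_eq0 -linearB; apply/eqP/kp; rewrite linearB e subrr.
Qed.

Lemma lin_eq0_inj (A B : lmodType R) (f : {linear A -> B}) :
  (forall a, f a = 0 -> a = 0) -> injective f.
Proof.
move=> h a a' e; apply/eqP; rewrite -subr_eq0; apply/eqP/h.
by rewrite linearB e subrr.
Qed.

Lemma lin_inj_eq0 (A B : lmodType R) (f : {linear A -> B}) a :
  injective f -> f a = 0 -> a = 0.
Proof. by move=> h e; apply: h; rewrite linear0. Qed.

Definition submodule (M : lmodType R) (S : M -> Prop) : Prop :=
  S 0 /\ forall c x y, S x -> S y -> S (c *: x + y).

Lemma submoduleD (M : lmodType R) (S : M -> Prop) x y :
  submodule S -> S x -> S y -> S (x + y).
Proof. by move=> [_ h] hx hy; rewrite -[x]scale1r; apply: h. Qed.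

Lemma submoduleZ (M : lmodType R) (S : M -> Prop) c x :
  submodule S -> S x -> S (c *: x).
Proof. by move=> [h0 h] hx; rewrite -[_ *: _]addr0; apply: h. Qed.

Lemma submoduleB (M : lmodType R) (S : M -> Prop) x y :
  submodule S -> S x -> S y -> S (x - y).
Proof. by move=> h hx hy; rewrite addrC -scaleN1r; apply: h.2. Qed.

Lemma submodule_sum (M : lmodType R) (S : M -> Prop) (I : Type) (r : seq I)
    (P : pred I) (F : I -> M) :
  submodule S -> (forall i, P i -> S (F i)) -> S (\sum_(i <- r | P i) F i).
Proof.
move=> hS hF; elim/big_ind: _ => //; first exact: hS.1.
by move=> x y; apply: submoduleD.
Qed.

Lemma submodule_ker (M N : lmodType R) (f : {linear M -> N}) :
  submodule (fun m => f m = 0).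
Proof.
split=> [|c x y hx hy]; first exact: linear0.
by rewrite linearP hx hy scaler0 addr0.
Qed.

Lemma submodule_im (M N : lmodType R) (f : {linear M -> N}) :
  submodule (fun n => exists m, f m = n).
Proof.
split=> [|c _ _ [x <-] [y <-]]; first by exists 0; rewrite linear0.
by exists (c *: x + y); rewrite linearP.
Qed.

End Linear.

Section SubModule.
Variables (R : comPzRingType) (M : lmodType R) (S : M -> Prop) (hS : submodule S).

Definition sub_pred : {pred M} := fun x => `[< S x >].

Lemma sub_pred_closed : GRing.submod_closed sub_pred.
Proof.
split=> [|c x y /asboolP hx /asboolP hy]; first exact/asboolP/hS.1.
exact/asboolP/hS.2.
Qed.
HB.instance Definition _ := GRing.isSubmodClosed.Build R M sub_pred sub_pred_closed.

Record sub_type := SubType { sub_val : M; _ : sub_val \in sub_pred }.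
HB.instance Definition _ := [isSub of sub_type for sub_val].
HB.instance Definition _ := [Choice of sub_type by <:].
HB.instance Definition _ := [SubChoice_isSubLmodule of sub_type by <:].

(** Submodules and quotients matter only up to isomorphism, so they are used
  through the existence of an embedding, resp. of a projection. *)
Lemma sub_exists : exists (K : lmodType R) (i : {linear K -> M}),
  injective i /\ forall m, S m <-> exists k, i k = m.
Proof.
exists sub_type, (val : {linear sub_type -> M}); split; first exact: val_inj.
move=> m; split=> [h|[k <-]]; last by case: k => x /= /asboolP.
by have h' : m \in sub_pred by [apply/asboolP]; exists (SubType h').
Qed.

End SubModule.

Section QuotModule.
Variables (R : comPzRingType) (M : lmodType R) (S : M -> Prop) (hS : submodule S).

Definition qrel (x y : M) : bool := `[< S (x - y) >].

Lemma qrel_refl : reflexive qrel.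
Proof. by move=> x; apply/asboolP; rewrite subrr; exact: hS.1. Qed.
Lemma qrel_symP x y : qrel x y -> qrel y x.
Proof.
by move=> /asboolP h; apply/asboolP; rewrite -opprB -scaleN1r; apply: submoduleZ.
Qed.
Lemma qrel_sym : symmetric qrel.
Proof. by move=> x y; apply/idP/idP; apply: qrel_symP. Qed.
Lemma qrel_trans : transitive qrel.
Proof.
move=> y x z /asboolP h /asboolP h'; apply/asboolP.
by rewrite -(subrKA y); apply: submoduleD.
Qed.

Let eqv := EquivRel qrel qrel_refl qrel_sym qrel_trans.
Let Q := {eq_quot eqv}.
HB.instance Definition _ := Choice.on Q.
HB.instance Definition _ := Quotient.on Q.

Let piP (x y : M) : (\pi_Q x = \pi_Q y) <-> S (x - y).
Proof. by split=> [/eqmodP/asboolP|h]; last apply/eqmodP/asboolP. Qed.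

Let reprS x : S (repr (\pi_Q x) - x).
Proof. by apply/piP; rewrite reprK. Qed.

Let qadd (x y : Q) : Q := \pi_Q (repr x + repr y).
Let qopp (x : Q) : Q := \pi_Q (- repr x).
Let qscale a (x : Q) : Q := \pi_Q (a *: repr x).

Let qaddE x y : qadd (\pi_Q x) (\pi_Q y) = \pi_Q (x + y).
Proof. by apply/piP; rewrite opprD addrACA; apply: (submoduleD hS); apply: reprS. Qed.
Let qoppE x : qopp (\pi_Q x) = \pi_Q (- x).
Proof.
by apply/piP; rewrite -opprD -[- (_ - _)]scaleN1r; apply: (submoduleZ _ hS); apply: reprS.
Qed.
Let qscaleE a x : qscale a (\pi_Q x) = \pi_Q (a *: x).
Proof. by apply/piP; rewrite -scalerBr; apply: (submoduleZ _ hS); apply: reprS. Qed.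

Let qaddA : associative qadd.
Proof.
move=> x y z; elim/quotW: x => x; elim/quotW: y => y; elim/quotW: z => z.
by rewrite (qaddE y z) (qaddE x y) (qaddE x (y + z)) (qaddE (x + y) z) addrA.
Qed.
Let qaddC : commutative qadd.
Proof.
by move=> x y; elim/quotW: x => x; elim/quotW: y => y; rewrite (qaddE x y) (qaddE y x) addrC.
Qed.
Let qadd0 : left_id (\pi_Q 0) qadd.
Proof. by move=> x; elim/quotW: x => x; rewrite qaddE add0r. Qed.
Let qaddN : left_inverse (\pi_Q 0) qopp qadd.
Proof. by move=> x; elim/quotW: x => x; rewrite qoppE qaddE addNr. Qed.

HB.instance Definition _ := GRing.isZmodule.Build Q qaddA qaddC qadd0 qaddN.

Let qscaleA a b x : qscale a (qscale b x) = qscale (a * b) x.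
Proof. by elim/quotW: x => x; rewrite (qscaleE b x) (qscaleE (a * b) x) (qscaleE a (b *: x)) scalerA. Qed.
Let qscale1 : left_id 1 qscale.
Proof. by move=> x; elim/quotW: x => x; rewrite !qscaleE scale1r. Qed.
Let qscaleDr : right_distributive qscale +%R.
Proof.
move=> a x y; elim/quotW: x => x; elim/quotW: y => y.
by rewrite [_ + _](qaddE x y) (qscaleE a x) (qscaleE a y) (qscaleE a (x + y)) [RHS]qaddE scalerDr.
Qed.
Let qscaleDl (x : Q) : {morph qscale^~ x : a b / a + b}.
Proof.
by move=> a b; elim/quotW: x => x; rewrite (qscaleE (a + b) x) (qscaleE a x) (qscaleE b x) [RHS]qaddE scalerDl.
Qed.

HB.instance Definition _ := GRing.Zmodule_isLmodule.Build R Q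
  qscaleA qscale1 qscaleDr qscaleDl.

Lemma quot_exists : exists (C : lmodType R) (p : {linear M -> C}),
  surj p /\ forall m, p m = 0 <-> S m.
Proof.
pose p (x : M) : Q := \pi_Q x.
have pl : linear p.
  move=> c x y; rewrite /p; symmetry.
  by rewrite [_ *: _]qscaleE [LHS]qaddE.
pose pL := GRing.isLinear.Build R _ _ _ p pl.
pose F : {linear M -> Q} := HB.pack p pL.
exists Q, F; split=> [x|m]; first by elim/quotW: x => x; exists x.
by rewrite -[S m](congr1 S (subr0 m)); exact: (piP m 0).
Qed.

End QuotModule.

(** * Direct sums *)

Lemma choice_dep (X : Type) (Y : X -> Type) (Q : forall x, Y x -> Prop) :
  (forall x, exists y, Q x y) -> exists f, forall x, Q x (f x).
Proof. by move=> h; exists (fun x => projT1 (cid (h x))) => x; case: cid. Qed.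

Section DirectSum.
Variables (R : comPzRingType) (X : choiceType) (P : X -> lmodType R).

(** Direct sums are indexed by arbitrary, possibly infinite, types and have
  terms that depend on the index. *)
Record dsum := Dsum {
  dfun :> forall x, P x;
  dfunP : exists s : seq X, forall x, x \notin s -> dfun x = 0 }.

HB.instance Definition _ := gen_eqMixin dsum.
HB.instance Definition _ := gen_choiceMixin dsum.

Lemma dsum_ext (m n : dsum) : (forall x, m x = n x) -> m = n.
Proof.
case: m n => [f fP] [g gP] /= h.
have e : f = g by apply: functional_extensionality_dep.
by case: _ / e gP {h} => gP; congr Dsum; apply: Prop_irrelevance.
Qed.

Lemma dsum0_subproof : exists s : seq X, forall x, x \notin s -> (0 : P x) = 0.
Proof. by exists [::]. Qed.
Definition dsum0 := Dsum dsum0_subproof.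

Lemma dsum_lin_subproof a (m n : dsum) :
  exists s : seq X, forall x, x \notin s -> a *: m x + n x = 0.
Proof.
have [[s hs] [t ht]] := (dfunP m, dfunP n).
exists (s ++ t) => x; rewrite mem_cat negb_or => /andP[/hs -> /ht ->].
by rewrite scaler0 addr0.
Qed.
Definition dsum_lin a m n := Dsum (dsum_lin_subproof a m n).

Definition dsum_add m n := dsum_lin 1 m n.
Definition dsum_scale a m := dsum_lin a m dsum0.
Definition dsum_opp m := dsum_lin (-1) m dsum0.

Lemma dsum_addA : associative dsum_add.
Proof. by move=> m n p; apply: dsum_ext => x /=; rewrite !scale1r addrA. Qed.
Lemma dsum_addC : commutative dsum_add.
Proof. by move=> m n; apply: dsum_ext => x /=; rewrite !scale1r addrC. Qed.
Lemma dsum_add0 : left_id dsum0 dsum_add.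
Proof. by move=> m; apply: dsum_ext => x /=; rewrite scale1r add0r. Qed.
Lemma dsum_addN : left_inverse dsum0 dsum_opp dsum_add.
Proof.
by move=> m; apply: dsum_ext => x /=; rewrite scaleN1r addr0 scale1r addNr.
Qed.
HB.instance Definition _ :=
  GRing.isZmodule.Build dsum dsum_addA dsum_addC dsum_add0 dsum_addN.

Lemma dsum_scaleA a b m :
  dsum_scale a (dsum_scale b m) = dsum_scale (a * b) m.
Proof. by apply: dsum_ext => x /=; rewrite !addr0 scalerA. Qed.
Lemma dsum_scale1 : left_id 1 dsum_scale.
Proof. by move=> m; apply: dsum_ext => x /=; rewrite addr0 scale1r. Qed.
Lemma dsum_scaleDr : right_distributive dsum_scale +%R.
Proof.
by move=> a m n; apply: dsum_ext => x /=; rewrite !addr0 !scale1r scalerDr.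
Qed.
Lemma dsum_scaleDl m : {morph dsum_scale^~ m : a b / a + b}.
Proof.
by move=> a b; apply: dsum_ext => x /=; rewrite !addr0 scale1r scalerDl.
Qed.
HB.instance Definition _ := GRing.Zmodule_isLmodule.Build R dsum
  dsum_scaleA dsum_scale1 dsum_scaleDr dsum_scaleDl.

Lemma dsumD (m n : dsum) x : (m + n) x = m x + n x.
Proof. by rewrite /= scale1r. Qed.
Lemma dsumZ a (m : dsum) x : (a *: m) x = a *: m x.
Proof. by rewrite /= addr0. Qed.
Lemma dsum00 x : (0 : dsum) x = 0.
Proof. by []. Qed.
Lemma dsumN (m : dsum) x : (- m) x = - m x.
Proof. by rewrite /= scaleN1r addr0. Qed.
Lemma dsumB (m n : dsum) x : (m - n) x = m x - n x.
Proof. by rewrite dsumD dsumN. Qed.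
Lemma dsum_sum (I : Type) (r : seq I) (Q : pred I) (F : I -> dsum) x :
  (\sum_(i <- r | Q i) F i) x = \sum_(i <- r | Q i) F i x.
Proof.
elim/big_rec2: _ => [|i y z _ <-]; first exact: dsum00.
by rewrite dsumD.
Qed.

Definition dproj_fun x (m : dsum) : P x := m x.
Lemma dproj_linear x : linear (dproj_fun x).
Proof. by move=> a m n; rewrite /dproj_fun dsumD dsumZ. Qed.
HB.instance Definition _ x :=
  GRing.isLinear.Build R dsum (P x) _ (dproj_fun x) (dproj_linear x).
Definition dproj x : {linear dsum -> P x} := dproj_fun x.

Definition dinj_val x (a : P x) (y : X) : P y :=
  if @eqP _ x y is ReflectT e then ecast z (P z) e a else 0.

Lemma dinj_val_id x (a : P x) : dinj_val a x = a.
Proof. by rewrite /dinj_val; case: eqP => // e; rewrite eq_axiomK. Qed.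

Lemma dinj_val_ne x (a : P x) y : x != y -> dinj_val a y = 0.
Proof. by rewrite /dinj_val; case: eqP. Qed.

Lemma dinj_subproof x (a : P x) :
  exists s : seq X, forall y, y \notin s -> dinj_val a y = 0.
Proof.
by exists [:: x] => y; rewrite inE eq_sym => /dinj_val_ne->.
Qed.

Definition dinj_fun x (a : P x) := Dsum (dinj_subproof a).

Lemma dinj_linear x : linear (@dinj_fun x).
Proof.
move=> c a b; apply: dsum_ext => y; rewrite dsumD dsumZ /=.
have [<-|ne] := eqVneq x y; first by rewrite !dinj_val_id.
by rewrite !dinj_val_ne // scaler0 addr0.
Qed.
HB.instance Definition _ x :=
  GRing.isLinear.Build R (P x) dsum _ (@dinj_fun x) (@dinj_linear x).
Definition dinj x : {linear P x -> dsum} := @dinj_fun x.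

Lemma dinj_id x (a : P x) : dinj x a x = a.
Proof. exact: dinj_val_id. Qed.
Lemma dinj_ne x (a : P x) y : x <> y -> dinj x a y = 0.
Proof. by move/eqP; exact: dinj_val_ne. Qed.

Lemma dsupp_exists (m : dsum) :
  exists s : seq X, uniq s /\ forall x, (x \in s) = (m x != 0).
Proof.
have [s hs] := dfunP m; exists (undup [seq x <- s | m x != 0]).
split=> [|x]; first exact: undup_uniq.
rewrite mem_undup mem_filter; case: (boolP (m x != 0)) => //= h.
by apply: contra_neqT h => /hs.
Qed.

Definition dsupp m : seq X := projT1 (cid (dsupp_exists m)).
Lemma dsupp_uniq m : uniq (dsupp m).
Proof. by rewrite /dsupp; case: cid => s []. Qed.
Lemma mem_dsupp m x : (x \in dsupp m) = (m x != 0).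
Proof. by rewrite /dsupp; case: cid => s []. Qed.

Lemma dsumE (m : dsum) : m = \sum_(x <- dsupp m) dinj x (m x).
Proof.
apply: dsum_ext => y; rewrite dsum_sum.
have [hy|hy] := boolP (y \in dsupp m).
  rewrite (bigD1_seq y) ?dsupp_uniq //= dinj_val_id big1 ?addr0 // => x /eqP ne.
  exact: dinj_ne.
rewrite big1_seq => [|x /= hx]; last first.
  by apply: dinj_val_ne; apply: contraNneq hy => <-.
by apply/eqP; rewrite -(negbK (_ == _)) -mem_dsupp.
Qed.

Lemma lin_dsumE (T : lmodType R) (f : {linear dsum -> T}) m :
  f m = \sum_(x <- dsupp m) f (dinj x (m x)).
Proof. by rewrite {1}(dsumE m) linear_sum. Qed.

(** Only the components in the support matter; this is what lets recursive
  definitions along an order use partially known families of maps. *)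
Lemma dsum_eq_lin (T : lmodType R) (f g : {linear dsum -> T}) (m : dsum) :
  (forall x, m x <> 0 -> forall a : P x, f (dinj x a) = g (dinj x a)) ->
  f m = g m.
Proof.
move=> h; rewrite !lin_dsumE; apply: eq_big_seq => x.
by rewrite mem_dsupp => /eqP hx; apply: h.
Qed.

Section Map.
Variables (T : lmodType R) (f : forall x, {linear P x -> T}).

Definition dmap_fun (m : dsum) : T := \sum_(x <- dsupp m) f x (m x).

Lemma dmap_fun_supp m (s : seq X) :
  uniq s -> {subset dsupp m <= s} -> dmap_fun m = \sum_(x <- s) f x (m x).
Proof.
move=> us sub; rewrite (bigID [pred x | x \in dsupp m]) /=.
rewrite [X in _ + X]big1 ?addr0 => [|x]; last first.
  by rewrite mem_dsupp negbK => /eqP ->; rewrite linear0.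
rewrite -big_filter; apply: perm_big; apply: uniq_perm.
- exact: dsupp_uniq.
- exact: filter_uniq.
by move=> x; rewrite mem_filter /= andb_idr //; apply: sub.
Qed.

Lemma dmap_linear : linear dmap_fun.
Proof.
move=> c m n; pose s := undup (dsupp (c *: m + n) ++ dsupp m ++ dsupp n).
have us : uniq s by apply: undup_uniq.
rewrite !(@dmap_fun_supp _ s) //; try by
  move=> x hx; rewrite mem_undup !mem_cat hx ?orbT.
rewrite scaler_sumr -big_split; apply: eq_bigr => x _.
by rewrite dsumD dsumZ linearP.
Qed.
HB.instance Definition _ :=
  GRing.isLinear.Build R dsum T _ dmap_fun dmap_linear.
Definition dmap : {linear dsum -> T} := dmap_fun.

Lemma dmap_inj x a : dmap (dinj x a) = f x a.
Proof.
rewrite /dmap /= (@dmap_fun_supp _ [:: x]) ?big_seq1 ?dinj_id //= => y.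
rewrite mem_dsupp inE; apply: contraNT => ne.
by rewrite dinj_ne //; apply/eqP; rewrite eq_sym.
Qed.

End Map.

Lemma dsum_projective : (forall x, projective (P x)) -> projective dsum.
Proof.
move=> hP A B p f ps.
have /choice_dep [h hh] : forall x, exists h : {linear P x -> A},
    forall a, p (h a) = f (dinj x a).
  move=> x; have [h hh] := hP x A B p (f \o dinj x : {linear _ -> _}) ps.
  by exists h.
exists (dmap h) => m.
rewrite -[LHS]/((p \o dmap h : {linear _ -> _}) m).
by apply: dsum_eq_lin => x _ a /=; rewrite dmap_inj hh.
Qed.

End DirectSum.

(* Otherwise [/=] exposes the representation and the lemmas above no longer
   apply. *)
Arguments dsum_lin : simpl never.
Arguments dinj_fun : simpl never.
Arguments dmap_fun : simpl never.
Arguments dinj {R X P} x.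
Arguments dmap {R X P T} f.

(** * Well-orders and triangular maps *)

Definition wf_total (X : Type) (lt : X -> X -> Prop) : Prop :=
  [/\ well_founded lt, forall x y z, lt x y -> lt y z -> lt x z &
      forall x y, [\/ lt x y, x = y | lt y x]].

Lemma wf_total_exists (X : eqType) : exists lt : X -> X -> Prop, wf_total lt.
Proof.
have [le wo] := well_ordering_principle X.
have tot x y : le x y || le y x.
  have [|z [[hz mz] _]] := wo [pred t | (t == x) || (t == y)].
    by exists x; rewrite !inE eqxx.
  move: hz; rewrite inE => /orP[] /eqP ez; subst z.
    by rewrite mz ?inE ?eqxx ?orbT.
  by rewrite (mz x) ?orbT // !inE eqxx.
have anti x y : le x y -> le y x -> x = y.
  move=> lxy lyx; have refl z : le z z by have := tot z z; rewrite orbb.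
  have [|z [_ uz]] := wo [pred t | (t == x) || (t == y)].
    by exists x; rewrite !inE eqxx.
  rewrite -(uz x) ?(uz y) //; split; rewrite ?inE ?eqxx ?orbT //.
    by move=> t; rewrite inE => /orP[] /eqP ->.
  by move=> t; rewrite inE => /orP[] /eqP ->.
have tr x y z : le x y -> le y z -> le x z.
  move=> lxy lyz.
  have [|t [[ht mt] _]] := wo [pred t | [|| t == x, t == y | t == z]].
    by exists x; rewrite !inE eqxx.
  have mx : le t x by apply: mt; rewrite !inE eqxx.
  have my : le t y by apply: mt; rewrite !inE eqxx ?orbT.
  have mz : le t z by apply: mt; rewrite !inE eqxx ?orbT.
  move: ht; rewrite inE => /or3P[] /eqP et; subst t => //.
    by rewrite (anti x y).
  by rewrite -(anti y z lyz my).
exists (fun x y => le x y /\ x <> y); split.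
- move=> x; apply: contrapT => nx.
  have [|z [[hz mz] _]] := wo [pred t | `[< ~ Acc (fun x y => le x y /\ x <> y) t >]].
    by exists x; rewrite inE; apply/asboolP.
  move: hz; rewrite inE => /asboolP; apply; split=> y [lyz ne].
  apply: contrapT => ny; apply: ne; apply: anti => //; apply: mz.
  by rewrite inE; apply/asboolP.
- move=> x y z [lxy nxy] [lyz nyz]; split; first exact: tr lxy lyz.
  by move=> e; subst z; apply: nxy; apply: anti.
- move=> x y; have [->|/eqP ne] := eqVneq x y; first by constructor 2.
  by have /orP[h|h] := tot x y; [constructor 1|constructor 3]; split=> // /esym.
Qed.

Section WfChoice.
Variables (X : choiceType) (lt : X -> X -> Prop) (lt_wf : well_founded lt).

(** Recursion along a well-founded relation whose step only asserts the existence
  of a suitable value.  The previous values are passed as a total family, which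
  makes sense since [Rel x] looks only at indices below [x]; [a0] fills the
  gaps. *)
Lemma wf_choice (A : X -> Type) (a0 : forall x, A x)
    (Rel : forall x, (forall y, A y) -> A x -> Prop) :
  (forall x f g a, (forall y, lt y x -> f y = g y) -> Rel x f a -> Rel x g a) ->
  (forall x f, (forall y, lt y x -> Rel y f (f y)) -> exists a, Rel x f a) ->
  exists f : forall x, A x, forall x, Rel x f (f x).
Proof.
move=> ext ex.
pose tot x (r : forall y, lt y x -> A y) y : A y :=
  if pselect (lt y x) is left h then r y h else a0 y.
pose F x (r : forall y, lt y x -> A y) : A x :=
  if pselect (exists a, Rel x (tot x r) a) is left h then projT1 (cid h) else a0 x.
pose f := Fix lt_wf A F.
have fE x : f x = F x (fun y _ => f y).
  apply: Fix_eq => {}x r r' e.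
  suff -> : r = r' by [].
  by apply: functional_extensionality_dep => y; apply: functional_extensionality_dep.
exists f; elim/(well_founded_ind lt_wf) => x ih.
have e y : lt y x -> tot x (fun y _ => f y) y = f y.
  by move=> h; rewrite /tot; case: pselect.
rewrite fE /F; case: pselect => [h|[]].
  by case: cid => a /= ha; apply: (ext x) ha.
have [a ha] := ex x f ih; exists a; apply: (ext x) ha => y h.
by rewrite e.
Qed.

End WfChoice.

Section Triangular.
Variables (R : comPzRingType) (X : choiceType) (lt : X -> X -> Prop).
Hypothesis lt_wo : wf_total lt.

Let lt_trans x y z : lt x y -> lt y z -> lt x z.
Proof. by case: lt_wo => _ + _; apply. Qed.
Let lt_total x y : [\/ lt x y, x = y | lt y x].
Proof. by case: lt_wo => _ _; apply. Qed.
Let lt_wf : well_founded lt.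
Proof. by case: lt_wo. Qed.

Lemma lt_irr x : ~ lt x x.
Proof. by elim/(well_founded_ind lt_wf): x => x ih h; exact: (ih x h h). Qed.

Section Supp.
Variable P : X -> lmodType R.
Implicit Types m n : dsum P.

Definition supp_lt x m := forall y, ~ lt y x -> m y = 0.
Definition supp_le x m := forall y, lt x y -> m y = 0.

Lemma supp_lt_submodule x : submodule (supp_lt x).
Proof.
split=> [y _|c m n hm hn y h]; first exact: dsum00.
by rewrite dsumD dsumZ hm // hn // scaler0 addr0.
Qed.

Lemma supp_le_lt x y m : supp_le y m -> lt y x -> supp_lt x m.
Proof.
move=> h hyx z hz; apply: h; have [h|e|//] := lt_total z y.
  by case: hz; apply: lt_trans hyx.
by case: hz; rewrite e.
Qed.

Lemma supp_lt_trans x y m : supp_lt y m -> lt y x -> supp_lt x m.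
Proof.
by move=> h hyx z hz; apply: h => hzy; apply: hz; apply: lt_trans hyx.
Qed.

Lemma supp_lt_le x m : supp_lt x m -> supp_le x m.
Proof. by move=> h y hy; apply: h => h'; apply: (@lt_irr x); apply: lt_trans h'. Qed.

Lemma supp_lt_mem x m y : supp_lt x m -> m y <> 0 -> lt y x.
Proof. by move=> h hy; apply: contrapT => /h. Qed.

Lemma supp_le_dinj x a : supp_le x (dinj x a : dsum P).
Proof. by move=> y hy; apply: dinj_ne => e; apply: (@lt_irr y); rewrite -{1}e. Qed.

Lemma supp_lt_dinj x y a : lt y x -> supp_lt x (dinj y a : dsum P).
Proof. by move=> h; apply: supp_le_lt h; apply: supp_le_dinj. Qed.

Lemma supp_le_tail x m : supp_le x m -> supp_lt x (m - dinj x (m x)).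
Proof.
move=> h y hy; rewrite dsumB; have [h'|->|h'] := lt_total x y.
- by rewrite h // (supp_le_dinj _ h') subrr.
- by rewrite dinj_id subrr.
- by case: hy.
Qed.

(** Finite supports in a total order have a largest index. *)
Lemma exists_lead m : m <> 0 -> exists2 y, m y <> 0 & supp_le y m.
Proof.
move=> hm.
suff [y hy ley] : exists2 y, y \in dsupp m &
    forall z, z \in dsupp m -> ~ lt y z.
  exists y; first by apply/eqP; rewrite -mem_dsupp.
  by move=> z hz; apply: contrapT => /eqP; rewrite -mem_dsupp => /ley.
have : dsupp m <> [::] by move=> e; apply: hm; rewrite (dsumE m) e big_nil.
elim: (dsupp m) => // x s ih _; have [->|/ih [y hy ley]] := pselect (s = [::]).
  exists x; first exact: mem_head.
  by move=> z; rewrite inE => /eqP ->; apply: lt_irr.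
have [h|e|h] := lt_total x y.
- exists y; first by rewrite inE hy orbT.
  move=> z; rewrite inE => /orP[/eqP ->|/ley //] h'.
  by apply: (@lt_irr x); apply: lt_trans h'.
- exists y; first by rewrite inE hy orbT.
  by move=> z; rewrite inE => /orP[/eqP ->|/ley //]; rewrite e; apply: lt_irr.
- exists x; first exact: mem_head.
  move=> z; rewrite inE => /orP[/eqP ->|hz h']; first exact: lt_irr.
  by apply: (ley z hz); apply: lt_trans h'.
Qed.

Definition trunc x : {linear dsum P -> dsum P} :=
  dmap (fun y => if pselect (lt y x) then dinj y else \0 : {linear _ -> _}).

Lemma trunc_id x m : supp_lt x m -> trunc x m = m.
Proof.
move=> h; rewrite -[RHS]/((idfun : {linear _ -> _}) m).
apply: dsum_eq_lin => y hy a; rewrite dmap_inj /=.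
by case: pselect => // -[]; apply: supp_lt_mem hy.
Qed.

Lemma dmap_supp_lt (F : X -> lmodType R) (g : forall y, {linear P y -> dsum F}) x m :
  (forall y, lt y x -> forall a z, ~ lt z x -> g y a z = 0) ->
  supp_lt x m -> forall z, ~ lt z x -> dmap g m z = 0.
Proof.
move=> h hm z hz; rewrite lin_dsumE dsum_sum big1_seq // => y.
rewrite mem_dsupp => /= /eqP hy; rewrite dmap_inj; apply: h hz.
exact: supp_lt_mem hy.
Qed.

End Supp.

Lemma trunc_supp P x (m : dsum P) : supp_lt x (trunc P x m).
Proof.
move=> z hz; rewrite lin_dsumE dsum_sum big1_seq // => y _.
rewrite dmap_inj; case: pselect => h /=; last exact: dsum00.
exact: (supp_lt_dinj _ h).
Qed.

Section Tri.
Variables E F : X -> lmodType R.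

(** Upper triangular maps with diagonal [e]. *)
Definition tri (e : forall x, {linear E x -> F x})
    (Phi : {linear dsum E -> dsum F}) : Prop :=
  forall x a, supp_lt x (Phi (dinj x a) - dinj x (e x a)).

Variables (e : forall x, {linear E x -> F x}) (Phi : {linear dsum E -> dsum F}).
Hypothesis hT : tri e Phi.

Lemma tri_inj x a : exists2 l, supp_lt x l & Phi (dinj x a) = dinj x (e x a) + l.
Proof. by exists (Phi (dinj x a) - dinj x (e x a)); rewrite // addrC subrK. Qed.

Lemma tri_supp_le x a : supp_le x (Phi (dinj x a)).
Proof.
have [l hl ->] := tri_inj a; move=> y hy.
by rewrite dsumD (supp_le_dinj _ hy) (supp_lt_le hl hy) addr0.
Qed.

Lemma tri_supp_lt x m : supp_lt x m -> supp_lt x (Phi m).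
Proof.
move=> hm; rewrite lin_dsumE big_seq; apply: submodule_sum.
  exact: supp_lt_submodule.
move=> y; rewrite mem_dsupp => /eqP hy.
exact: (supp_le_lt (@tri_supp_le _ _) (supp_lt_mem hm hy)).
Qed.

Lemma tri_lead x m : supp_le x m -> Phi m x = e x (m x).
Proof.
move=> h; rewrite -[m in LHS](subrK (dinj x (m x))) linearD dsumD.
rewrite (tri_supp_lt (supp_le_tail h)) ?add0r; last exact: lt_irr.
have [l hl ->] := tri_inj (m x).
by rewrite dsumD dinj_id hl ?addr0 //; apply: lt_irr.
Qed.

End Tri.

(** A cycle [m] with leading index [y] has the same leading component as some
  boundary [Phi' (dinj y w)]; subtracting it lowers the leading index, and the
  order is well-founded.  The second conclusion says that the order is
  respected by the choice of preimages. *)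
Lemma tri_exact (E' E : X -> lmodType R) (T : lmodType R)
    (e' : forall x, {linear E' x -> E x})
    (Phi' : {linear dsum E' -> dsum E}) (Phi : {linear dsum E -> T}) :
  tri e' Phi' -> (forall m, Phi (Phi' m) = 0) ->
  (forall y m, supp_le y m -> Phi m = 0 -> exists w, e' y w = m y) ->
  exact_at Phi' Phi /\
  forall x m, supp_lt x m -> Phi m = 0 -> exists2 n, supp_lt x n & Phi' n = m.
Proof.
move=> hT h0 hx.
have key y : forall m, supp_le y m -> Phi m = 0 ->
    exists2 n, supp_le y n & Phi' n = m.
  elim/(well_founded_ind lt_wf): y => y ih m hm hPm.
  have [w hw] := hx y m hm hPm.
  pose m' := m - Phi' (dinj y w).
  have hm' : supp_lt y m'.
    have [l hl] := tri_inj hT w; rewrite /m' hw => ->; rewrite opprD addrA.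
    by apply: submoduleB hl; [apply: supp_lt_submodule|apply: supp_le_tail].
  have h'0 : Phi m' = 0 by rewrite linearB hPm h0 subrr.
  have [n hn en] : exists2 n, supp_le y n & Phi' n = m'.
    have [->|/exists_lead [z hz lz]] := pselect (m' = 0).
      by exists 0; rewrite ?linear0 // => t _; apply: dsum00.
    have hzy := supp_lt_mem hm' hz.
    have [n hn <-] := ih z hzy m' lz h'0.
    by exists n => //; apply: supp_lt_le; apply: supp_le_lt hzy.
  exists (n + dinj y w); last by rewrite linearD en /m' subrK.
  by move=> t ht; rewrite dsumD hn // (supp_le_dinj _ ht) addr0.
split=> [m|x m hm hPm].
  split=> [hPm|[n <-] //].
  have [->|/exists_lead [z hz lz]] := pselect (m = 0).
    by exists 0; rewrite linear0.
  by have [n _ <-] := key z m lz hPm; exists n.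
have [->|/exists_lead [z hz lz]] := pselect (m = 0).
  by exists 0; [apply: (supp_lt_submodule _ x).1 | rewrite linear0].
have [n hn <-] := key z m lz hPm; exists n => //.
exact: supp_le_lt hn (supp_lt_mem hm hz).
Qed.

Lemma tri_exact_diag (E' E F : X -> lmodType R)
    (e' : forall x, {linear E' x -> E x}) (e : forall x, {linear E x -> F x})
    (Phi' : {linear dsum E' -> dsum E}) (Phi : {linear dsum E -> dsum F}) :
  tri e' Phi' -> tri e Phi -> (forall m, Phi (Phi' m) = 0) ->
  (forall x, exact_at (e' x) (e x)) -> exact_at Phi' Phi.
Proof.
move=> t' t h0 ex; apply: (proj1 (tri_exact t' h0 _)) => y m lm hm.
by apply/ex; rewrite -(tri_lead t lm) hm dsum00.
Qed.

(** One step of a resolution to the left.  The diagonal term [dinj x (e' x w)] need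
  not be a cycle, but its image is also the image of something below [x], which
  projectivity of [E' x] lets one choose linearly and subtract. *)
Lemma tri_left (E' E : X -> lmodType R) (T : lmodType R)
    (e' : forall x, {linear E' x -> E x}) (Phi : {linear dsum E -> T}) :
  (forall x, projective (E' x)) ->
  (forall x z, (exists w, e' x w = z) <->
     exists2 l, supp_lt x l & Phi (dinj x z) = Phi l) ->
  exists Phi' : {linear dsum E' -> dsum E},
    [/\ tri e' Phi', exact_at Phi' Phi &
     forall x m, supp_lt x m -> Phi m = 0 -> exists2 n, supp_lt x n & Phi' n = m].
Proof.
move=> pE' hyp.
have /choice_dep [psi hpsi] : forall x, exists psi : {linear E' x -> dsum E},
    forall w, supp_lt x (psi w) /\ Phi (psi w) = Phi (dinj x (e' x w)).
  move=> x; have [L [i [ii hi]]] := sub_exists (supp_lt_submodule E x).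
  have [Pi hPi] := lin_comp Phi i.
  have [N [j [ij hj]]] := sub_exists (submodule_im Pi).
  have [|p hp] := @factor_inj _ N T L j Pi ij.
    by move=> l; apply/hj; exists l.
  have [c1 hc1] := lin_comp (dinj x : {linear _ -> dsum E}) (e' x).
  have [c2 hc2] := lin_comp Phi c1.
  have [|f hf] := @factor_inj _ N T _ j c2 ij.
    move=> w; apply/hj; rewrite hc2 hc1.
    have [|l hl ->] := (hyp x (e' x w)).1; first by exists w.
    by have [l' <-] := (hi l).1 hl; exists l'; rewrite hPi.
  have [|h hh] := pE' x L N p f.
    move=> n; have [l hl] := (hj (j n)).2 (ex_intro _ n erefl).
    by exists l; apply: ij; rewrite hp.
  have [g hg] := lin_comp i h; exists g => w; rewrite hg; split.
    by apply/hi; exists (h w).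
  by rewrite -hPi -hp hh hf hc2 hc1.
pose g x : {linear E' x -> dsum E} := (dinj x \o e' x) \- psi x.
have gE x w : g x w = dinj x (e' x w) - psi x w by [].
pose Phi' := dmap g.
have t : tri e' Phi'.
  move=> x w; rewrite /Phi' dmap_inj gE addrAC subrr sub0r -scaleN1r.
  by apply: (submoduleZ _ (supp_lt_submodule E x)); case: (hpsi x w).
have h0 m : Phi (Phi' m) = 0.
  have [c hc] := lin_comp Phi Phi'; rewrite -hc.
  rewrite -[RHS]/((\0 : {linear _ -> _}) m); apply: dsum_eq_lin => x _ w.
  by rewrite hc /Phi' dmap_inj gE linearB (hpsi x w).2 subrr.
exists Phi'; have [ex fex] : exact_at Phi' Phi /\
  forall x m, supp_lt x m -> Phi m = 0 -> exists2 n, supp_lt x n & Phi' n = m.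
  apply: (tri_exact t h0) => y m lm hm; apply/hyp.
  exists (- (m - dinj y (m y))).
    rewrite -scaleN1r; apply: (submoduleZ _ (supp_lt_submodule E y)).
    exact: supp_le_tail.
  by rewrite opprB linearB hm subr0.
by split.
Qed.

(** One step to the right.  [Phi] is defined by recursion on the component: on the
  image of [e' x] it is forced by the values below [x], these forced values kill
  the image of [e'' x] because [Phi' o Phi'' = 0], and so they extend to [E x]
  by exactness of [Hom(-, dsum F)] on the diagonal. *)
Lemma tri_right (E'' E' E F : X -> lmodType R)
    (e'' : forall x, {linear E'' x -> E' x}) (e' : forall x, {linear E' x -> E x})
    (e : forall x, {linear E x -> F x})
    (Phi'' : {linear dsum E'' -> dsum E'}) (Phi' : {linear dsum E' -> dsum E}) :
  tri e'' Phi'' -> tri e' Phi' -> (forall m, Phi' (Phi'' m) = 0) ->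
  (forall x v, e' x (e'' x v) = 0) -> (forall x w, e x (e' x w) = 0) ->
  (forall x, hom_exact_at (dsum F) (e'' x) (e' x)) ->
  exists2 Phi : {linear dsum E -> dsum F}, tri e Phi & forall m, Phi (Phi' m) = 0.
Proof.
move=> t'' t' h0 ee'' ee' hx.
pose tail x w := Phi' (dinj x w) - dinj x (e' x w).
have tailS x w : supp_lt x (tail x w) by apply: t'.
(* The first clause is triangularity; the second is [Phi (Phi' w) = 0] for [w]
   in the component [x], the lower part of [Phi' w] being sent by [g]. *)
pose Rel x (g : forall y, {linear E y -> dsum F}) (k : {linear E x -> dsum F}) :=
  (forall z, supp_lt x (k z - dinj x (e x z))) /\
  forall w, k (e' x w) + dmap g (tail x w) = 0.
have [|x g IH|g hg] := wf_choice lt_wf (A := fun x => {linear E x -> dsum F})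
    (fun x => \0 : {linear _ -> _}) (Rel := Rel).
- move=> x f g k hfg [k1 k2]; split=> // w; rewrite -(k2 w); congr (_ + _).
  apply: dsum_eq_lin => y hy a; rewrite !dmap_inj hfg //.
  exact: supp_lt_mem (tailS x w) hy.
- have kill l : supp_lt x l -> dmap g (Phi' l) = 0.
    move=> hl; have [c hc] := lin_comp (dmap g) Phi'; rewrite -hc.
    rewrite -[RHS]/((\0 : {linear _ -> _}) l); apply: dsum_eq_lin => y hy w.
    rewrite hc /= -[Phi' _](subrK (dinj y (e' y w))) linearD dmap_inj addrC.
    exact: (IH y (supp_lt_mem hl hy)).2.
  pose h : {linear E' x -> dsum F} :=
    \0 \- (dmap g \o ((Phi' \o dinj x) \- (dinj x \o e' x))).
  have hE w : h w = - dmap g (tail x w) by rewrite /h /= sub0r.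
  have hS w : supp_lt x (h w).
    rewrite hE -scaleN1r; apply: (submoduleZ _ (supp_lt_submodule F x)).
    apply: dmap_supp_lt (tailS x w) => y hy a z hz.
    have [hgy _] := IH y hy; rewrite -[g y a](subrK (dinj y (e y a))) dsumD.
    by rewrite (supp_lt_trans (hgy a) hy hz) (supp_lt_dinj _ hy hz) addr0.
  have [|k0 hk0] := (hx x h).1.
    move=> v; rewrite hE /tail ee'' linear0 subr0.
    have [l hl] := tri_inj t'' v => /(congr1 Phi'); rewrite h0 linearD.
    move=> /esym/eqP; rewrite addr_eq0 => /eqP ->.
    by rewrite linearN opprK kill.
  (* Truncation restores triangularity without affecting the values on the
     image of [e' x], which already lie below [x]. *)
  have [k1 hk1] := lin_comp (trunc F x) k0.
  pose k : {linear E x -> dsum F} := (dinj x \o e x) \+ k1.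
  have kE z : k z = dinj x (e x z) + trunc F x (k0 z) by rewrite -hk1.
  exists k; split=> [z|w].
    by rewrite kE addrAC subrr add0r; apply: trunc_supp.
  by rewrite kE ee' linear0 add0r hk0 trunc_id // hE addNr.
exists (dmap g) => [x a|m]; first by rewrite dmap_inj; apply: (hg x).1.
have [c hc] := lin_comp (dmap g) Phi'; rewrite -hc.
rewrite -[RHS]/((\0 : {linear _ -> _}) m); apply: dsum_eq_lin => x _ w.
rewrite hc /= -[Phi' _](subrK (dinj x (e' x w))) linearD dmap_inj addrC.
exact: (hg x).2.
Qed.

(** The extension to [dsum F] is built by the same recursion as in [tri_right]: on
  the component [x] one corrects [h] by the contribution of lower components. *)
Lemma tri_hom (E' E F : X -> lmodType R) (Q : lmodType R)
    (e' : forall x, {linear E' x -> E x}) (e : forall x, {linear E x -> F x})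
    (Phi' : {linear dsum E' -> dsum E}) (Phi : {linear dsum E -> dsum F}) :
  tri e' Phi' -> tri e Phi -> (forall m, Phi (Phi' m) = 0) ->
  (forall x v, e x (e' x v) = 0) ->
  (forall x, hom_exact_at Q (e' x) (e x)) -> hom_exact_at Q Phi' Phi.
Proof.
move=> t' t h0 ee hx h; split=> [hPhi|[k hk] m]; last first.
  by rewrite -hk h0 linear0.
pose tail x z := Phi (dinj x z) - dinj x (e x z).
have tailS x w : supp_lt x (tail x w) by apply: t.
pose Rel x (g : forall y, {linear F y -> Q}) (k : {linear F x -> Q}) :=
  forall z, k (e x z) + dmap g (tail x z) = h (dinj x z).
have [|x g IH|g hg] := wf_choice lt_wf (A := fun x => {linear F x -> Q})
    (fun x => \0 : {linear _ -> _}) (Rel := Rel).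
- move=> x f g k hfg hk z; rewrite -(hk z); congr (_ + _).
  apply: dsum_eq_lin => y hy a; rewrite !dmap_inj hfg //.
  exact: supp_lt_mem (tailS x z) hy.
- have low l : supp_lt x l -> dmap g (Phi l) = h l.
    move=> hl; have [c hc] := lin_comp (dmap g) Phi; rewrite -hc.
    apply: dsum_eq_lin => y hy z.
    rewrite hc /= -[Phi _](subrK (dinj y (e y z))) linearD dmap_inj addrC.
    exact: (IH y (supp_lt_mem hl hy)).
  pose h' : {linear E x -> Q} :=
    (h \o dinj x) \- (dmap g \o ((Phi \o dinj x) \- (dinj x \o e x))).
  have hE z : h' z = h (dinj x z) - dmap g (tail x z) by [].
  have [|k hk] := (hx x h').1.
    move=> v; rewrite hE /tail ee linear0 subr0.
    have [l hl el] := tri_inj t' v.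
    have := congr1 Phi el; rewrite h0 linearD => /esym/eqP.
    rewrite addr_eq0 => /eqP ->; rewrite linearN opprK low // -linearD -el.
    exact: hPhi.
  by exists k => z; rewrite hk hE subrK.
exists (dmap g) => m; have [c hc] := lin_comp (dmap g) Phi; rewrite -hc.
apply: dsum_eq_lin => x _ w.
rewrite hc /= -[Phi _](subrK (dinj x (e x w))) linearD dmap_inj addrC.
exact: hg.
Qed.

End Triangular.

(** * Complete resolutions and filtered modules *)

(** Dependent choice, for sequences of terms of varying types. *)
Lemma dep_seq (A : nat -> Type) (Inv : forall i, A i -> Prop)
    (Rel : forall i, A i -> A i.+1 -> Prop) (a0 : A 0%N) :
  Inv 0%N a0 ->
  (forall i a, Inv i a -> exists2 b, Inv i.+1 b & Rel i a b) ->
  exists f : forall i, A i,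
    [/\ f 0%N = a0, forall i, Inv i (f i) & forall i, Rel i (f i) (f i.+1)].
Proof.
move=> h0 hS.
have hS' i (a : {a | Inv i a}) : {b : {b | Inv i.+1 b} | Rel i (sval a) (sval b)}.
  case: a => a ha /=; have [b hb r] := cid2 (hS i a ha).
  by exists (exist _ b hb).
pose g := nat_rect (fun i => {a | Inv i a}) (exist _ a0 h0)
  (fun i a => sval (hS' i a)).
exists (fun i => sval (g i)); split=> // i; first exact: svalP.
exact: svalP (hS' i (g i)).
Qed.

Section FG.
Variable R : comPzRingType.
Implicit Types M : lmodType R.

Definition scale_by_fun M (x : M) (r : R^o) : M := r *: x.
Lemma scale_by_linear M (x : M) : linear (scale_by_fun x).
Proof. by move=> a r s; rewrite /scale_by_fun scalerDl scalerA. Qed.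
HB.instance Definition _ M (x : M) :=
  GRing.isLinear.Build R R^o M _ (scale_by_fun x) (scale_by_linear x).
Definition scale_by M (x : M) : {linear R^o -> M} := scale_by_fun x.
Lemma scale_byE M (x : M) r : scale_by x r = r *: x. Proof. by []. Qed.

Definition combo_fun M n (s : 'I_n -> M) (u : 'rV[R]_n) : M :=
  \sum_i u 0 i *: s i.
Lemma combo_linear M n (s : 'I_n -> M) : linear (combo_fun s).
Proof.
move=> a u v; rewrite /combo_fun scaler_sumr -big_split; apply: eq_bigr => i _.
by rewrite !mxE scalerDl scalerA.
Qed.
HB.instance Definition _ M n (s : 'I_n -> M) :=
  GRing.isLinear.Build R 'rV[R]_n M _ (combo_fun s) (combo_linear s).
Definition combo M n (s : 'I_n -> M) : {linear 'rV[R]_n -> M} := combo_fun s.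
Lemma comboE M n (s : 'I_n -> M) u : combo s u = \sum_i u 0 i *: s i.
Proof. by []. Qed.

Lemma combo_row M n (s : 'I_n -> M) i : combo s (delta_mx 0 i) = s i.
Proof.
rewrite comboE (bigD1 i) //= mxE !eqxx scale1r big1 ?addr0 // => j ne.
by rewrite mxE (negPf ne) andbF scale0r.
Qed.

Lemma rV_linE M n (f : {linear 'rV[R]_n -> M}) u :
  f u = \sum_i u 0 i *: f (delta_mx 0 i).
Proof.
rewrite {1}(row_sum_delta u) linear_sum.
by apply: eq_bigr => i _; rewrite linearZ.
Qed.

Lemma n_presented0P M :
  n_presented 0 M <-> exists k (f : {linear 'rV[R]_k -> M}), surj f.
Proof.
split=> [[k [eps [_ [h _ _]]]]|[k [f hf]]]; first by exists (k 0%N), eps.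
by exists (fun _ => k), f, (fun _ => \0 : {linear _ -> _}).
Qed.

Lemma exact_comp0 (A B C : lmodType R) (f : {linear A -> B}) (g : {linear B -> C}) x :
  exact_at f g -> g (f x) = 0.
Proof. by move=> h; apply/h; exists x. Qed.

Definition short_exact (A B C : lmodType R) (i : {linear A -> B})
    (p : {linear B -> C}) : Prop := [/\ injective i, surj p & exact_at i p].

Lemma short_exact_ker (B C : lmodType R) (p : {linear B -> C}) : surj p ->
  exists (A : lmodType R) (i : {linear A -> B}), short_exact i p.
Proof.
move=> ps; have [A [i [ii hi]]] := sub_exists (submodule_ker p).
by exists A, i.
Qed.

Lemma short_exact_coker (A B : lmodType R) (i : {linear A -> B}) : injective i ->
  exists (C : lmodType R) (p : {linear B -> C}), short_exact i p.
Proof.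
move=> ii; have [C [p [ps hp]]] := quot_exists (submodule_im i).
by exists C, p.
Qed.

Lemma ring_projective : projective (R^o : lmodType R).
Proof.
move=> A B p f ps; have [a ha] := ps (f 1); exists (scale_by a) => r.
rewrite scale_byE linearZ ha -linearZ; congr (f _); exact: mulr1.
Qed.

Lemma dsum_free_projective (X : choiceType) :
  projective (dsum (fun _ : X => R^o : lmodType R)).
Proof. by apply: dsum_projective => _; apply: ring_projective. Qed.

Lemma rV_projective n : projective ('rV[R]_n : lmodType R).
Proof.
move=> A B p f ps.
have [s hs] := choice (fun i : 'I_n => ps (f (delta_mx 0 i))).
exists (combo s) => u; rewrite comboE linear_sum [RHS]rV_linE.
by apply: eq_bigr => i _; rewrite linearZ hs.
Qed.

Lemma rV0_eq0 (u : 'rV[R]_0) : u = 0.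
Proof. by apply/rowP => -[]. Qed.

End FG.

Section CompleteResolution.
Variable R : comPzRingType.

(** [... -> P_1 -> P_0] together with [P_d -> T_0 -> T_1 -> ...], to be glued at
  [P_d] into [... -> P_{d+1} -> P_d -> T_0 -> T_1 -> ...]. *)
Record cdata (d : nat) := CData {
  cP : nat -> lmodType R;
  cp : forall i, {linear cP i.+1 -> cP i};
  cT : nat -> lmodType R;
  ct0 : {linear cP d -> cT 0%N};
  ct : forall i, {linear cT i -> cT i.+1} }.

(** The glued complex is totally acyclic: exact, made of projectives, and exact
  under [Hom(-, Q)] for [Q] projective.  Below degree [d] only exactness is
  asked. *)
Definition cdata_ok d (D : cdata d) : Prop :=
  [/\ (forall i, projective (cP D i)) /\ (forall i, projective (cT D i)),
      forall i, exact_at (cp D i.+1) (cp D i),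
      [/\ exact_at (cp D d) (ct0 D), exact_at (ct0 D) (ct D 0%N) &
          forall i, exact_at (ct D i) (ct D i.+1)] &
      forall Q, projective Q ->
      [/\ forall i, (d <= i)%N -> hom_exact_at Q (cp D i.+1) (cp D i),
          hom_exact_at Q (cp D d) (ct0 D), hom_exact_at Q (ct0 D) (ct D 0%N) &
          forall i, hom_exact_at Q (ct D i) (ct D i.+1)]].

(** A resolution of [M] showing that [Gpd M <= d]: the [d]-th syzygy is a cycle of
  a totally acyclic complex. *)
Definition cres d (M : lmodType R) : Prop :=
  exists (D : cdata d) (eps : {linear cP D 0%N -> M}),
    [/\ cdata_ok D, surj eps & exact_at (cp D 0%N) eps].

Lemma cres_iso d (M N : lmodType R) (f : {linear M -> N}) :
  injective f -> surj f -> cres d M -> cres d N.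
Proof.
move=> fi fs [D [eps [ok es ex]]]; have [e he] := lin_comp f eps.
exists D, e; split=> // [y|y].
  by have [m <-] := fs y; have [x <-] := es m; exists x; rewrite he.
rewrite he; split=> [h|/ex ->]; last exact: linear0.
by apply/ex; apply: lin_inj_eq0 h.
Qed.

Lemma GP_cres0 (M : lmodType R) : Gorenstein_projective M <-> cres 0 M.
Proof.
split=> [[[L Rt l m r] [[/= pL pR] [/= e1 e2 e3 e4] [/= j [ji hj]] hQ]]|].
  pose D := @CData 0 L l Rt m r.
  have [|eps heps] := factor_inj (f := m) ji.
    by move=> x; apply/hj; exists x.
  exists D, eps; split.
  - split=> // Q /hQ [h1 h2 h3 h4].
    by split=> // i _; apply: h1.
  - move=> y; have [x hx] := (hj (j y)).1 (ex_intro _ y erefl).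
    by exists x; apply: ji; rewrite heps.
  - move=> y; rewrite -(e2 y) -heps; split=> [->|h]; first exact: linear0.
    exact: lin_inj_eq0 h.
move=> [D [eps [[[pP pT] e1 [e2 e3 e4] hQ] es ex]]].
exists (Biseq (cp D) (ct0 D) (ct D)); split=> //=.
- have [|j hj] := factor_surj (f := ct0 D) es.
    by move=> m /ex [x <-]; apply: exact_comp0.
  exists j; split.
    apply: lin_eq0_inj => a; have [x <-] := es a; rewrite hj => /e2 [y <-].
    exact: exact_comp0.
  move=> y; split=> [[m <-]|[x <-]]; last by exists (eps x).
  by have [x <-] := es m; exists x; rewrite hj.
- move=> Q /hQ [h1 h2 h3 h4]; split=> // i; exact: h1.
Qed.

Lemma cres_succ d (C P M : lmodType R) (i : {linear C -> P}) (p : {linear P -> M}) :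
  projective P -> short_exact i p -> cres d C -> cres d.+1 M.
Proof.
move=> pP [ii ps ex] [D [eps [[[pD pT] e1 e2 hQ] es ee]]].
have [c hc] := lin_comp i eps.
pose P' (n : nat) : lmodType R := if n is k.+1 then cP D k else P.
pose p' (n : nat) : {linear P' n.+1 -> P' n} :=
  match n return {linear P' n.+1 -> P' n} with 0 => c | k.+1 => cp D k end.
exists (@CData d.+1 P' p' (cT D) (ct0 D) (ct D)), p; split=> //=.
- split=> //=.
  + by split=> // -[].
  + case=> [|k] /=; last exact: e1.
    move=> y; rewrite hc; split=> [h|[x <-]].
      by apply/ee; apply: lin_inj_eq0 h.
    by rewrite (exact_comp0 _ ee) linear0.
  + by move=> Q /hQ [h1 h2 h3 h4]; split=> // -[|k] //=; apply: h1.
- move=> y; split=> [/ex [z <-]|[x <-]].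
    by have [x <-] := es z; exists x; rewrite hc.
  by rewrite hc; apply: exact_comp0 ex.
Qed.

Lemma cres_pred d (M : lmodType R) : cres d.+1 M ->
  exists (P Z : lmodType R) (i : {linear Z -> P}) (p : {linear P -> M}),
    [/\ projective P, short_exact i p & cres d Z].
Proof.
move=> [D [eps [[[pD pT] e1 e2 hQ] es ee]]].
have [Z [i se]] := short_exact_ker es; have [ii _ ex] := se.
exists (cP D 0%N), Z, i, eps; split=> //.
have [|f hf] := factor_inj (f := cp D 0%N) ii.
  by move=> x; apply/ex; apply: exact_comp0 ee.
exists (@CData d (fun n => cP D n.+1) (fun n => cp D n.+1) (cT D) (ct0 D) (ct D)), f.
split=> //=.
- split=> /=.
  + by split=> [k|k]; [apply: pD|apply: pT].
  + by move=> k; apply: e1.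
  + by [].
  + move=> Q /hQ [h1 h2 h3 h4]; split=> // k hk; exact: h1.
- move=> y; have [x hx] := (ee (i y)).1 (exact_comp0 _ ex).
  by exists x; apply: ii; rewrite hf.
- move=> y; rewrite -(e1 0%N y) -hf; split=> [->|h]; first exact: linear0.
  exact: lin_inj_eq0 h.
Qed.

(** The identity of [P], extended by zeros, is a complete resolution. *)
Lemma projective_GP (P : lmodType R) : projective P -> Gorenstein_projective P.
Proof.
move=> pP; apply/GP_cres0.
pose Z : lmodType R := 'rV[R]_0.
pose L (n : nat) : lmodType R := if n is _.+1 then Z else P.
have lZ n (f : {linear Z -> L n}) z : f z = 0 by rewrite (rV0_eq0 z) linear0.
pose D := @CData 0 L (fun _ => \0) L idfun (fun _ => \0 : {linear _ -> _}).
have pZ : projective Z by apply: rV_projective.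
have pL n : projective (L n) by case: n.
exists D, (idfun : {linear _ -> _}); split=> //.
- split=> //=.
  + by move=> n y; split=> // _; exists 0; rewrite (rV0_eq0 y).
  + split=> [y|y|n y].
    * by split=> [/= ->|[x <-]] //; exists 0.
    * by split=> // _; exists y.
    * by split=> // _; exists 0; rewrite (rV0_eq0 y).
  + move=> Q pQ; split=> [n _ h|h|h|n h] /=.
    * split=> [_|_ x]; last by rewrite linear0.
      by exists \0 => y; rewrite (rV0_eq0 y) !linear0.
    * split=> [_|[k hk] x]; last by rewrite linear0.
      by exists h.
    * split=> [h0|[k hk] x]; first by exists \0 => y; rewrite -[y]/(idfun y) h0.
      by rewrite -hk linear0.
    * split=> [_|_ x]; last by rewrite linear0.
      by exists \0 => y; rewrite (rV0_eq0 y) !linear0.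
- by move=> y; exists y.
- by move=> y; split=> [/= ->|[x <-] //]; exists 0.
Qed.

Lemma Gproj_resolution_succ d (Z G M : lmodType R) (i : {linear Z -> G})
    (p : {linear G -> M}) :
  Gorenstein_projective G -> short_exact i p -> Gproj_resolution Z d ->
  Gproj_resolution M d.+1.
Proof.
move=> gG [ii ps ex] [H [eps [dH [gH zH es ee eH]]]].
have [c hc] := lin_comp i eps.
pose P' (n : nat) : lmodType R := if n is k.+1 then H k else G.
pose p' (n : nat) : {linear P' n.+1 -> P' n} :=
  match n return {linear P' n.+1 -> P' n} with 0 => c | k.+1 => dH k end.
exists P', p, p'; split=> //=; first by case.
- by case=> // k; apply: zH.
- move=> y; split=> [/ex [z <-]|[x <-]].
    by have [x <-] := es z; exists x; rewrite hc.
  by rewrite hc; apply: exact_comp0 ex.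
- case=> [|k] /=; last exact: eH.
  move=> y; rewrite hc; split=> [h|[x <-]].
    by apply/ee; apply: lin_inj_eq0 h.
  by rewrite (exact_comp0 _ ee) linear0.
Qed.

Lemma Gproj_resolution_pred d (M : lmodType R) : Gproj_resolution M d.+1 ->
  exists (Z G : lmodType R) (i : {linear Z -> G}) (p : {linear G -> M}),
    [/\ Gorenstein_projective G, short_exact i p & Gproj_resolution Z d].
Proof.
move=> [G [eps [dG [gG zG es ee eG]]]].
have [Z [i se]] := short_exact_ker es; have [ii _ ex] := se.
exists Z, (G 0%N), i, eps; split=> //.
have [|f hf] := factor_inj (f := dG 0%N) ii.
  by move=> x; apply/ex; apply: exact_comp0 ee.
exists (fun n => G n.+1), f, (fun n => dG n.+1); split=> //.
- by move=> n hn x; apply: zG.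
- move=> y; have [x hx] := (ee (i y)).1 (exact_comp0 _ ex).
  by exists x; apply: ii; rewrite hf.
- move=> y; rewrite -(eG 0%N y) -hf; split=> [->|h]; first exact: linear0.
  exact: lin_inj_eq0 h.
Qed.

Lemma Gproj_resolution0 (M : lmodType R) :
  Gproj_resolution M 0 <-> Gorenstein_projective M.
Proof.
split=> [[G [eps [dG [gG zG es ee _]]]]|gM].
  apply/GP_cres0; have /GP_cres0 := gG 0%N; apply: (cres_iso (f := eps)) => //.
  apply: lin_eq0_inj => a /ee [x <-].
  by have -> : x = 0 by [apply: (zG 1%N)]; rewrite linear0.
pose Z : lmodType R := 'rV[R]_0.
pose L (n : nat) : lmodType R := if n is _.+1 then Z else M.
exists L, (idfun : {linear _ -> _}), (fun n => \0 : {linear _ -> _}).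
split=> //=.
- by case=> //= n; apply/projective_GP/rV_projective.
- by case=> // n _ x; apply: rV0_eq0.
- by move=> y; exists y.
- by move=> y; split=> [/= ->|[x <-] //]; exists 0.
- by move=> n y; split=> // _; exists 0; rewrite (rV0_eq0 y).
Qed.

Lemma cres_Gproj_resolution d (M : lmodType R) : cres d M -> Gproj_resolution M d.
Proof.
elim: d M => [|d ih] M; first by rewrite Gproj_resolution0 GP_cres0.
move=> /cres_pred [P [Z [i [p [pP se /ih]]]]].
by apply: Gproj_resolution_succ se; apply: projective_GP.
Qed.

Section Filtration.
Variables (X : choiceType) (lt : X -> X -> Prop) (lt_wo : wf_total lt).

(** The next differential depends on the two previous ones, so consecutive pairs
  are built. *)
Lemma tri_right_seq (U : nat -> X -> lmodType R)
    (u : forall i x, {linear U i x -> U i.+1 x})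
    (Phi0 : {linear dsum (U 0%N) -> dsum (U 1%N)})
    (Phi1 : {linear dsum (U 1%N) -> dsum (U 2%N)}) :
  (forall i x a, u i.+1 x (u i x a) = 0) ->
  (forall i x, hom_exact_at (dsum (U i.+3)) (u i x) (u i.+1 x)) ->
  tri lt (u 0%N) Phi0 -> tri lt (u 1%N) Phi1 -> (forall m, Phi1 (Phi0 m) = 0) ->
  exists Phi : forall i, {linear dsum (U i) -> dsum (U i.+1)},
    [/\ Phi 0%N = Phi0, Phi 1%N = Phi1, forall i, tri lt (u i) (Phi i) &
        forall i m, Phi i.+1 (Phi i m) = 0].
Proof.
move=> uu hu t0 t1 h0.
pose A i := ({linear dsum (U i) -> dsum (U i.+1)} *
             {linear dsum (U i.+1) -> dsum (U i.+2)})%type.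
pose Inv i (a : A i) := [/\ tri lt (u i) a.1, tri lt (u i.+1) a.2 &
  forall m, a.2 (a.1 m) = 0].
have [||f [f0 fI fR]] := @dep_seq A Inv (fun i a b => a.2 = b.1) (Phi0, Phi1).
- by [].
- move=> i [a1 a2] [ta1 ta2 a12].
  have [b tb hb] := tri_right lt_wo ta1 ta2 a12 (uu i) (uu i.+1) (hu i).
  by exists (a2, b).
exists (fun i => (f i).1); split=> [|||i m].
- by rewrite f0.
- by rewrite -(fR 0%N) f0.
- by move=> i; case: (fI i).
- by rewrite -(fR i); case: (fI i).
Qed.

(** The invariant pairs triangularity with the hypothesis under which [tri_left]
  applies again; the latter is provided by its order-respecting exactness. *)
Lemma tri_left_seq (P : nat -> X -> lmodType R)
    (p : forall i x, {linear P i.+1 x -> P i x}) (M : lmodType R)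
    (eps : {linear dsum (P 0%N) -> M}) :
  (forall i x, projective (P i x)) ->
  (forall i x, exact_at (p i.+1 x) (p i x)) ->
  (forall x z, (exists w, p 0%N x w = z) <->
     exists2 l, supp_lt lt x l & eps (dinj x z) = eps l) ->
  exists Phi : forall i, {linear dsum (P i.+1) -> dsum (P i)},
    [/\ forall i, tri lt (p i) (Phi i), exact_at (Phi 0%N) eps &
        forall i, exact_at (Phi i.+1) (Phi i)].
Proof.
move=> pP ep h0.
pose A i := {linear dsum (P i.+1) -> dsum (P i)}.
pose Inv i (a : A i) := tri lt (p i) a /\ forall x z, p i x z = 0 ->
  exists2 l, supp_lt lt x l & a (dinj x z) = a l.
have [a0 [t0 e0 f0]] := tri_left lt_wo (fun x => pP 1%N x) h0.
have [||f [f00 fI fR]] := @dep_seq A Inv (fun i a b => exact_at b a) a0.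
- split=> // x z hz.
  have [||l hl <-] := f0 x (a0 (dinj x z)); last by exists l.
    by move=> y hy; have := t0 x z y hy; rewrite hz linear0 subr0.
  exact: exact_comp0 e0.
- move=> i a [ta ha].
  have [|b [tb eb fb]] := tri_left lt_wo (e' := p i.+1) (Phi := a) (fun x => pP i.+2 x).
    move=> x z; rewrite -(ep i x z); split; first exact: ha.
    move=> [l hl e]; rewrite -(dinj_id (p i x z)).
    have := ta x z x (@lt_irr _ _ lt_wo x); rewrite dsumB e.
    rewrite (tri_supp_lt lt_wo ta hl) ?sub0r => [/eqP|]; last exact: lt_irr.
    by rewrite oppr_eq0 => /eqP.
  exists b => //; split=> // x z hz.
  have [||l hl <-] := fb x (b (dinj x z)); last by exists l.
    by move=> y hy; have := tb x z y hy; rewrite hz linear0 subr0.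
  exact: exact_comp0 eb.
exists f; split=> // [i|]; first by case: (fI i).
by rewrite f00.
Qed.

(** A module filtered along a well-order, with factors that have complete
  resolutions from degree [d] on, has one too.  The filtration is given by the
  images under [eps] of the partial sums, and the hypothesis on [cp (D x) 0] says
  that [D x] resolves the [x]-th factor. *)
Lemma cres_filtered d (D : X -> cdata d) (M : lmodType R)
    (eps : {linear dsum (fun x => cP (D x) 0%N) -> M}) :
  (forall x, cdata_ok (D x)) -> surj eps ->
  (forall x z, (exists w, cp (D x) 0%N w = z) <->
     exists2 l, supp_lt lt x l & eps (dinj x z) = eps l) ->
  cres d M.
Proof.
move=> ok es he.
pose P i x := cP (D x) i; pose p i x : {linear P i.+1 x -> P i x} := cp (D x) i.
have [||Phi [tPhi e0 ePhi]] := @tri_left_seq P p M eps _ _ he.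
- by move=> i x; case: (ok x) => -[h _] _ _ _; apply: h.
- by move=> i x; case: (ok x) => _ h _ _; apply: h.
(* The glued complex from [P_{d+2}] on; its first two differentials are already
   known and start the recursion to the right. *)
pose U (n : nat) (x : X) : lmodType R := match n with
  | 0 => P d.+2 x | 1 => P d.+1 x | 2 => P d x | k.+3 => cT (D x) k end.
pose u (n : nat) (x : X) : {linear U n x -> U n.+1 x} :=
  match n return {linear U n x -> U n.+1 x} with
  | 0 => p d.+1 x | 1 => p d x | 2 => ct0 (D x) | k.+3 => ct (D x) k end.
have pU n x : projective (U n x).
  by case: (ok x) => -[pP pT] _ _ _; case: n => [|[|[|n]]] /=; rewrite /P.
have eu n x : exact_at (u n x) (u n.+1 x).
  case: (ok x) => _ e1 [e2 e3 e4] _.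
  by case: n => [|[|[|n]]] //=; apply: e1.
have hu n x Q : projective Q -> hom_exact_at Q (u n x) (u n.+1 x).
  case: (ok x) => _ _ _ h /h [h1 h2 h3 h4].
  by case: n => [|[|[|n]]] //=; apply: h1.
have [|||||Psi [Psi0 Psi1 tPsi Psi2]] := @tri_right_seq U u (Phi d.+1) (Phi d).
- by move=> i x a; apply: exact_comp0 (eu i x).
- by move=> i x; apply: hu; apply: dsum_projective.
- exact: tPhi.
- exact: tPhi.
- by move=> m; apply: exact_comp0 (ePhi d).
have ePsi n : exact_at (Psi n) (Psi n.+1).
  exact: (tri_exact_diag lt_wo (tPsi n) (tPsi n.+1) (Psi2 n) (eu n)).
have hPsi n Q : projective Q -> hom_exact_at Q (Psi n) (Psi n.+1).
  move=> pQ; apply: (tri_hom lt_wo (tPsi n) (tPsi n.+1) (Psi2 n)) => x; last exact: hu.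
  by move=> v; apply: exact_comp0 (eu n x).
exists (@CData d (fun i => dsum (P i)) Phi (fun i => dsum (U i.+3))
  (Psi 2%N) (fun i => Psi i.+3)), eps; split=> //; split=> //=.
- split=> i; apply: dsum_projective => x; last exact: pU.
  by case: (ok x) => -[h _] _ _ _; apply: h.
- split; [|exact (ePsi 2%N)|move=> i; exact (ePsi i.+3)].
  by move: (ePsi 1%N); rewrite Psi1 => h; exact h.
- move=> Q pQ; split; [|move: (hPsi 1%N Q pQ); rewrite Psi1 => h; exact h|exact (hPsi 2%N Q pQ)|
    move=> i; exact (hPsi i.+3 Q pQ)].
  move=> i hi; apply: (tri_hom lt_wo (tPhi i.+1) (tPhi i)) => [m|x v|x].
  + exact: exact_comp0 (ePhi i).
  + by case: (ok x) => _ e _ _; apply: exact_comp0 (e i).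
  + by case: (ok x) => _ _ _ h; have [h1 _ _ _] := h Q pQ; apply: h1.
Qed.

End Filtration.

(** A filtration with two steps. *)
Lemma GP_extension (A B C : lmodType R) (i : {linear A -> B}) (p : {linear B -> C}) :
  short_exact i p -> Gorenstein_projective A -> Gorenstein_projective C ->
  Gorenstein_projective B.
Proof.
move=> [ii ps ex] /GP_cres0 [DA [eA [okA sA xA]]] /GP_cres0 [DC [eC [okC sC xC]]].
apply/GP_cres0.
pose lt (x y : bool) := ~~ x && y.
have lt_wo : wf_total lt.
  split=> [x|x y z|x y].
  - have af : Acc lt false by constructor=> y; rewrite /lt andbF.
    by case: x; [constructor=> -[]|exact: af].
  - by case: x y z => -[] [].
  - by case: x y => -[]; [constructor 2|constructor 3|constructor 1|constructor 2].
have [l hl] : exists l : {linear cP DC 0%N -> B}, forall x, p (l x) = eC x.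
  by case: (okC) => -[pP _] _ _ _; apply: pP.
have [iA hiA] := lin_comp i eA.
pose D (x : bool) := if x then DC else DA.
pose g (x : bool) : {linear cP (D x) 0%N -> B} :=
  match x return {linear cP (D x) 0%N -> B} with true => l | false => iA end.
apply: (cres_filtered lt_wo (D := D) (eps := dmap g)).
- by case.
- move=> b; have [z hz] := sC (p b).
  have [a ha] : exists a, i a = b - l z by apply/ex; rewrite linearB hl hz subrr.
  have [y hy] := sA a.
  exists (dinj true (z : cP (D true) 0%N) + dinj false (y : cP (D false) 0%N)).
  by rewrite linearD !dmap_inj /= hiA hy ha addrC subrK.
- have low (m : dsum (fun x => cP (D x) 0%N)) : supp_lt lt true m ->
      dmap g m = i (eA (m false)).
    move=> hm; rewrite -hiA -[RHS](dmap_inj g (x := false)); congr (dmap g _).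
    apply: dsum_ext => -[]; last by rewrite dinj_id.
    by rewrite (hm true) // dinj_ne.
  case=> z /=.
  + rewrite dmap_inj /= -[X in X <-> _](xC z) -hl; split=> [/ex [a ha]|[m hm ->]].
      have [y hy] := sA a; exists (dinj false (y : cP (D false) 0%N)).
        by apply: supp_lt_dinj => //; case.
      by rewrite dmap_inj /= hiA hy.
    by rewrite low //; apply: exact_comp0 ex.
  + rewrite dmap_inj /= hiA -[X in X <-> _](xA z); split=> [->|[m hm]].
      by exists 0; rewrite ?linear0 // => y _; apply: dsum00.
    have -> : m = 0 by apply: dsum_ext => y; rewrite hm // /lt andbF.
    by rewrite linear0 => /(lin_inj_eq0 ii).
Qed.

Lemma free_cover (M : lmodType R) :
  exists (F : lmodType R) (p : {linear F -> M}), projective F /\ surj p.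
Proof.
exists (dsum (fun _ : M => R^o : lmodType R)), (dmap (fun x : M => scale_by x)).
split; first exact: dsum_free_projective.
by move=> m; exists (@dinj R M (fun _ => R^o) m 1); rewrite dmap_inj scale_byE scale1r.
Qed.

End CompleteResolution.

(** * Gorenstein projective dimension of arbitrary modules *)

Section Global.
Variable R : comPzRingType.

Lemma pullback_exists (A B C : lmodType R) (f : {linear A -> C}) (g : {linear B -> C}) :
  exists (W : lmodType R) (a : {linear W -> A}) (b : {linear W -> B}),
  [/\ forall w, f (a w) = g (b w),
      forall w, a w = 0 -> b w = 0 -> w = 0 &
      forall x y, f x = g y -> exists w, a w = x /\ b w = y].
Proof.
pose S (w : A * B) := f w.1 = g w.2.
have hS : submodule S.
  split=> [|c x y hx hy]; rewrite /S /=; first by rewrite !linear0.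
  by rewrite !linearP hx hy.
have [W [i [ii hi]]] := sub_exists hS.
have [a ha] := lin_comp (fst : {linear (A * B)%type -> A}) i.
have [b hb] := lin_comp (snd : {linear (A * B)%type -> B}) i.
exists W, a, b; split=> [w|w|x y e].
- by rewrite ha hb; apply/hi; exists w.
- by rewrite ha hb => h1 h2; apply: ii; rewrite linear0; apply/pair_eqP/andP; split; apply/eqP.
- by have [w hw] := (hi (x, y)).1 e; exists w; rewrite ha hb hw.
Qed.

(** Shift the complete resolution by one. *)
Lemma GP_syzygy (G : lmodType R) : Gorenstein_projective G ->
  exists (P G' : lmodType R) (i : {linear G' -> P}) (p : {linear P -> G}),
    [/\ projective P, short_exact i p & Gorenstein_projective G'].
Proof.
move=> /GP_cres0 [D [eps [[[pD pT] e1 [e2 e3 e4] hQ] es ee]]].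
have [Z [i se]] := short_exact_ker es; have [ii _ ex] := se.
exists (cP D 0%N), Z, i, eps; split=> //.
have [|f hf] := factor_inj (f := cp D 0%N) ii.
  by move=> x; apply/ex; apply: exact_comp0 ee.
apply/GP_cres0.
pose T (n : nat) : lmodType R := if n is k.+1 then cT D k else cP D 0%N.
pose t (n : nat) : {linear T n -> T n.+1} :=
  match n return {linear T n -> T n.+1} with 0 => ct0 D | k.+1 => ct D k end.
exists (@CData R 0 (fun n => cP D n.+1) (fun n => cp D n.+1) T (cp D 0%N) t), f.
split.
- split=> /=.
  + by split=> [k|[|k]]; [apply: pD|apply: pD|apply: pT].
  + by move=> k; apply: e1.
  + by split=> //; case=> [|k]; [apply: e3|apply: e4].
  + move=> Q pQ; have [h1 h2 h3 h4] := hQ Q pQ; split=> //.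
    * by move=> k _; apply: h1.
    * exact: h1.
    * by case=> [|k]; [apply: h3|apply: h4].
- move=> y; have [x hx] := (ee (i y)).1 (exact_comp0 _ ex).
  by exists x; apply: ii; rewrite hf.
- move=> y; rewrite -(e1 0%N y) -hf; split=> [->|h]; first exact: linear0.
  exact: lin_inj_eq0 h.
Qed.

(** Pulling the extension back along the cover [G -> C] that starts a resolution
  of [C] gives an extension of [G] by [A],
  which is Gorenstein projective and covers [B] with the kernel of [G -> C]. *)
Lemma Gproj_resolution_extension d (A B C : lmodType R) (i : {linear A -> B})
    (p : {linear B -> C}) :
  short_exact i p -> Gorenstein_projective A -> Gproj_resolution C d ->
  Gproj_resolution B d.
Proof.
case: d => [|d] se gA.
  by rewrite !Gproj_resolution0; apply: GP_extension se gA.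
have [ii ps ex] := se.
move=> /Gproj_resolution_pred [Z [G [j [q [gG [ij qs exq] rZ]]]]].
have [W [a [b [abW abi abs]]]] := pullback_exists p q.
have [u hu] : exists u : {linear A -> W}, forall x, a (u x) = i x /\ b (u x) = 0.
  apply: (lin_of_rel (G := fun x w => a w = i x /\ b w = 0)) => [x|x w w'|c x x' w w'].
  - by apply: abs; rewrite linear0; apply: exact_comp0 ex.
  - move=> [h1 h2] [h3 h4]; apply/eqP; rewrite -subr_eq0; apply/eqP.
    by apply: abi; rewrite linearB ?h1 ?h3 ?h2 ?h4 subrr.
  - by move=> [h1 h2] [h3 h4]; rewrite !linearP h1 h2 h3 h4 scaler0 addr0.
have [v hv] : exists v : {linear Z -> W}, forall x, a (v x) = 0 /\ b (v x) = j x.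
  apply: (lin_of_rel (G := fun x w => a w = 0 /\ b w = j x)) => [x|x w w'|c x x' w w'].
  - by apply: abs; rewrite linear0; apply/esym; apply: exact_comp0 exq.
  - move=> [h1 h2] [h3 h4]; apply/eqP; rewrite -subr_eq0; apply/eqP.
    by apply: abi; rewrite linearB ?h1 ?h3 ?h2 ?h4 subrr.
  - by move=> [h1 h2] [h3 h4]; rewrite !linearP h1 h2 h3 h4 scaler0 addr0.
have seW : short_exact u b.
  split.
  - by apply: lin_eq0_inj => x hx; apply: (lin_inj_eq0 ii); rewrite -(hu x).1 hx linear0.
  - by move=> g; have [x hx] := ps (q g); have [w [_ hw]] := abs _ _ hx; exists w.
  - move=> w; split=> [hw|[x <-]]; last by case: (hu x).
    have [x hx] : exists x, i x = a w by apply/ex; rewrite abW hw linear0.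
    exists x; apply/eqP; rewrite -subr_eq0; apply/eqP; apply: abi.
      by rewrite linearB (hu x).1 hx subrr.
    by rewrite linearB (hu x).2 hw subrr.
have seV : short_exact v a.
  split.
  - by apply: lin_eq0_inj => x hx; apply: (lin_inj_eq0 ij); rewrite -(hv x).2 hx linear0.
  - by move=> x; have [g /esym hg] := qs (p x); have [w [hw _]] := abs _ _ hg; exists w.
  - move=> w; split=> [hw|[x <-]]; last by case: (hv x).
    have [x hx] : exists x, j x = b w by apply/exq; rewrite -abW hw linear0.
    exists x; apply/eqP; rewrite -subr_eq0; apply/eqP; apply: abi.
      by rewrite linearB (hv x).1 hw subrr.
    by rewrite linearB (hv x).2 hx subrr.
exact: Gproj_resolution_succ (GP_extension seW gA gG) seV rZ.
Qed.

(** By induction, replacing the first cover [G -> M] by a projective one [P -> M]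
  with [P -> G -> M]: the kernel is then an extension of the old kernel by a
  Gorenstein projective module. *)
Lemma Gproj_resolution_cres d (M : lmodType R) : Gproj_resolution M d -> cres d M.
Proof.
elim: d M => [|d ih] M; first by rewrite Gproj_resolution0 GP_cres0.
move=> /Gproj_resolution_pred [Z [G [i [p [gG [ii ps ex] rZ]]]]].
have [P [G' [j [q [pP [ij qs exq] gG']]]]] := GP_syzygy gG.
have [pq hpq] := lin_comp p q.
have pqs : surj pq.
  by move=> m; have [g <-] := ps m; have [x <-] := qs g; exists x.
have [C [k sek]] := short_exact_ker pqs; have [ik _ exk] := sek.
apply: (cres_succ pP sek); apply: ih.
have [|a ha] := factor_inj (f := j) ik.
  by move=> x; apply/exk; rewrite hpq (exact_comp0 x exq) linear0.
have [qk hqk] := lin_comp q k.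
have [|b hb] := factor_inj (f := qk) ii.
  by move=> x; apply/ex; rewrite hqk -hpq; apply: exact_comp0 exk.
apply: (Gproj_resolution_extension (i := a) (p := b) _ gG' rZ); split.
- by apply: lin_eq0_inj => x hx; apply: (lin_inj_eq0 ij); rewrite -ha hx linear0.
- move=> z; have [x hx] := qs (i z).
  have [c hc] : exists c, k c = x by apply/exk; rewrite hpq hx; apply: exact_comp0 ex.
  by exists c; apply: ii; rewrite hb hqk hc.
- move=> c; split=> [hc|[x <-]].
    have [x hx] : exists x, j x = k c by apply/exq; rewrite -hqk -hb hc linear0.
    by exists x; apply: ik; rewrite ha.
  by apply: ii; rewrite hb hqk ha linear0; apply: exact_comp0 exq.
Qed.

Lemma least_le (P : nat -> Prop) d :
  (forall m n, (m <= n)%N -> P m -> P n) -> (dim_le (least P) d <-> P d).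
Proof.
move=> mono; rewrite /least; case: pselect => [h|h].
  case: ex_minnP => k /asboolP hk kmin /=; split=> [hkd|hd]; first exact: mono hk.
  by apply: kmin; apply/asboolP.
by split=> // hd; case: h; exists d; apply/asboolP.
Qed.

Lemma Gpd_le (M : lmodType R) d : dim_le (Gpd M) d <-> Gproj_resolution M d.
Proof.
apply: least_le => m n mn [G [eps [dG [h1 h2 h3 h4 h5]]]].
by exists G, eps, dG; split=> // i hi; apply: h2; apply: leq_ltn_trans hi.
Qed.

Lemma Ggldim_le d :
  dim_le (Ggldim R) d <-> forall M : lmodType R, Gproj_resolution M d.
Proof.
rewrite /Ggldim; rewrite least_le; last first.
  move=> m n mn h M; have := h M; rewrite /dim_le; case: (Gpd M) => // k hk.
  exact: leq_trans hk mn.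
by split=> h M; apply/Gpd_le.
Qed.

(** Well-order [M] and filter it by the submodules generated by initial segments;
  the factors are cyclic. *)
Lemma cyclic_filtration (M : lmodType R) d :
  (forall (C : lmodType R) (q : {linear R^o -> C}), surj q -> cres d C) ->
  cres d M.
Proof.
move=> hC; have [lt lt_wo] := wf_total_exists M.
pose F (x : M) : lmodType R := R^o.
pose sigma : {linear dsum F -> M} := dmap (fun x : M => scale_by x).
have /choice_dep [cyc hcyc] : forall x : M, exists C : {C : lmodType R & {linear R^o -> C}},
    surj (projT2 C) /\ forall r, projT2 C r = 0 <->
      exists2 l, supp_lt lt x l & r *: x = sigma l.
  move=> x; have [|C [q hq]] := @quot_exists R R^o
      (fun r => exists2 l, supp_lt lt x l & r *: x = sigma l).
    split=> [|c r s [l hl hr] [l' hl' hs]].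
      by exists 0; rewrite ?scale0r ?linear0 //; apply: (supp_lt_submodule _ _ x).1.
    exists (c *: l + l'); first exact: (supp_lt_submodule _ _ x).2.
    by rewrite linearP -hr -hs scalerDl scalerA.
  by exists (existT _ C q).
pose C x := projT1 (cyc x); pose q x : {linear R^o -> C x} := projT2 (cyc x).
have qs x : surj (q x) by case: (hcyc x).
have q0 x r : q x r = 0 <-> exists2 l, supp_lt lt x l & r *: x = sigma l.
  by case: (hcyc x) => _; apply.
have /choice_dep [D hD] : forall x, exists D : cdata R d,
    exists eps : {linear cP D 0%N -> C x},
    [/\ cdata_ok D, surj eps & exact_at (cp D 0%N) eps].
  by move=> x; apply: (hC _ (q x)).
have /choice_dep [e he] := hD.
have okD x : cdata_ok (D x) by case: (he x).
have es x : surj (e x) by case: (he x).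
have ex x : exact_at (cp (D x) 0%N) (e x) by case: (he x).
have /choice_dep [a ha] : forall x, exists a : {linear cP (D x) 0%N -> R^o},
    forall z, q x (a z) = e x z.
  by move=> x; case: (okD x) => -[pP _] _ _ _; apply: pP.
pose g x : {linear cP (D x) 0%N -> M} := scale_by x \o a x.
have gE x z : g x z = a x z *: x by [].
pose eps := dmap g.
pose tau : {linear dsum (fun x => cP (D x) 0%N) -> dsum F} :=
  dmap (fun x => dinj x \o a x : {linear cP (D x) 0%N -> dsum F}).
have stau m : sigma (tau m) = eps m.
  have [c hc] := lin_comp sigma tau; rewrite -hc; apply: dsum_eq_lin => x _ z.
  rewrite hc [tau _]dmap_inj [RHS]dmap_inj gE -[LHS]/(sigma (dinj x (a x z))).
  by rewrite [LHS]dmap_inj.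
have down x m : supp_lt lt x m -> exists2 l, supp_lt lt x l & eps m = sigma l.
  move=> hm; exists (tau m); last by rewrite stau.
  apply: (dmap_supp_lt _ hm) => y hy z t ht /=.
  exact: (supp_lt_dinj lt_wo _ hy) ht.
have up x : (forall y, lt y x -> exists2 m, supp_le lt y m & eps m = y) ->
    forall l, supp_lt lt x l -> exists2 m, supp_lt lt x m & eps m = sigma l.
  move=> hx l hl; pose S (t : M) := exists2 m, supp_lt lt x m & eps m = t.
  have hS : submodule S.
    split=> [|c _ _ [m hm <-] [m' hm' <-]].
      by exists 0; rewrite ?linear0 //; apply: (supp_lt_submodule _ _ x).1.
    exists (c *: m + m'); last by rewrite linearP.
    exact: (supp_lt_submodule _ _ x).2.
  rewrite lin_dsumE big_seq; apply: (submodule_sum _ hS) => y.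
  rewrite mem_dsupp => /eqP /(supp_lt_mem hl) hy.
  rewrite dmap_inj scale_byE; apply: (submoduleZ _ hS).
  have [m hm em] := hx y hy; exists m => //; exact: (supp_le_lt lt_wo hm hy).
(* Up to the span of the elements below [x], the element [x] is [eps] of a lift
   of the generator of the cyclic factor. *)
have gen x : exists2 m, supp_le lt x m & eps m = x.
  have lt_wf : well_founded lt by case: lt_wo.
  elim/(well_founded_ind lt_wf): x => x /up upx.
  have [z hz] := es x (q x 1).
  have [l hl el] : exists2 l, supp_lt lt x l & (a x z - 1) *: x = sigma l.
    by apply/q0; rewrite linearB ha hz subrr.
  have [m hm em] := upx l hl.
  exists (dinj x z - m); last first.
    by rewrite linearB em -el /eps dmap_inj gE scalerBl scale1r opprB addrC subrK.
  move=> y hy; rewrite dsumB (supp_le_dinj lt_wo _ hy).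
  by rewrite (supp_lt_le lt_wo hm hy) subrr.
apply: (cres_filtered lt_wo (eps := eps) okD).
- by move=> x; have [m _ <-] := gen x; exists m.
- move=> x z; rewrite -[X in X <-> _](ex x z) -ha q0.
  rewrite [eps (dinj x z)]dmap_inj gE; split=> -[l hl ->].
    by have [m hm <-] := up x (fun y _ => gen y) l hl; exists m.
  exact: down.
Qed.

Lemma G_0d_ring_iff d : G_nd_ring R 0 d <-> forall M : lmodType R, Gproj_resolution M d.
Proof.
split=> [h M|h M _]; last exact/Gpd_le.
apply: cres_Gproj_resolution; apply: cyclic_filtration => C q qs.
apply: Gproj_resolution_cres; apply/Gpd_le/h/n_presented0P.
exists 1%N; have [f hf] := lin_comp q (combo (fun _ : 'I_1 => (1 : R^o))).
exists f => c; have [r <-] := qs c; exists (const_mx r).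
by rewrite hf comboE big_ord1 mxE; congr (q _); apply: mulr1.
Qed.

Lemma semisimple_iff : G_semisimple R <-> forall M : lmodType R, Gproj_resolution M 0.
Proof. by split=> h M; apply/Gproj_resolution0. Qed.

End Global.

(** * Tensor products and flatness *)

Section Tensor.
Variable R : comPzRingType.
Implicit Types U V W A B C : lmodType R.

Lemma tens0l U V (v : V) : tens (0 : U) v = 0.
Proof. by rewrite -(scale0r (0 : U)) tensZl scale0r. Qed.
Lemma tens0r U V (u : U) : tens u (0 : V) = 0.
Proof. by rewrite -(scale0r (0 : V)) tensZr scale0r. Qed.

Lemma tens_suml U V (I : Type) (r : seq I) (P : pred I) (F : I -> U) (v : V) :
  tens (\sum_(i <- r | P i) F i) v = \sum_(i <- r | P i) tens (F i) v.
Proof. by apply: (big_morph (fun u => tens u v)) => [u u'|]; rewrite ?tensDl ?tens0l. Qed.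

Lemma tens_sumr U V (I : Type) (r : seq I) (P : pred I) (F : I -> V) (u : U) :
  tens u (\sum_(i <- r | P i) F i) = \sum_(i <- r | P i) tens u (F i).
Proof. by apply: (big_morph (fun v => tens u v)) => [v v'|]; rewrite ?tensDr ?tens0r. Qed.

Lemma tensorE U V (x : tensor U V) : exists n (u : 'I_n -> U) (v : 'I_n -> V),
  x = \sum_i tens (u i) (v i).
Proof.
elim/quotW: x => s; exists (size s), (fun i => (tnth (in_tuple s) i).1),
  (fun i => (tnth (in_tuple s) i).2).
by rewrite tensor_piE big_tnth.
Qed.

Lemma tensor_eq_lin U V W (f g : {linear tensor U V -> W}) :
  (forall u v, f (tens u v) = g (tens u v)) -> f =1 g.
Proof.
move=> h x; have [n [u [v ->]]] := tensorE x.
by rewrite !linear_sum; apply: eq_bigr => i _.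
Qed.

(** A bilinear map out of [B] descends to a quotient of [B] when it kills the
  kernel. *)
Lemma tensor_desc B C V W (p : {linear B -> C}) (b : B -> V -> W) :
  surj p ->
  (forall a y y' v, b (a *: y + y') v = a *: b y v + b y' v) ->
  (forall a y v v', b y (a *: v + v') = a *: b y v + b y v') ->
  (forall y v, p y = 0 -> b y v = 0) ->
  exists L : {linear tensor C V -> W}, forall y v, L (tens (p y) v) = b y v.
Proof.
move=> ps bl br b0; have [s hs] := choice ps.
have wd y y' v : p y = p y' -> b y v = b y' v.
  move=> e; have -> : y = 1 *: (y - y') + y' by rewrite scale1r subrK.
  by rewrite bl b0 ?scaler0 ?add0r // linearB e subrr.
have bD y y' v : b (y + y') v = b y v + b y' v by have := bl 1 y y' v; rewrite !scale1r.
have bDr y v v' : b y (v + v') = b y v + b y v' by have := br 1 y v v'; rewrite !scale1r.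
have b0l v : b 0 v = 0 by apply: b0; rewrite linear0.
have b0r y : b y 0 = 0 by apply: (addrI (b y 0)); rewrite -bDr !addr0.
have [||||L [hL _]] := @tensor_universal R C V W (fun c v => b (s c) v).
- by move=> u u' v; rewrite -bD; apply: wd; rewrite linearD !hs.
- by move=> u v v'; rewrite bDr.
- move=> a u v; rewrite -[RHS]addr0 -(b0l v) -bl addr0; apply: wd.
  by rewrite linearZ !hs.
- by move=> a u v; rewrite -[a *: v]addr0 br b0r addr0.
by exists L => y v; rewrite hL; apply: wd; rewrite hs.
Qed.

Lemma tensor_map_surj B C V (p : {linear B -> C}) : surj p -> surj (tensor_map p V).
Proof.
move=> ps x; have [n [u [v ->]]] := tensorE x.
have [s hs] := choice (fun i => ps (u i)).
exists (\sum_i tens (s i) (v i)); rewrite linear_sum.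
by apply: eq_bigr => i _; rewrite /= tensor_mapE hs.
Qed.

Lemma tensor_map_comp A B C V (f : {linear A -> B}) (g : {linear B -> C})
    (h : {linear A -> C}) x :
  (forall a, h a = g (f a)) -> tensor_map h V x = tensor_map g V (tensor_map f V x).
Proof.
move=> e; have [c hc] := lin_comp (tensor_map g V) (tensor_map f V).
rewrite -hc; apply: (tensor_eq_lin (f := tensor_map h V) (g := c)) => u v.
by rewrite /= hc /= !tensor_mapE e.
Qed.

Lemma tensor_map0 A B V (f : {linear A -> B}) x :
  (forall a, f a = 0) -> tensor_map f V x = 0.
Proof.
move=> e; have [n [u [v ->]]] := tensorE x.
by rewrite linear_sum big1 // => i _; rewrite /= tensor_mapE e tens0l.
Qed.

(** Right exactness: the inverse of [coker (f (x) V) -> C (x) V] is defined on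
  generators by lifting along [p]. *)
Lemma tensor_map_exact A B C V (f : {linear A -> B}) (p : {linear B -> C}) :
  surj p -> exact_at f p -> exact_at (tensor_map f V) (tensor_map p V).
Proof.
move=> ps ex y; split=> [hy|[x <-]]; last first.
  have [c hc] := lin_comp p f.
  rewrite /= -(tensor_map_comp x hc); apply: tensor_map0 => a.
  by rewrite hc; apply: exact_comp0 ex.
have [Q [q [qs hq]]] := quot_exists (submodule_im (tensor_map f V)).
have [|||L hL] := tensor_desc (b := fun b v => q (tens b v)) ps.
- by move=> a b b' v; rewrite tensDl tensZl linearP.
- by move=> a b v v'; rewrite tensDr tensZr linearP.
- by move=> b v /ex [a <-]; apply/hq; exists (tens a v); rewrite /= tensor_mapE.
apply/hq; have [c hc] := lin_comp L (tensor_map p V).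
have <- : c y = q y by apply: tensor_eq_lin => u v; rewrite hc /= tensor_mapE hL.
by rewrite hc hy linear0.
Qed.

Lemma tensor_swap_exists U V : exists s : {linear tensor U V -> tensor V U},
  forall u v, s (tens u v) = tens v u.
Proof.
have [||||L [hL _]] := @tensor_universal R U V (tensor V U) (fun u v => tens v u).
- by move=> *; rewrite tensDr.
- by move=> *; rewrite tensDl.
- by move=> *; rewrite tensZr.
- by move=> *; rewrite tensZl.
by exists L.
Qed.

Definition swap U V : {linear tensor U V -> tensor V U} :=
  projT1 (cid (tensor_swap_exists U V)).
Arguments swap : simpl never.
Lemma swapE U V (u : U) (v : V) : swap U V (tens u v) = tens v u.
Proof. by rewrite /swap; case: cid. Qed.
Lemma swapK U V x : swap V U (swap U V x) = x.
Proof.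
have [c hc] := lin_comp (swap V U) (swap U V).
rewrite -hc -[RHS]/((idfun : {linear _ -> _}) x); apply: tensor_eq_lin => u v.
by rewrite hc !swapE.
Qed.

Lemma tensor_mapr_exists U V V' (g : {linear V -> V'}) :
  exists f : {linear tensor U V -> tensor U V'},
    forall x, f x = swap V' U (tensor_map g U (swap U V x)).
Proof. by exists (swap V' U \o tensor_map g U \o swap U V : {linear _ -> _}). Qed.

Definition tensor_mapr U V V' (g : {linear V -> V'}) :
    {linear tensor U V -> tensor U V'} := projT1 (cid (tensor_mapr_exists U g)).
Arguments tensor_mapr : simpl never.

Lemma tensor_maprE U V V' (g : {linear V -> V'}) x :
  tensor_mapr U g x = swap V' U (tensor_map g U (swap U V x)).
Proof. by rewrite /tensor_mapr; case: cid. Qed.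

Lemma tensor_mapr_tens U V V' (g : {linear V -> V'}) u v :
  tensor_mapr U g (tens u v) = tens u (g v).
Proof. by rewrite tensor_maprE swapE tensor_mapE swapE. Qed.

Lemma tensor_mapr_inj U V V' (g : {linear V -> V'}) :
  injective (tensor_mapr U g) <-> injective (tensor_map g U).
Proof.
split=> h; apply: lin_eq0_inj => x hx.
  rewrite -(swapK x) (_ : swap V U x = 0) ?linear0 //.
  by apply: (lin_inj_eq0 h); rewrite tensor_maprE swapK hx linear0.
rewrite -(swapK x) (_ : swap U V x = 0) ?linear0 //.
apply: (lin_inj_eq0 h); rewrite /= -(swapK (tensor_map _ _ _)).
by rewrite -tensor_maprE hx linear0.
Qed.

Lemma tensor_mapr_surj U V V' (g : {linear V -> V'}) : surj g -> surj (tensor_mapr U g).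
Proof.
move=> gs y; have [x hx] := tensor_map_surj (V := U) gs (swap _ _ y).
by exists (swap _ _ x); rewrite tensor_maprE swapK hx swapK.
Qed.

Lemma tensor_mapr_exact A B C U (f : {linear A -> B}) (p : {linear B -> C}) :
  surj p -> exact_at f p -> exact_at (tensor_mapr U f) (tensor_mapr U p).
Proof.
move=> ps ex y; have e := tensor_map_exact (V := U) ps ex.
split=> [hy|[x <-]].
  have /e [x hx] : tensor_map p U (swap _ _ y) = 0.
    by rewrite /= -(swapK (tensor_map _ _ _)) -tensor_maprE hy linear0.
  by exists (swap _ _ x); rewrite tensor_maprE swapK hx swapK.
by rewrite !tensor_maprE swapK (exact_comp0 _ e) linear0.
Qed.

Lemma tensor_bimap U U' V V' (f : {linear U -> U'}) (g : {linear V -> V'}) x :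
  tensor_map f V' (tensor_mapr U g x) = tensor_mapr U' g (tensor_map f V x).
Proof.
have [c hc] := lin_comp (tensor_map f V') (tensor_mapr U g).
have [d hd] := lin_comp (tensor_mapr U' g) (tensor_map f V).
rewrite -hc -hd; apply: tensor_eq_lin => u v.
by rewrite hc hd /= tensor_mapr_tens !tensor_mapE tensor_mapr_tens.
Qed.

(** Balance of [Tor]: when [F0] and [L] are flat, the hypothesis on [f] and the
  conclusion both say that [Tor_1(I, N'') = 0], computed from one sequence or
  the other.  The proof is a chase in the square of the two sequences. *)
Lemma tor_balance (N L N'' F1 F0 I : lmodType R) (i : {linear N -> L}) (p : {linear L -> N''})
    (f : {linear F1 -> F0}) (g : {linear F0 -> I}) :
  short_exact i p -> short_exact f g ->
  injective (tensor_map i F0) -> injective (tensor_map f N'') ->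
  injective (tensor_map i I).
Proof.
move=> [ii ps exp] [fi gs exg] hi /tensor_mapr_inj hf.
have eL := tensor_mapr_exact (U := L) gs exg.
have eN := tensor_mapr_exact (U := N) gs exg.
have e1 := tensor_map_exact (V := F1) ps exp.
have e0 := tensor_map_exact (V := F0) ps exp.
apply: lin_eq0_inj => x hx; have [x0 hx0] := tensor_mapr_surj (U := N) gs x.
have /eL [y hy] : tensor_mapr L g (tensor_map i F0 x0) = 0.
  by rewrite -tensor_bimap hx0.
have /e1 [y' hy'] : tensor_map p F1 y = 0.
  by apply: (lin_inj_eq0 hf); rewrite -tensor_bimap hy; apply: exact_comp0 e0.
have e : tensor_mapr N f y' = x0.
  by apply: hi; rewrite [LHS]tensor_bimap -hy; congr (tensor_mapr L f _).
by rewrite -hx0 -e; apply: exact_comp0 eN.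
Qed.

End Tensor.

Section Equational.
Variable R : comPzRingType.
Implicit Types F M : lmodType R.

(** The row vector [s D], for a row vector [s] with entries in a module. *)
Definition act M b n (s : 'I_b -> M) (D : 'M[R]_(b, n)) (j : 'I_n) : M :=
  \sum_i D i j *: s i.

Lemma act_mul M a b n (s : 'I_a -> M) (A : 'M[R]_(a, b)) (D : 'M[R]_(b, n)) j :
  act (act s A) D j = act s (A *m D) j.
Proof.
rewrite /act (eq_bigr (fun i => \sum_k (D i j * A k i) *: s k)); last first.
  by move=> i _; rewrite scaler_sumr; apply: eq_bigr => k _; rewrite scalerA.
rewrite exchange_big; apply: eq_bigr => k _ /=; rewrite mxE scaler_suml.
by apply: eq_bigr => i _; rewrite mulrC.
Qed.

Lemma act_lin (M N : lmodType R) b n (f : {linear M -> N}) (s : 'I_b -> M) (D : 'M[R]_(b, n)) j :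
  f (act s D j) = act (fun i => f (s i)) D j.
Proof. by rewrite linear_sum; apply: eq_bigr => i _; rewrite linearZ. Qed.

Lemma eq_act M b n (s s' : 'I_b -> M) (D : 'M[R]_(b, n)) j :
  (forall i, s i = s' i) -> act s D j = act s' D j.
Proof. by move=> e; apply: eq_bigr => i _; rewrite e. Qed.

Lemma act0 M b n (s : 'I_b -> M) j : act s (0 : 'M[R]_(b, n)) j = 0.
Proof. by rewrite /act big1 // => i _; rewrite mxE scale0r. Qed.

Lemma actB M b n (s s' : 'I_b -> M) (D : 'M[R]_(b, n)) j :
  act (fun i => s i - s' i) D j = act s D j - act s' D j.
Proof. by rewrite /act -sumrB; apply: eq_bigr => i _; rewrite scalerBr. Qed.

(** The equational criterion for flatness: relations in [F] are consequences
  of relations in [R]. *)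
Definition equational F : Prop :=
  forall b n (s : 'I_b -> F) (D : 'M[R]_(b, n)), (forall j, act s D j = 0) ->
  exists a (A : 'M[R]_(a, b)) (t : 'I_a -> F),
    A *m D = 0 /\ forall i, s i = act t A i.

Lemma equational_retract (F Q : lmodType R) (i : {linear Q -> F}) (r : {linear F -> Q}) :
  (forall x, r (i x) = x) -> equational F -> equational Q.
Proof.
move=> ri hF b n s D hs.
have [|a [A [t [hA ht]]]] := hF b n (fun k => i (s k)) D.
  by move=> j; rewrite -act_lin hs linear0.
exists a, A, (fun k => r (t k)); split=> // k.
by rewrite -act_lin -ht ri.
Qed.

Lemma equational_free (X : choiceType) : equational (dsum (fun _ : X => R^o : lmodType R)).
Proof.
move=> b n s D hs; pose S := undup (flatten [seq dsupp (s i) | i <- enum 'I_b]).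
have uS : uniq S by apply: undup_uniq.
have sS i x : x \notin S -> s i x = 0.
  rewrite mem_undup => hx; apply/eqP; rewrite -[_ == _]negbK -mem_dsupp.
  apply: contraNN hx => hx; apply/flattenP; exists (dsupp (s i)) => //.
  by apply/mapP; exists i; rewrite ?mem_enum.
exists (size S), (\matrix_(k, i) (s i (tnth (in_tuple S) k) : R)),
  (fun k => @dinj R X (fun _ => R^o) (tnth (in_tuple S) k) (1 : R^o)); split.
  apply/matrixP => k j; rewrite !mxE.
  have := congr1 (fun m : dsum _ => m (tnth (in_tuple S) k)) (hs j).
  rewrite dsum_sum dsum00 => e; rewrite -[RHS]e; apply: eq_bigr => i _.
  by rewrite mxE dsumZ mulrC.
move=> i; apply: dsum_ext => x; rewrite /act dsum_sum.
have tr (F : X -> R^o) : \sum_(k < size S) F (tnth (in_tuple S) k) = \sum_(y <- S) F y.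
  by rewrite (big_tnth _ _ S).
rewrite (eq_bigr (fun k => s i (tnth (in_tuple S) k) *:
    @dinj R X (fun _ => R^o) (tnth (in_tuple S) k) (1 : R^o) x)); last first.
  by move=> k _; rewrite dsumZ mxE.
rewrite (tr (fun y => s i y *: @dinj R X (fun _ => R^o) y (1 : R^o) x)).
have [xS|xS] := boolP (x \in S).
  rewrite (bigD1_seq x) // big1 ?addr0 => [|y /eqP ne].
    by rewrite dinj_id [RHS]addr0 -[RHS]/((s i x : R) * 1) mulr1.
  by rewrite dinj_ne // scaler0.
rewrite sS // big1_seq // => y /andP[_ hy]; rewrite dinj_ne ?scaler0 // => e.
by rewrite -e hy in xS.
Qed.

Lemma projective_equational (Q : lmodType R) : projective Q -> equational Q.
Proof.
move=> pQ; pose F := dsum (fun _ : Q => R^o : lmodType R).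
pose p : {linear F -> Q} := dmap (fun x : Q => scale_by x).
have [|i hi] := pQ F Q p (idfun : {linear _ -> _}).
  move=> m; exists (@dinj R Q (fun _ => R^o) m (1 : R^o)).
  by rewrite [p _]dmap_inj scale_byE scale1r.
by apply: (equational_retract (i := i) (r := p) hi); apply: equational_free.
Qed.

(** If [J] is the row space of [D], then [R^b (x) F -> J (x) F] has as kernel the
  vectors generated by the relations between the rows of [D]. *)
Lemma equational_test F :
  (forall n (J : lmodType R) (j : {linear J -> 'rV[R]_n}),
     injective j -> injective (tensor_map j F)) -> equational F.
Proof.
move=> hF b n s D hs.
pose f : {linear 'rV[R]_b -> 'rV[R]_n} := mulmxr D.
have [J [j [ij hj]]] := sub_exists (submodule_im f).
have [|p hp] := factor_inj (f := f) ij.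
  by move=> u; apply/hj; exists u.
have ps : surj p.
  move=> y; have [u hu] := (hj (j y)).2 (ex_intro _ y erefl).
  by exists u; apply: ij; rewrite hp.
have rowD i : j (p (delta_mx 0 i)) = \sum_k D i k *: delta_mx 0 k.
  rewrite hp /f /= -rowE [LHS]row_sum_delta; apply: eq_bigr => k _.
  by rewrite mxE.
(* The relation [s D = 0] says that this tensor vanishes in [R^n (x) F]. *)
pose x := \sum_i tens (p (delta_mx 0 i)) (s i).
have x0 : x = 0.
  apply: (lin_inj_eq0 (hF n J j ij)); rewrite linear_sum.
  rewrite (eq_bigr (fun i => \sum_k tens (delta_mx 0 k : 'rV[R]_n) (D i k *: s i))); last first.
    move=> i _; rewrite /= tensor_mapE rowD tens_suml; apply: eq_bigr => k _.
    by rewrite tensZl tensZr.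
  rewrite exchange_big big1 // => k _ /=; rewrite -tens_sumr.
  by rewrite [X in tens _ X](hs k) tens0r.
pose FB : lmodType R := {ffun 'I_b -> F}.
pose S (w : FB) := exists a (A : 'M[R]_(a, b)) (t : 'I_a -> F),
    A *m D = 0 /\ forall i, w i = act t A i.
have hS : submodule S.
  split.
    exists 0%N, 0, (fun _ => 0); split=> [|i]; first by rewrite mul0mx.
    by rewrite ffunE act0.
  move=> c w w' [a [A [t [hA ht]]]] [a' [A' [t' [hA' ht']]]].
  exists (a + a')%N, (col_mx A A'),
    (fun k => match split k with inl k => c *: t k | inr k => t' k end); split.
    by rewrite mul_col_mx hA hA' col_mx0.
  move=> i; rewrite !ffunE ht ht' /act big_split_ord /= scaler_sumr.
  congr (_ + _); apply: eq_bigr => k _.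
    by rewrite col_mxEu (unsplitK (inl k)) !scalerA mulrC.
  by rewrite col_mxEd (unsplitK (inr k)).
have [C [q [qs hq]]] := quot_exists hS.
pose bl (u : 'rV[R]_b) (z : F) : FB := [ffun i => u 0 i *: z].
have [|||L hL] := tensor_desc (b := fun u z => q (bl u z)) ps.
- move=> c u u' z; rewrite -linearP; congr (q _); apply/ffunP => i.
  by rewrite !ffunE !mxE scalerDl scalerA.
- move=> c u z z'; rewrite -linearP; congr (q _); apply/ffunP => i.
  by rewrite !ffunE scalerDr !scalerA mulrC.
- move=> u z hu; apply/hq; exists 1%N, u, (fun _ => z); split.
    by rewrite -[LHS]/(f u) -hp hu linear0.
  by move=> i; rewrite ffunE /act big_ord1.
have : q [ffun i => s i] = 0.
  rewrite -(linear0 L) -x0 linear_sum.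
  rewrite (eq_bigr (fun i => q (bl (delta_mx 0 i) (s i)))) => [|i _]; last exact: hL.
  rewrite -linear_sum; congr (q _); apply/ffunP => k; rewrite ffunE sum_ffunE.
  rewrite (bigD1 k) //= ffunE mxE !eqxx scale1r big1 ?addr0 // => i ne.
  by rewrite ffunE mxE [k == i]eq_sym (negPf ne) andbF scale0r.
move=> /hq [a [A [t [hA ht]]]]; exists a, A, t; split=> // i.
by rewrite -ht ffunE.
Qed.

(** For a submodule of a free module, a vanishing tensor is a relation with
  coefficients in [R], which the criterion trivializes.  A general inclusion
  [A -> B] is pulled back to a free cover of [B]. *)
Lemma equational_flat F : equational F -> flat F.
Proof.
move=> hF A B i ii.
pose Fr := dsum (fun _ : B => R^o : lmodType R).
have free (K : lmodType R) (k : {linear K -> Fr}) : injective k ->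
    injective (tensor_map k F).
  move=> ik; apply: lin_eq0_inj => y; have [b [a [s ->]]] := tensorE y.
  rewrite linear_sum => hy.
  pose S := undup (flatten [seq dsupp (k (a i)) | i <- enum 'I_b]).
  have sS l x : x \notin S -> k (a l) x = 0.
    rewrite mem_undup => hx; apply/eqP; rewrite -[_ == _]negbK -mem_dsupp.
    apply: contraNN hx => hx; apply/flattenP; exists (dsupp (k (a l))) => //.
    by apply/mapP; exists l; rewrite ?mem_enum.
  have coord x : \sum_l (k (a l) x : R) *: s l = 0.
    have [||||L [hL _]] := @tensor_universal R Fr F F (fun w z => (w x : R) *: z).
    - by move=> w w' z; rewrite dsumD scalerDl.
    - by move=> w z z'; rewrite scalerDr.
    - by move=> c w z; rewrite dsumZ scalerA.
    - by move=> c w z; rewrite !scalerA mulrC.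
    transitivity (L (\sum_l tensor_map k F (tens (a l) (s l)))); last first.
      by rewrite hy linear0.
    by rewrite linear_sum; apply: eq_bigr => l _; rewrite /= tensor_mapE hL.
  have [|c [C [t [hC ht]]]] := hF b (size S) s
      (\matrix_(l, j) (k (a l) (tnth (in_tuple S) j) : R)).
    move=> j; rewrite -(coord (tnth (in_tuple S) j)).
    by apply: eq_bigr => l _; rewrite mxE.
  have rel r : \sum_l C r l *: a l = 0.
    apply: (lin_inj_eq0 ik); rewrite linear_sum; apply: dsum_ext => x.
    rewrite dsum_sum dsum00; have [xS|xS] := boolP (x \in S); last first.
      by rewrite big1 // => l _; rewrite linearZ dsumZ sS // scaler0.
    have /seq_tnthP [j ->] := xS.
    have := congr1 (fun M : 'M[R]_(_, _) => M r j) hC; rewrite !mxE => e.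
    rewrite -[RHS]e; apply: eq_bigr => l _.
    by rewrite linearZ dsumZ mxE.
  rewrite (eq_bigr (fun l => \sum_r tens (C r l *: a l) (t r))); last first.
    move=> l _; rewrite ht tens_sumr; apply: eq_bigr => r _.
    by rewrite tensZr tensZl.
  by rewrite exchange_big big1 // => r _ /=; rewrite -tens_suml rel tens0l.
pose q : {linear Fr -> B} := dmap (fun x : B => scale_by x).
have qs : surj q.
  move=> m; exists (@dinj R B (fun _ => R^o) m (1 : R^o)).
  by rewrite [q _]dmap_inj scale_byE scale1r.
have [K [r [k [rk h0 hK]]]] := pullback_exists i q.
have ik : injective k.
  apply: lin_eq0_inj => w hw; apply: h0 => //.
  by apply: (lin_inj_eq0 ii); rewrite rk hw linear0.
have rs : surj r.
  by move=> a; have [w hw] := qs (i a); have [z [hz _]] := hK a w (esym hw); exists z.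
have [N [n [ni _ exn]]] := short_exact_ker qs.
have [|n' hn'] := factor_inj (f := n) ik.
  move=> x; have [|z [_ hz]] := hK 0 (n x); last by exists z.
  by rewrite linear0 (exact_comp0 _ exn).
have exr : exact_at n' r.
  move=> z; split=> [hz|[x <-]].
    have /exn [x hx] : q (k z) = 0 by rewrite -rk hz linear0.
    by exists x; apply: ik; rewrite hn'.
  by apply: ii; rewrite rk hn' linear0; apply: exact_comp0 exn.
apply: lin_eq0_inj => x hx; have [y hy] := tensor_map_surj (V := F) rs x.
have [c hc] := lin_comp i r.
have /(tensor_map_exact (V := F) qs exn) [z hz] : tensor_map q F (tensor_map k F y) = 0.
  rewrite /= -(tensor_map_comp _ (h := c)) => [|w]; last by rewrite hc rk.
  by rewrite /= (tensor_map_comp _ hc) hy.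
have e : tensor_map n' F z = y.
  apply: (free K k ik); rewrite -hz; apply/esym/tensor_map_comp => w.
  by rewrite hn'.
by rewrite -hy -e; apply: exact_comp0 (tensor_map_exact (V := F) rs exr).
Qed.

Lemma flat_equational F : flat F <-> equational F.
Proof.
split=> [h|]; last exact: equational_flat.
by apply: equational_test => n J j; apply: h.
Qed.

Lemma projective_flat (P : lmodType R) : projective P -> flat P.
Proof. by move=> /projective_equational /equational_flat. Qed.

End Equational.

(** * Enough injectives *)

Section Baer.
Variable R : comPzRingType.

Definition baer (E : lmodType R) : Prop :=
  forall (J : lmodType R) (j : {linear J -> R^o}) (f : {linear J -> E}),
  injective j -> exists e, forall x, f x = (j x : R) *: e.

(** Baer's criterion.  Instead of a maximal partial extension, the value of the
  extension at each element [x] of a well-ordered [B] is chosen in turn: it has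
  to agree with the previous values on the ideal of scalars that send [x] into
  what is generated so far. *)
Lemma baer_injective (E : lmodType R) : baer E -> injective_module E.
Proof.
move=> bE A B i f ii; have [lt lt_wo] := wf_total_exists B.
have lt_wf : well_founded lt by case: lt_wo.
pose F (x : B) : lmodType R := R^o.
pose sigma : {linear dsum F -> B} := dmap (fun x : B => scale_by x).
pose gam (g : B -> E) : {linear dsum F -> E} := dmap (fun x : B => scale_by (g x)).
pose Rel x (g : B -> E) (e : E) := forall r a w, supp_lt lt x w ->
  i a + sigma w = r *: x -> f a + gam g w = r *: e.
have kill g (a : A) (w : dsum F) : (forall y, w y <> 0 -> Rel y g (g y)) ->
    i a + sigma w = 0 -> f a + gam g w = 0.
  move=> hw; have [->|/(exists_lead lt_wo) [y hy ley]] := pselect (w = 0).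
    by rewrite !linear0 !addr0 => /(lin_inj_eq0 ii) ->; rewrite linear0.
  (* The leading term of [w] is moved to the right hand side, where the choice
     of [g y] accounts for it. *)
  pose w' := w - dinj y (w y).
  have sw' : supp_lt lt y w' by apply: supp_le_tail.
  have -> : w = w' + dinj y (w y) by rewrite subrK.
  rewrite (linearD sigma w') (linearD (gam g) w') [sigma (dinj _ _)]dmap_inj.
  rewrite [gam g (dinj _ _)]dmap_inj.
  rewrite !scale_byE !addrA => /eqP; rewrite addr_eq0 -scaleNr => /eqP e.
  by rewrite (hw y hy _ _ _ sw' e) scaleNr addNr.
have linrel (g : B -> E) c (a a' : A) (w w' : dsum F) :
    f (c *: a + a') + gam g (c *: w + w') = c *: (f a + gam g w) + (f a' + gam g w').
  by rewrite !linearP /= scalerDr addrACA.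
have linrel' c (a a' : A) (w w' : dsum F) :
    i (c *: a + a') + sigma (c *: w + w') = c *: (i a + sigma w) + (i a' + sigma w').
  by rewrite !linearP /= scalerDr addrACA.
have [||g hg] := wf_choice lt_wf (A := fun _ => E) (fun _ => 0) (Rel := Rel).
- move=> x g g' e hgg' he r a w hw /(he r a w hw) <-; congr (_ + _).
  apply: dsum_eq_lin => y hy z; rewrite !dmap_inj hgg' //.
  exact: supp_lt_mem hw hy.
- move=> x g IH.
  pose S (r : R^o) := exists a w, supp_lt lt x w /\ i a + sigma w = r *: x.
  have hS : submodule S.
    split=> [|c r r' [a [w [hw e]]] [a' [w' [hw' e']]]].
      by exists 0, 0; rewrite !linear0 addr0 scale0r.
    exists (c *: a + a'), (c *: w + w'); split.
      exact: (supp_lt_submodule _ _ x).2.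
    by rewrite linrel' e e' scalerA -scalerDl.
  have [J [j [ij hj]]] := sub_exists hS.
  have [|||v hv] := @lin_of_rel R J E (fun r e => exists a w,
      [/\ supp_lt lt x w, i a + sigma w = (j r : R) *: x & e = f a + gam g w]).
  + move=> r; have [a [w [hw e]]] := (hj (j r)).2 (ex_intro _ r erefl).
    by exists (f a + gam g w), a, w.
  + move=> r _ _ [a [w [hw e ->]]] [a' [w' [hw' e' ->]]].
    apply/eqP; rewrite -subr_eq0 addrC -scaleN1r -linrel; apply/eqP.
    apply: kill; last by rewrite linrel' e e' scaleN1r addNr.
    move=> y hy; apply: IH; apply: supp_lt_mem hy.
    exact: (supp_lt_submodule _ _ x).2.
  + move=> c r r' _ _ [a [w [hw e ->]]] [a' [w' [hw' e' ->]]].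
    exists (c *: a + a'), (c *: w + w'); split; last by rewrite linrel.
      exact: (supp_lt_submodule _ _ x).2.
    by rewrite linrel' e e' linearP scalerA -scalerDl.
  have [e he] := bE J j v ij; exists e => r a w hw ew.
  have [y hy] := (hj r).1 (ex_intro _ a (ex_intro _ w (conj hw ew))).
  have [a' [w' [hw' e' fe']]] := hv y; rewrite -hy -he fe'.
  apply/eqP; rewrite -subr_eq0 addrC -scaleN1r -linrel; apply/eqP.
  apply: kill; last by rewrite linrel' e' hy ew scaleN1r addNr.
  move=> z hz; apply: IH; apply: supp_lt_mem hz.
  exact: (supp_lt_submodule _ _ x).2.
have [|||h hh] := @lin_of_rel R B E (fun b e => exists a w,
    i a + sigma w = b /\ e = f a + gam g w).
- move=> b; exists (f 0 + gam g (@dinj R B F b 1)), 0, (@dinj R B F b 1); split=> //.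
  by rewrite linear0 add0r [sigma _]dmap_inj scale_byE scale1r.
- move=> b _ _ [a [w [e ->]]] [a' [w' [e' ->]]].
  apply/eqP; rewrite -subr_eq0 addrC -scaleN1r -linrel; apply/eqP.
  by apply: kill => //; rewrite linrel' e e' scaleN1r addNr.
- move=> c b b' _ _ [a [w [e ->]]] [a' [w' [e' ->]]].
  by exists (c *: a + a'), (c *: w + w'); rewrite linrel linrel' e e'.
exists h => a; have [a' [w [e ->]]] := hh (i a).
have <- : f a + gam g 0 = f a by rewrite linear0 addr0.
apply/eqP; rewrite -subr_eq0 addrC -scaleN1r -linrel; apply/eqP.
by apply: kill => //; rewrite linrel' e linear0 addr0 scaleN1r addNr.
Qed.

End Baer.

Section Divisible.

Definition divisible (D : lmodType int) : Prop :=
  forall (n : int) (d : D), n != 0 -> exists d', n *: d' = d.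

(** Ideals of [Z] are generated by an element of least absolute value. *)
Lemma divisible_baer D : divisible D -> baer D.
Proof.
move=> dD J j f ij.
have [[x0 hx0]|h] := pselect (exists x, j x != 0); last first.
  exists 0 => x; have -> : x = 0.
    apply: (lin_inj_eq0 ij); apply: contrapT => /eqP hx; apply: h.
    by exists x.
  by rewrite !linear0.
pose P k := `[< exists2 x, j x != 0 & `|(j x : int)|%N = k >].
have exP : exists k, P k by exists `|(j x0 : int)|%N; apply/asboolP; exists x0.
case: (ex_minnP exP) => k /asboolP [x hx hk] kmin {x0 hx0}.
have [d hd] := dD (j x : int) (f x) hx.
exists d => y; pose q := ((j y : int) %/ (j x : int))%Z.
have jr : j (y - q *: x) = ((j y : int) %% (j x : int))%Z.
  rewrite linearB linearZ; apply/eqP; rewrite subr_eq addrC; apply/eqP.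
  exact: divz_eq.
have : y - q *: x = 0.
  apply: (lin_inj_eq0 ij); apply: contrapT => /eqP hne.
  have := kmin `|(j (y - q *: x)%R : int)|%N.
  rewrite -hk => /(_ _)/wrap []; first by apply/asboolP; exists (y - q *: x).
  apply/negP; rewrite -ltnNge -ltz_nat !abszE jr ger0_norm ?modz_ge0 //.
  exact: ltz_mod.
move=> /eqP; rewrite subr_eq0 => /eqP ->.
by rewrite !linearZ /= -hd scalerA.
Qed.

(** An abelian group [Z^(M) / K] embeds in the divisible group [Q^(M) / K]. *)
Lemma divisible_embedding (M : zmodType) :
  exists (D : lmodType int) (u : {linear zmodule M -> D}), divisible D /\ injective u.
Proof.
pose FZ : lmodType int := dsum (fun _ : M => int^o : lmodType int).
pose FQ : lmodType int := dsum (fun _ : M => zmodule rat : lmodType int).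
pose tau : {linear FZ -> zmodule M} := dmap (fun x : M => scale_by (x : zmodule M)).
pose one : zmodule rat := (1 : rat).
pose c : {linear int^o -> zmodule rat} := scale_by one.
pose h : {linear FZ -> FQ} :=
  dmap (fun x : M => dinj x \o c : {linear int^o -> FQ}).
have taus : surj tau.
  move=> m; exists (@dinj int M (fun _ => int^o) m 1).
  by rewrite [tau _]dmap_inj scale_byE scale1r.
have hco (w : FZ) x : h w x = c (w x).
  pose p1 : {linear FZ -> zmodule rat} :=
    dproj (fun _ : M => zmodule rat : lmodType int) x \o h.
  pose p2 : {linear FZ -> zmodule rat} := c \o dproj (fun _ : M => int^o : lmodType int) x.
  rewrite -[LHS]/(p1 w) -[RHS]/(p2 w); apply: dsum_eq_lin => y _ a.
  rewrite -[LHS]/(h (dinj y a) x) [h _]dmap_inj.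
  rewrite -[LHS]/(@dinj int M (fun _ => zmodule rat : lmodType int) y (c a) x).
  rewrite -[RHS]/(c (@dinj int M (fun _ => int^o : lmodType int) y a x)).
  have [<-|ne] := pselect (y = x); first by rewrite !dinj_id.
  by rewrite !dinj_ne // linear0.
have ih : injective h.
  apply: lin_eq0_inj => w hw; apply: dsum_ext => x.
  have := hco w x; rewrite hw => /esym /eqP.
  by rewrite -[_ == _]/((1 : rat) *~ (w x : int) == 0) intr_eq0 => /eqP.
(* [M] is [Z^(M)] modulo the kernel of [tau]; the same relations are imposed on
   [Q^(M)]. *)
pose S (q : FQ) := exists2 w, tau w = 0 & h w = q.
have hS : submodule S.
  split=> [|a _ _ [w hw <-] [w' hw' <-]]; first by exists 0; rewrite linear0.
  by exists (a *: w + w'); rewrite linearP ?hw ?hw' ?scaler0 ?addr0.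
have [D [p [ps hp]]] := quot_exists hS.
have [ph hph] := lin_comp p h.
have [|u hu] := factor_surj (f := ph) taus.
  by move=> w hw; rewrite hph; apply/hp; exists w.
exists D, u; split.
  move=> n d nz; have [q <-] := ps d.
  pose dv (x : zmodule rat) : zmodule rat := (x : rat) / n%:~R.
  have dvl : linear dv.
    move=> a x y; rewrite /dv.
    rewrite -[a *: x + y]/((x : rat) *~ a + (y : rat)) mulrDl.
    by rewrite -[RHS]/((x : rat) / n%:~R *~ a + (y : rat) / n%:~R) mulrzAl.
  pose dvL := GRing.isLinear.Build int _ _ _ dv dvl.
  pose dvF : {linear zmodule rat -> zmodule rat} := HB.pack dv dvL.
  pose k : {linear FQ -> FQ} := dmap (fun x : M => dinj x \o dvF : {linear _ -> FQ}).
  exists (p (k q)); rewrite -linearZ; congr (p _).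
  pose nk : {linear FQ -> FQ} := n \*: k.
  rewrite -[LHS]/(nk q) -[RHS]/((idfun : {linear _ -> _}) q).
  apply: dsum_eq_lin => y _ a.
  rewrite -[LHS]/(n *: k (dinj y a)) [k _]dmap_inj -[RHS]/(dinj y a).
  rewrite -[LHS]/(n *: dinj y (dvF a)) -linearZ; congr (dinj y _).
  rewrite -[LHS]/((a : rat) / n%:~R *~ n) -mulrzr mulfVK //.
  by rewrite intr_eq0.
apply: lin_eq0_inj => m; have [w <-] := taus m.
by rewrite hu hph => /hp [w' hw' /ih <-].
Qed.

Lemma zlinear_exists (A : zmodType) (D : lmodType int) (f : A -> D) :
  {morph f : x y / x + y} -> exists g : {linear zmodule A -> D}, forall a, g a = f a.
Proof.
move=> fD.
have f0 : f 0 = 0 by apply: (addrI (f 0)); rewrite -fD !addr0.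
have fN x : f (- x) = - f x by apply/eqP; rewrite -addr_eq0 -fD addNr f0.
have fn x n : f (x *+ n) = f x *+ n.
  by elim: n => [|n ih]; rewrite ?mulr0n // !mulrS fD ih.
have fl : linear (f : zmodule A -> D).
  move=> n x y; rewrite -[n *: x + y]/((x : A) *~ n + (y : A)) fD; congr (_ + _).
  rewrite -[n in RHS]intz scaler_int; case: n => n; first exact: fn.
  by rewrite !NegzE !mulrNz fN; congr (- _); apply: fn.
pose fL := GRing.isLinear.Build int _ _ _ (f : zmodule A -> D) fl.
pose F : {linear zmodule A -> D} := HB.pack (f : zmodule A -> D) fL.
by exists F.
Qed.

End Divisible.

Section Coinduced.
Variables (R : comPzRingType) (D : lmodType int).

(** The coinduced module [Hom_Z(R, D)]; a scalar acts on the argument. *)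
Record coind := Coind { cfun :> R -> D; cfunD : {morph cfun : x y / x + y} }.

HB.instance Definition _ := gen_eqMixin coind.
HB.instance Definition _ := gen_choiceMixin coind.

Lemma coind_ext (f g : coind) : (forall x, f x = g x) -> f = g.
Proof.
case: f g => [f fD] [g gD] /= /funext e; case: _ / e gD => gD.
by congr Coind; apply: Prop_irrelevance.
Qed.

Lemma coind0_subproof : {morph (fun _ : R => 0 : D) : x y / x + y}.
Proof. by move=> x y; rewrite addr0. Qed.
Definition coind0 := Coind coind0_subproof.
Lemma coind_add_subproof (f g : coind) : {morph (fun x => f x + g x) : x y / x + y}.
Proof. by move=> x y; rewrite !cfunD addrACA. Qed.
Definition coind_add f g := Coind (coind_add_subproof f g).
Lemma coind_opp_subproof (f : coind) : {morph (fun x => - f x) : x y / x + y}.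
Proof. by move=> x y; rewrite cfunD opprD. Qed.
Definition coind_opp f := Coind (coind_opp_subproof f).
Lemma coind_scale_subproof a (f : coind) : {morph (fun x => f (x * a)) : x y / x + y}.
Proof. by move=> x y; rewrite mulrDl cfunD. Qed.
Definition coind_scale a f := Coind (coind_scale_subproof a f).

Lemma coind_addA : associative coind_add.
Proof. by move=> f g h; apply: coind_ext => x /=; rewrite addrA. Qed.
Lemma coind_addC : commutative coind_add.
Proof. by move=> f g; apply: coind_ext => x /=; rewrite addrC. Qed.
Lemma coind_add0 : left_id coind0 coind_add.
Proof. by move=> f; apply: coind_ext => x /=; rewrite add0r. Qed.
Lemma coind_addN : left_inverse coind0 coind_opp coind_add.
Proof. by move=> f; apply: coind_ext => x /=; rewrite addNr. Qed.
HB.instance Definition _ :=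
  GRing.isZmodule.Build coind coind_addA coind_addC coind_add0 coind_addN.

Lemma coind_scaleA a b f : coind_scale a (coind_scale b f) = coind_scale (a * b) f.
Proof. by apply: coind_ext => x /=; rewrite mulrA. Qed.
Lemma coind_scale1 : left_id 1 coind_scale.
Proof. by move=> f; apply: coind_ext => x /=; rewrite mulr1. Qed.
Lemma coind_scaleDr : right_distributive coind_scale +%R.
Proof. by move=> a f g; apply: coind_ext. Qed.
Lemma coind_scaleDl f : {morph coind_scale^~ f : a b / a + b}.
Proof. by move=> a b; apply: coind_ext => x /=; rewrite mulrDr cfunD. Qed.
HB.instance Definition _ := GRing.Zmodule_isLmodule.Build R coind
  coind_scaleA coind_scale1 coind_scaleDr coind_scaleDl.

(** Maps [B -> Hom_Z(R, D)] over [R] are additive maps [B -> D], by evaluation at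
  [1]. *)
Lemma coind_injective : injective_module D -> injective_module coind.
Proof.
move=> iD A B i f ii.
have [fz hfz] : exists g : {linear zmodule A -> D}, forall a, g a = f a 1.
  by apply: zlinear_exists => x y; rewrite linearD.
have [iz hiz] : exists g : {linear zmodule A -> zmodule B}, forall a, g a = i a.
  by apply: (@zlinear_exists A (zmodule B) i) => x y; rewrite linearD.
have [|g hg] := iD _ _ iz fz; first by move=> x y; rewrite !hiz => /ii.
have gD (b : B) : {morph (fun x : R => g (x *: b)) : x y / x + y}.
  by move=> x y; rewrite scalerDl -linearD.
pose h (b : B) : coind := Coind (gD b).
have hl : linear h.
  move=> a x y; apply: coind_ext => r /=.
  rewrite scalerDr scalerA; exact: (linearD g ((r * a) *: x : zmodule B) (r *: y)).
pose hL := GRing.isLinear.Build R _ _ _ h hl.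
pose H : {linear B -> coind} := HB.pack h hL.
exists H => a; apply: coind_ext => r.
rewrite -[LHS]/(g (r *: i a)) -linearZ -hiz hg hfz linearZ.
by rewrite -[LHS]/(f a (1 * r)) mul1r.
Qed.

End Coinduced.

Lemma enough_injectives (R : comPzRingType) (M : lmodType R) :
  exists (E : lmodType R) (i : {linear M -> E}), injective_module E /\ injective i.
Proof.
have [D [u [dD iu]]] := divisible_embedding M.
have iD : injective_module D by apply/baer_injective/divisible_baer.
have uD (m : M) : {morph (fun x : R => u (x *: m)) : x y / x + y}.
  by move=> x y; rewrite scalerDl -linearD.
pose h (m : M) : coind R D := Coind (uD m).
have hl : linear h.
  move=> a x y; apply: coind_ext => r /=.
  rewrite scalerDr scalerA; exact: (linearD u ((r * a) *: x : zmodule M) (r *: y)).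
pose hL := GRing.isLinear.Build R _ _ _ h hl.
pose H : {linear M -> coind R D} := HB.pack h hL.
exists (coind R D), H; split; first exact: coind_injective.
move=> x y /(congr1 (fun f : coind R D => f 1)).
by rewrite -[H x 1]/(u (1 *: x)) -[H y 1]/(u (1 *: y)) !scale1r => /iu.
Qed.

(** * Spliced complexes, matrices and G-Von Neumann regular rings *)

Section Build.
Variable R : comPzRingType.

Definition embedding_property : Type :=
  forall K P : lmodType R, {linear K -> P} -> Prop.

(** The maps [A -> B -> C] come from [0 -> K -> B -> K' -> 0] by precomposing
  with [A -> K] and embedding [K'] in [C].  The predicate [good] records what
  is known of the embeddings, and decides which functors preserve exactness
  of the spliced complex. *)
Definition spliced (good : embedding_property) (A B C : lmodType R)
    (f : {linear A -> B}) (g : {linear B -> C}) : Prop :=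
  exists (K K' : lmodType R) (p0 : {linear A -> K}) (i : {linear K -> B})
    (p : {linear B -> K'}) (i' : {linear K' -> C}),
  [/\ surj p0, short_exact i p, injective i' /\ good _ _ i',
      forall x, f x = i (p0 x) & forall y, g y = i' (p y)].

Lemma spliced_exact good (A B C : lmodType R) (f : {linear A -> B})
    (g : {linear B -> C}) : spliced good f g -> exact_at f g.
Proof.
move=> [K [K' [p0 [i [p [i' [p0s [ii ps ex] [ii' _] fE gE]]]]]]] y.
rewrite gE; split=> [/(lin_inj_eq0 ii')/ex [k <-]|[x <-]].
  by have [x <-] := p0s k; exists x.
by rewrite fE (exact_comp0 _ ex) linear0.
Qed.

(** A map on [B] that kills [A] descends to [K'] and then extends along the good
  embedding of [K'] in [C]. *)
Lemma spliced_hom good (A B C Q : lmodType R) (f : {linear A -> B})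
    (g : {linear B -> C}) :
  (forall (K P : lmodType R) (i : {linear K -> P}), good _ _ i ->
     forall h : {linear K -> Q}, exists k : {linear P -> Q}, forall x, k (i x) = h x) ->
  spliced good f g -> hom_exact_at Q f g.
Proof.
move=> hg sp h; have ex := spliced_exact sp.
split=> [hf|[k hk] x]; last by rewrite -hk (exact_comp0 _ ex) linear0.
move: sp => [K [K' [p0 [i [p [i' [p0s [ii ps exi] [ii' gi'] fE gE]]]]]]].
have [|h' hh'] := factor_surj (f := h) ps.
  by move=> m /exi [k <-]; have [x <-] := p0s k; rewrite -fE.
have [k hk] := hg _ _ _ gi' h'.
by exists k => y; rewrite gE hk hh'.
Qed.

Lemma spliced_tensor good (A B C I : lmodType R) (f : {linear A -> B})
    (g : {linear B -> C}) :
  (forall (K P : lmodType R) (i : {linear K -> P}), good _ _ i ->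
     injective (tensor_map i I)) ->
  spliced good f g -> exact_at (tensor_map f I) (tensor_map g I).
Proof.
move=> hg [K [K' [p0 [i [p [i' [p0s [ii ps exi] [ii' gi'] fE gE]]]]]]] y.
have e := tensor_map_exact (V := I) ps exi.
rewrite /= (tensor_map_comp y gE); split=> [/(lin_inj_eq0 (hg _ _ _ gi'))/e [k <-]|].
  have [x <-] := tensor_map_surj (V := I) p0s k.
  by exists x; rewrite /= (tensor_map_comp x fE).
move=> [x <-]; rewrite /= (tensor_map_comp x fE).
by rewrite [X in tensor_map i' I X](exact_comp0 _ e) linear0.
Qed.

Variables (cls term : lmodType R -> Prop) (good : embedding_property).

(** A continuation to the right by one short exact sequence, as data: the sequence
  of continuations is built by iteration. *)
Record rstep (K : lmodType R) := RStep {
  rsP : lmodType R; rsK : lmodType R;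
  rsi : {linear K -> rsP}; rsp : {linear rsP -> rsK};
  rs_term : term rsP; rs_cls : cls rsK; rs_exact : short_exact rsi rsp;
  rs_good : good rsi }.

Record lstep (K : lmodType R) := LStep {
  lsP : lmodType R; lsK : lmodType R;
  lsi : {linear lsK -> lsP}; lsp : {linear lsP -> K};
  ls_term : term lsP; ls_cls : cls lsK; ls_exact : short_exact lsi lsp;
  ls_good : good lsi }.

Hypothesis right_step : forall K, cls K ->
  exists (P K' : lmodType R) (i : {linear K -> P}) (p : {linear P -> K'}),
    [/\ term P, cls K', short_exact i p & good i].
Hypothesis left_step : forall K, cls K ->
  exists (P K' : lmodType R) (i : {linear K' -> P}) (p : {linear P -> K}),
    [/\ term P, cls K', short_exact i p & good i].

(** Starting from [M], continue for ever on both sides inside [cls] and splice. *)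
Lemma biseq_build M : cls M -> exists S : biseq R,
  [/\ biseq_all term S, iso_image M (mmap S),
      [/\ forall i, spliced good (lmap S i.+1) (lmap S i),
          spliced good (lmap S 0) (mmap S) & spliced good (mmap S) (rmap S 0)] &
      forall i, spliced good (rmap S i) (rmap S i.+1)].
Proof.
move=> cM; pose T := {K : lmodType R | cls K}.
have ex_rs (K : T) : exists s : rstep (sval K), True.
  case: K => K cK; have [P [K' [i [p [h1 h2 h3 h4]]]]] := right_step cK.
  by exists (RStep h1 h2 h3 h4).
pose rs K := projT1 (cid (ex_rs K)).
have ex_ls (K : T) : exists s : lstep (sval K), True.
  case: K => K cK; have [P [K' [i [p [h1 h2 h3 h4]]]]] := left_step cK.
  by exists (LStep h1 h2 h3 h4).
pose ls K := projT1 (cid (ex_ls K)).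
pose r0 : T := exist _ M cM.
pose rst := nat_rect (fun _ => T) r0 (fun _ K => exist _ _ (rs_cls (rs K))).
pose lst := nat_rect (fun _ => T) r0 (fun _ K => exist _ _ (ls_cls (ls K))).
pose S := @Biseq R (fun i => lsP (ls (lst i))) (fun i => rsP (rs (rst i)))
  (fun i => lsi (ls (lst i)) \o lsp (ls (lst i.+1)))
  (rsi (rs r0) \o lsp (ls r0))
  (fun i => rsi (rs (rst i.+1)) \o rsp (rs (rst i))).
exists S; split.
- by split=> i; [apply: ls_term|apply: rs_term].
- have [_ lps _] := ls_exact (ls r0); have [ii _ _] := rs_exact (rs r0).
  exists (rsi (rs r0)); split=> // y; split=> [[m <-]|[x <-]].
    by have [x <-] := lps m; exists x.
  by exists (lsp (ls r0) x).
- split=> [i||].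
  + exists _, _, (lsp (ls (lst i.+2))), (lsi (ls (lst i.+1))),
      (lsp (ls (lst i.+1))), (lsi (ls (lst i))).
    by split=> //; [case: (ls_exact (ls (lst i.+2)))|exact: ls_exact|split;
      [case: (ls_exact (ls (lst i)))|exact: ls_good]].
  + exists _, _, (lsp (ls (lst 1%N))), (lsi (ls r0)), (lsp (ls r0)), (rsi (rs r0)).
    by split=> //; [case: (ls_exact (ls (lst 1%N)))|exact: ls_exact|split;
      [case: (rs_exact (rs r0))|exact: rs_good]].
  + exists _, _, (lsp (ls r0)), (rsi (rs r0)), (rsp (rs r0)), (rsi (rs (rst 1%N))).
    by split=> //; [case: (ls_exact (ls r0))|exact: rs_exact|split;
      [case: (rs_exact (rs (rst 1%N)))|exact: rs_good]].
- move=> i; exists _, _, (rsp (rs (rst i))), (rsi (rs (rst i.+1))),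
    (rsp (rs (rst i.+1))), (rsi (rs (rst i.+2))).
  by split=> //; [case: (rs_exact (rs (rst i)))|exact: rs_exact|split;
    [case: (rs_exact (rs (rst i.+2)))|exact: rs_good]].
Qed.

End Build.

Section Criteria.
Variable R : comPzRingType.

Definition extends_to_projectives (K P : lmodType R) (i : {linear K -> P}) : Prop :=
  forall Q : lmodType R, projective Q ->
  forall h : {linear K -> Q}, exists k : {linear P -> Q}, forall x, k (i x) = h x.

Definition tensor_injective (K P : lmodType R) (i : {linear K -> P}) : Prop :=
  forall I : lmodType R, injective_module I -> injective (tensor_map i I).

Lemma GP_build (cls : lmodType R -> Prop) :
  (forall K, cls K ->
   exists (P K' : lmodType R) (i : {linear K -> P}) (p : {linear P -> K'}),
    [/\ projective P, cls K', short_exact i p & extends_to_projectives i]) ->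
  (forall K, cls K ->
   exists (P K' : lmodType R) (i : {linear K' -> P}) (p : {linear P -> K}),
    [/\ projective P, cls K', short_exact i p & extends_to_projectives i]) ->
  forall M, cls M -> Gorenstein_projective M.
Proof.
move=> hr hl M cM; have [S [hS iS [h1 h2 h3] h4]] := biseq_build hr hl cM.
exists S; split=> //.
  by split=> [i|||i]; [exact: spliced_exact (h1 i)|exact: spliced_exact h2
    |exact: spliced_exact h3|exact: spliced_exact (h4 i)].
move=> Q pQ; have ext (K P : lmodType R) (i : {linear K -> P}) :
    extends_to_projectives i -> forall h : {linear K -> Q},
    exists k : {linear P -> Q}, forall x, k (i x) = h x by apply.
by split=> [i|||i]; [exact: spliced_hom ext (h1 i)|exact: spliced_hom ext h2
  |exact: spliced_hom ext h3|exact: spliced_hom ext (h4 i)].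
Qed.

Lemma GF_build (cls : lmodType R -> Prop) :
  (forall K, cls K ->
   exists (P K' : lmodType R) (i : {linear K -> P}) (p : {linear P -> K'}),
    [/\ flat P, cls K', short_exact i p & tensor_injective i]) ->
  (forall K, cls K ->
   exists (P K' : lmodType R) (i : {linear K' -> P}) (p : {linear P -> K}),
    [/\ flat P, cls K', short_exact i p & tensor_injective i]) ->
  forall M, cls M -> Gorenstein_flat M.
Proof.
move=> hr hl M cM; have [S [hS iS [h1 h2 h3] h4]] := biseq_build hr hl cM.
exists S; split=> //.
  by split=> [i|||i]; [exact: spliced_exact (h1 i)|exact: spliced_exact h2
    |exact: spliced_exact h3|exact: spliced_exact (h4 i)].
move=> I iI; have ext (K P : lmodType R) (i : {linear K -> P}) :
    tensor_injective i -> injective (tensor_map i I) by apply.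
by split=> [i|||i]; [exact: spliced_tensor ext (h1 i)|exact: spliced_tensor ext h2
  |exact: spliced_tensor ext h3|exact: spliced_tensor ext (h4 i)].
Qed.

Lemma lift_exact (P A B C : lmodType R) (d : {linear A -> B}) (e : {linear B -> C})
    (f : {linear P -> B}) :
  projective P -> exact_at d e -> (forall x, e (f x) = 0) ->
  exists h : {linear P -> A}, forall x, d (h x) = f x.
Proof.
move=> pP ex h0; have [K [i [ii hi]]] := sub_exists (submodule_ker e).
have [|d' hd'] := factor_inj (f := d) ii.
  by move=> a; apply/hi; apply: exact_comp0 ex.
have [|f' hf'] := factor_inj (f := f) ii; first by move=> a; apply/hi.
have [|h hh] := pP _ _ d' f'.
  move=> k; have [a ha] : exists a, d a = i k by apply/ex/hi; exists k.
  by exists a; apply: ii; rewrite hd'.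
by exists h => x; rewrite -hd' hh hf'.
Qed.

(** Extend from the image of [psi], where [phi] is well defined. *)
Lemma injective_extend (E A B : lmodType R) (phi : {linear A -> E})
    (psi : {linear A -> B}) :
  injective_module E -> (forall x, psi x = 0 -> phi x = 0) ->
  exists g : {linear B -> E}, forall x, g (psi x) = phi x.
Proof.
move=> iE h0; have [C [p [ps hp]]] := quot_exists (submodule_ker psi).
have [|j hj] := factor_surj (f := psi) ps; first by move=> m /hp.
have [|f hf] := factor_surj (f := phi) ps; first by move=> m /hp/h0.
have [|g hg] := iE _ _ j f.
  by apply: lin_eq0_inj => c; have [x <-] := ps c; rewrite hj => /hp.
by exists g => x; rewrite -hj hg hf.
Qed.

End Criteria.

Section Matrices.
Variable R : comPzRingType.

Definition row_exact a b n (A : 'M[R]_(a, b)) (D : 'M[R]_(b, n)) : Prop :=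
  forall u : 'rV[R]_b, u *m D = 0 <-> exists x, x *m A = u.

Definition col_exact a b n (A : 'M[R]_(a, b)) (D : 'M[R]_(b, n)) : Prop :=
  row_exact D^T A^T.

Lemma row_exact_mul a b n (A : 'M[R]_(a, b)) (D : 'M[R]_(b, n)) :
  row_exact A D -> A *m D = 0.
Proof.
move=> h; apply/row_matrixP => i; rewrite row_mul row0.
by apply/h; exists (delta_mx 0 i); rewrite -rowE.
Qed.

Lemma row_exact_factor a b n c (A : 'M[R]_(a, b)) (D : 'M[R]_(b, n))
    (B : 'M[R]_(c, b)) :
  row_exact A D -> B *m D = 0 -> exists X, B = X *m A.
Proof.
move=> h hB; have /choice [x hx] : forall i, exists x, x *m A = row i B.
  by move=> i; apply/h; rewrite -row_mul hB row0.
exists (\matrix_i x i); apply/row_matrixP => i.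
by rewrite row_mul rowK hx.
Qed.

Lemma equational_exact (F : lmodType R) a b n (A : 'M[R]_(a, b)) (D : 'M[R]_(b, n))
    (s : 'I_b -> F) :
  equational F -> row_exact A D -> (forall j, act s D j = 0) ->
  exists t : 'I_a -> F, forall i, s i = act t A i.
Proof.
move=> hF ex /hF [c [B [t [hB ht]]]].
have [X eX] := row_exact_factor ex hB.
by exists (act t X) => i; rewrite ht eX act_mul.
Qed.

Lemma combo_act (M : lmodType R) a b (t : 'I_a -> M) (A : 'M[R]_(a, b)) u :
  combo (act t A) u = combo t (u *m A^T).
Proof.
rewrite !comboE (eq_bigr (fun i => \sum_k (u 0 i * A k i) *: t k)); last first.
  by move=> i _; rewrite scaler_sumr; apply: eq_bigr => k _; rewrite scalerA.
rewrite exchange_big; apply: eq_bigr => k _ /=; rewrite mxE scaler_suml.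
by apply: eq_bigr => i _; rewrite mxE.
Qed.

Lemma eq_combo (M : lmodType R) b (s s' : 'I_b -> M) u :
  (forall i, s i = s' i) -> combo s u = combo s' u.
Proof. by move=> e; rewrite !comboE; apply: eq_bigr => i _; rewrite e. Qed.

Lemma rV_combo (M : lmodType R) b (f : {linear 'rV[R]_b -> M}) u :
  f u = combo (fun i => f (delta_mx 0 i)) u.
Proof. exact: rV_linE. Qed.

Lemma act_delta (M : lmodType R) b n (f : {linear 'rV[R]_b -> M}) (D : 'M[R]_(b, n)) j :
  act (fun i => f (delta_mx 0 i)) D j = f (row j D^T).
Proof.
by rewrite rV_combo comboE; apply: eq_bigr => i _; rewrite !mxE.
Qed.

Lemma combo_lin (M N : lmodType R) b (f : {linear M -> N}) (s : 'I_b -> M) u :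
  f (combo s u) = combo (fun i => f (s i)) u.
Proof. by rewrite !comboE linear_sum; apply: eq_bigr => i _; rewrite linearZ. Qed.

(** A map on the row space of [D] amounts to values [s_r] on the rows, and an
  extension to [R^n] to a solution [t] of [D t = s].  The relations between
  the rows give [C^T s = 0], and exactness of [R^n -> R^m -> R^c] persists with
  coefficients in a flat module. *)
Lemma extend_rV (K Q : lmodType R) n m c (i : {linear K -> 'rV[R]_n})
    (D : 'M[R]_(m, n)) (C : 'M[R]_(m, c)) (f : {linear K -> Q}) :
  equational Q -> injective i -> (forall u, (exists k, i k = u) <-> exists x, x *m D = u) ->
  row_exact D^T C -> exists g : {linear 'rV[R]_n -> Q}, forall k, g (i k) = f k.
Proof.
move=> eQ ii hi ex.
have /choice [k hk] : forall r, exists k, i k = row r D.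
  by move=> r; apply/hi; exists (delta_mx 0 r); rewrite -rowE.
have ik x : i (combo k x) = x *m D.
  rewrite combo_lin comboE mulmx_sum_row.
  by apply: eq_bigr => r _; rewrite hk.
have [|t ht] := equational_exact (s := fun r => f (k r)) eQ ex.
  move=> j; rewrite -act_lin; suff -> : act k C j = 0 by rewrite linear0.
  have -> : act k C j = combo k (row j C^T).
    by rewrite comboE; apply: eq_bigr => r _; rewrite !mxE.
  apply: (lin_inj_eq0 ii); rewrite ik -row_mul.
  have := congr1 trmx (row_exact_mul ex).
  by rewrite trmx_mul trmxK trmx0 => ->; rewrite row0.
exists (combo t) => y; have [x hx] := (hi (i y)).1 (ex_intro _ y erefl).
have -> : y = combo k x by apply: ii; rewrite ik.
rewrite ik -{1}(trmxK D) -combo_act combo_lin.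
by apply: eq_combo => r; rewrite ht.
Qed.

(** Matrices act on row vectors from the right, so the rows of [A] are the
  relations between the generators of [M]. *)
Definition presents (M : lmodType R) m n (A : 'M[R]_(m, n))
    (p : {linear 'rV[R]_n -> M}) : Prop :=
  surj p /\ forall u, p u = 0 <-> exists x, x *m A = u.

Lemma n_presented1P (M : lmodType R) : n_presented 1 M <->
  exists m n (A : 'M[R]_(m, n)) (p : {linear 'rV[R]_n -> M}), presents A p.
Proof.
split=> [[k [eps [dF [es /(_ isT) ex _]]]]|[m [n [A [p [ps hp]]]]]].
  exists (k 1%N), (k 0%N), (lin1_mx (dF 0%N)), eps; split=> // u.
  by rewrite (ex u); split=> -[x <-]; exists x; rewrite mul_rV_lin1.
pose k (i : nat) := if i is 0 then n else m.
pose dF (i : nat) : {linear 'rV[R]_(k i.+1) -> 'rV[R]_(k i)} :=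
  match i return {linear 'rV[R]_(k i.+1) -> 'rV[R]_(k i)} with
  | 0 => mulmxr A | _ => \0 end.
by exists k, p, dF.
Qed.

Lemma coker_presents m n (A : 'M[R]_(m, n)) :
  exists (M : lmodType R) (p : {linear 'rV[R]_n -> M}), presents A p.
Proof.
have [M [p [ps hp]]] := quot_exists (submodule_im (mulmxr A : {linear 'rV[R]_m -> 'rV[R]_n})).
by exists M, p.
Qed.

Lemma presents_map (M N : lmodType R) m n (A : 'M[R]_(m, n))
    (p : {linear 'rV[R]_n -> M}) (f : {linear 'rV[R]_n -> N}) :
  presents A p -> (forall x, f (x *m A) = 0) ->
  exists g : {linear M -> N}, forall u, g (p u) = f u.
Proof.
move=> [ps hp] hf; apply: factor_surj => // u /hp [x <-]; exact: hf.
Qed.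

Lemma presents_embed (M : lmodType R) m n s (A : 'M[R]_(m, n)) (B : 'M[R]_(n, s))
    (p : {linear 'rV[R]_n -> M}) :
  presents A p -> row_exact A B ->
  exists j : {linear M -> 'rV[R]_s}, [/\ injective j, forall u, j (p u) = u *m B &
    forall u, (exists k, j k = u) <-> exists x, x *m B = u].
Proof.
move=> pA ex; have [|j hj] := presents_map (f := mulmxr B) pA.
  by move=> x /=; rewrite -mulmxA (row_exact_mul ex) mulmx0.
have [ps hp] := pA; exists j; split=> // [|u].
  by apply: lin_eq0_inj => y; have [u <-] := ps y; rewrite hj => /ex/hp.
split=> [[k <-]|[x <-]]; last by exists (p x).
by have [x <-] := ps k; exists x; rewrite hj.
Qed.

End Matrices.

Section VonNeumann.
Variable R : comPzRingType.

(** Every finitely presented module embeds in a finitely generated free module. *)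
Definition row_coexact : Prop :=
  forall m n (A : 'M[R]_(m, n)), exists s (B : 'M[R]_(n, s)), row_exact A B.

(** The generators of [M] satisfy in a flat module [F] the relations [A]; by the
  equational criterion they come from a map [M -> R^a] through which the
  embedding in [F] factors. *)
Lemma flat_embedding_coexact :
  (forall M : lmodType R, exists (F : lmodType R) (j : {linear M -> F}),
     flat F /\ injective j) -> row_coexact.
Proof.
move=> h m n A; have [M [p [ps hp]]] := coker_presents A.
have [F [j [/flat_equational eF ij]]] := h M.
have [jp hjp] := lin_comp j p.
have [|a [B [t [hB ht]]]] := eF n m (fun i => jp (delta_mx 0 i)) A^T.
  move=> r; rewrite act_delta trmxK hjp (_ : p _ = 0) ?linear0 //.
  by apply/hp; exists (delta_mx 0 r); rewrite -rowE.
exists a, B^T => u; split=> [hu|[x <-]]; last first.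
  have := congr1 trmx hB; rewrite trmx_mul trmxK trmx0 => e.
  by rewrite -mulmxA e mulmx0.
apply/hp; apply: (lin_inj_eq0 ij); rewrite -hjp rV_combo (eq_combo _ ht).
by rewrite combo_act hu linear0.
Qed.

Hypothesis hco : row_coexact.

(** Continue [B^T] on the right by [C].  A column killed by [A] is killed by the
  rows of [C^T], since these are combinations of rows of [A]. *)
Lemma coexact_col m n s (A : 'M[R]_(m, n)) (B : 'M[R]_(n, s)) :
  row_exact A B -> col_exact A B.
Proof.
move=> ex v; split=> [hv|[x <-]]; last first.
  by rewrite -mulmxA -trmx_mul (row_exact_mul ex) trmx0 mulmx0.
have [c [C exC]] := hco B^T; apply/exC.
have [|X hX] := row_exact_factor (B := C^T) ex.
  by rewrite -[B]trmxK -trmx_mul (row_exact_mul exC) trmx0.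
by rewrite -[C]trmxK hX trmx_mul mulmxA hv mul0mx.
Qed.

Lemma coexact_left m n (A : 'M[R]_(m, n)) : exists s (B : 'M[R]_(s, m)), row_exact B A.
Proof.
have [s [C exC]] := hco A^T; exists s, C^T.
by have := coexact_col exC; rewrite /col_exact trmxK.
Qed.

(** Finitely presented modules form a class that can be continued on both sides by
  finitely generated free modules. *)
Lemma coexact_GP (M : lmodType R) m n (A : 'M[R]_(m, n))
    (p : {linear 'rV[R]_n -> M}) : presents A p -> Gorenstein_projective M.
Proof.
pose cls (K : lmodType R) := exists m n (A : 'M[R]_(m, n)) (p : {linear 'rV[R]_n -> K}),
  presents A p.
move=> pA; suff : cls M.
  2: by exists m, n, A, p.
apply: GP_build => {M m n A p pA} K [m [n [A [p pA]]]]; have [ps hp] := pA.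
  have [s [B exB]] := hco A.
  have [j [ij jp imj]] := presents_embed pA exB.
  have [C [q se]] := short_exact_coker ij; have [_ qs exq] := se.
  exists 'rV[R]_s, C, j, q; split=> //; first exact: rV_projective.
    by exists n, s, B, q; split=> // u; rewrite exq.
  move=> Q /projective_equational eQ h.
  have [c [C' exC]] := hco B^T; exact: (extend_rV h eQ ij imj exC).
have [K' [i se]] := short_exact_ker ps; have [ii _ exi] := se.
have imi u : (exists k, i k = u) <-> exists x, x *m A = u by rewrite -hp; symmetry.
exists 'rV[R]_n, K', i, p; split=> //; first exact: rV_projective.
  have [s [B exB]] := coexact_left A.
  have [|p' hp'] := factor_inj (f := mulmxr A) ii.
    by move=> x; apply/imi; exists x.
  exists s, m, B, p'; split=> [k|u].
    have [x hx] := (imi (i k)).1 (ex_intro _ k erefl).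
    by exists x; apply: ii; rewrite hp'.
  rewrite -exB -[u *m A]/(mulmxr A u) -hp'; split=> [->|hu]; first exact: linear0.
  exact: lin_inj_eq0 hu.
move=> Q /projective_equational eQ h.
have [c [C exC]] := hco A^T; exact: (extend_rV h eQ ii imi exC).
Qed.

End VonNeumann.

Section VonNeumannIff.
Variable R : comPzRingType.

(** Free covers to the left, injective hosts to the right; all terms are flat, and
  tensoring with an injective module is exact since the latter is flat too. *)
Lemma injective_flat_GF :
  (forall E : lmodType R, injective_module E -> flat E) -> G_von_Neumann_regular R.
Proof.
move=> hE M; apply: (@GF_build R (fun _ => True)) => // K _.
  have [E [i [iE ii]]] := enough_injectives K.
  have [C [p se]] := short_exact_coker ii.
  exists E, C, i, p; split=> //; first exact: hE.
  by move=> I /hE fI; apply: fI.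
have [F [p [pF ps]]] := free_cover K.
have [C [i se]] := short_exact_ker ps.
exists F, C, i, p; split=> //; first exact: projective_flat.
by move=> I /hE fI; apply: fI; case: se.
Qed.

Lemma G_10_ring_iff : G_nd_ring R 1 0 <-> G_von_Neumann_regular R.
Proof.
split=> h; last first.
  move=> M /n_presented1P [m [n [A [p pA]]]].
  apply/Gpd_le/Gproj_resolution0; apply: coexact_GP pA.
  apply: flat_embedding_coexact => N.
  have [S [[_ fS] _ [j [ij _]] _]] := h N.
  by exists (rterm S 0), j.
apply: injective_flat_GF => E iE; apply/flat_equational => b n s D hs.
have [M [p pA]] := coker_presents D^T; have [ps hp] := pA.
have [|f hf] := presents_map (f := combo s) pA.
  move=> x; rewrite -combo_act comboE big1 // => i _.
  by rewrite hs scaler0.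
have : Gorenstein_projective M.
  by apply/Gproj_resolution0/Gpd_le/h/n_presented1P; exists n, b, D^T, p.
move=> [S [[_ pS] _ [j [ij _]] _]].
(* [f] extends to [g] on a projective module, where the relation between the
   generators of [M] is a consequence of relations in [R]. *)
have [g hg] := iE _ _ j f ij.
have [jp hjp] := lin_comp j p.
have [|a [A [t [hA ht]]]] :=
    projective_equational (pS 0%N) (s := fun i => jp (delta_mx 0 i)) (D := D).
  move=> r; rewrite act_delta hjp (_ : p _ = 0) ?linear0 //.
  by apply/hp; exists (delta_mx 0 r); rewrite -rowE.
exists a, A, (fun k => g (t k)); split=> // i.
by rewrite -act_lin -ht hjp hg hf combo_row.
Qed.

End VonNeumannIff.

(** * Coherent rings, Noetherian rings and the theorem *)

Section Coherence.
Variable R : comPzRingType.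

(** Coherence of all finitely generated free modules, in matrix form. *)
Definition left_kernels : Prop :=
  forall b n (D : 'M[R]_(b, n)), exists a (A : 'M[R]_(a, b)), row_exact A D.

(** Schanuel's argument: comparing two covers of [M], the kernel of [q] is generated
  by the image of the relations [A] and by the defect of the round trip through
  the other cover. *)
Lemma presents_kernel (M : lmodType R) m n b (A : 'M[R]_(m, n))
    (p : {linear 'rV[R]_n -> M}) (q : {linear 'rV[R]_b -> M}) :
  presents A p -> surj q ->
  exists a (B : 'M[R]_(a, b)), presents B q.
Proof.
move=> [ps hp] qs.
have [al hal] := rV_projective q ps; have [be hbe] := rV_projective p qs.
pose Al := lin1_mx al; pose Be := lin1_mx be.
have eA u : u *m Al = al u by rewrite mul_rV_lin1.
have eB u : u *m Be = be u by rewrite mul_rV_lin1.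
exists (m + b)%N, (col_mx (A *m Be) (1%:M - Al *m Be)); split=> // u.
split=> [hu|[x <-]].
  have /hp [x hx] : p (u *m Al) = 0 by rewrite eA hal.
  exists (row_mx x u); rewrite mul_row_col mulmxA hx mulmxBr mulmx1 mulmxA.
  by rewrite addrC subrK.
rewrite -(hsubmxK x) mul_row_col linearD mulmxBr mulmx1 linearB !mulmxA.
rewrite !eB !hbe eA hal subrr addr0.
by apply/hp; exists (lsubmx x).
Qed.

(** By induction on the number of columns; one column is a finitely generated ideal. *)
Lemma coherent_left_kernels : coherent R -> left_kernels.
Proof.
move=> co.
have h1 b (D : 'M[R]_(b, 1)) : exists a (A : 'M[R]_(a, b)), row_exact A D.
  pose f : {linear 'rV[R]_b -> R^o} := combo (fun i => D i 0 : R^o).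
  have [J [j [ij hj]]] := sub_exists (submodule_im f).
  have [|q hq] := factor_inj (f := f) ij; first by move=> x; apply/hj; exists x.
  have qs : surj q.
    move=> y; have [x hx] := (hj (j y)).2 (ex_intro _ y erefl).
    by exists x; apply: ij; rewrite hq.
  have /n_presented1P [m [n [A [p pA]]]] : n_presented 1 J.
    by apply: (co J j ij); apply/n_presented0P; exists b, q.
  have [a [B [_ hB]]] := presents_kernel pA qs.
  exists a, B => u; rewrite -hB.
  have fE : (u *m D) 0 0 = f u by rewrite mxE comboE.
  split=> [hu|hu].
    by apply: (lin_inj_eq0 ij); rewrite hq -fE hu mxE.
  by apply/matrixP => x y; rewrite !ord1 fE -hq hu linear0 mxE.
move=> b n D; elim: n b D => [|n ih] b D.
  exists b, 1%:M => u; split=> [_|_]; first by exists u; rewrite mulmx1.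
  by apply/matrixP => x [].
pose D' : 'M[R]_(b, 1 + n) := D.
have [a [A exA]] := h1 b (lsubmx D').
have [c [B exB]] := ih a (A *m rsubmx D').
exists c, (B *m A) => u.
have eD : u *m D = row_mx (u *m lsubmx D') (u *m rsubmx D').
  by rewrite -mul_mx_row hsubmxK.
have -> : u *m D = 0 <-> u *m lsubmx D' = 0 /\ u *m rsubmx D' = 0.
  rewrite eD; split=> [e|[-> ->]]; last by rewrite row_mx0.
  by split; [rewrite -(row_mxKl (u *m lsubmx D') (u *m rsubmx D')) e linear0
    |rewrite -(row_mxKr (u *m lsubmx D') (u *m rsubmx D')) e linear0].
split=> [[/exA [x <-]]|[x <-]].
  by rewrite -mulmxA => /exB [y <-]; exists y; rewrite mulmxA.
split; first by apply/exA; exists (x *m B); rewrite mulmxA.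
by rewrite mulmxA -mulmxA; apply/exB; exists x.
Qed.

(** If [A1] and [A2] resolve the module presented by [D], the columns are exact
  at [A1] precisely when [Ext^2] of this module with values in [R] is zero. *)
Definition ext2_vanishes : Prop :=
  forall a b c n (A2 : 'M[R]_(a, b)) (A1 : 'M[R]_(b, c)) (D : 'M[R]_(c, n)),
  row_exact A2 A1 -> row_exact A1 D -> col_exact A2 A1.

(** The column [v] is a cocycle on the free resolution of the module presented by
  [D].  Transported to a resolution witnessing [Gpd <= 1] it becomes a
  coboundary, and a homotopy brings this back. *)
Lemma G_11_ring_ext2 : G_nd_ring R 1 1 -> ext2_vanishes.
Proof.
move=> hG a b c n A2 A1 D ex2 ex1 v; split=> [hv|[x <-]]; last first.
  by rewrite -mulmxA -trmx_mul (row_exact_mul ex2) trmx0 mulmx0.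
have [M [q qD]] := coker_presents D; have [qs hq] := qD.
have : cres 1 M.
  by apply/Gproj_resolution_cres/Gpd_le/hG/n_presented1P; exists c, n, D, q.
move=> [C [eps [[[pP _] eP _ hQ] es ee]]].
pose d : {linear 'rV[R]_c -> 'rV[R]_n} := mulmxr D.
pose d1 : {linear 'rV[R]_b -> 'rV[R]_c} := mulmxr A1.
pose d2 : {linear 'rV[R]_a -> 'rV[R]_b} := mulmxr A2.
have exq : exact_at d q by [].
have exd : exact_at d1 d by [].
have exd1 : exact_at d2 d1 by [].
pose h : {linear 'rV[R]_b -> R^o} := combo (fun i => v 0 i : R^o).
have hd2 x : h (d2 x) = 0.
  have -> : h (d2 x) = (x *m A2 *m v^T) 0 0.
    by rewrite [RHS]mxE; apply: eq_bigr => i _; rewrite [v^T _ _]mxE.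
  by rewrite -mulmxA -[A2]trmxK -trmx_mul hv trmx0 mulmx0 mxE.
have hker u : d1 u = 0 -> h u = 0 by move=> /exd1 [x <-]; exact: hd2.
(* Comparison maps between the two resolutions, and a homotopy [s0], [s1] from
   their composite to the identity of the free one. *)
have [al0 hal0] := pP 0%N _ _ q eps qs.
have [f1 hf1] := lin_comp al0 (cp C 0%N).
have [|al1 hal1] := lift_exact (f := f1) (pP 1%N) exq.
  by move=> x; rewrite hf1 hal0 (exact_comp0 _ ee).
have [f2 hf2] := lin_comp al1 (cp C 1%N).
have [|al2 hal2] := lift_exact (f := f2) (pP 2%N) exd.
  by move=> x; rewrite hf2 hal1 hf1 (exact_comp0 _ (eP 0%N)) linear0.
have [be0 hbe0] := rV_projective q es.
have [g1 hg1] := lin_comp be0 d.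
have [|be1 hbe1] := lift_exact (f := g1) (rV_projective (n:=_)) ee.
  by move=> x; rewrite hg1 hbe0 (exact_comp0 _ exq).
have [g2 hg2] := lin_comp be1 d1.
have [|be2 hbe2] := lift_exact (f := g2) (rV_projective (n:=_)) (eP 0%N).
  by move=> x; rewrite hg2 hbe1 hg1 (exact_comp0 _ exd) linear0.
pose k0 : {linear 'rV[R]_n -> 'rV[R]_n} := (al0 \o be0) \- idfun.
have [|s0 hs0] := lift_exact (f := k0) (rV_projective (n:=_)) exq.
  by move=> x; rewrite linearB /= hal0 hbe0 subrr.
pose k1 : {linear 'rV[R]_c -> 'rV[R]_c} := (al1 \o be1) \- idfun \- (s0 \o d).
have [|s1 hs1] := lift_exact (f := k1) (rV_projective (n:=_)) exd.
  move=> x; have -> : k1 x = al1 (be1 x) - x - s0 (d x) by [].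
  by rewrite !linearB hs0 hal1 hf1 hbe1 hg1 subrr.
have [hQ1 _ _ _] := hQ _ (@ring_projective R).
have [|g hg] := (hQ1 1%N isT (h \o al2 : {linear _ -> _})).1.
  move=> z /=; apply: hker; rewrite hal2 hf2 (exact_comp0 _ (eP 1%N)); exact: linear0.
pose phi : {linear 'rV[R]_c -> R^o} := (g \o be1) \- (h \o s1).
have phiE u : h u = phi (d1 u).
  have /eqP : h (al2 (be2 u) - u - s1 (d1 u)) = 0.
    apply: hker; rewrite !linearB hs1 hal2 hf2 hbe2 hg2.
    have -> : k1 (d1 u) = al1 (be1 (d1 u)) - d1 u - s0 (d (d1 u)) by [].
    by rewrite (exact_comp0 _ exd) linear0 subr0 subrr.
  rewrite !linearB -addrA -opprD subr_eq0 -[h (al2 _)]/((h \o al2 : {linear _ -> _}) _).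
  rewrite -hg hbe2 hg2 => /eqP e.
  by rewrite -[RHS]/(g (be1 (d1 u)) - h (s1 (d1 u))) e addrK.
exists (\row_j phi (delta_mx 0 j)); apply/rowP => i.
have -> : v 0 i = h (delta_mx 0 i) by rewrite [h _]combo_row.
rewrite phiE rV_combo comboE mxE; apply: eq_bigr => j _.
by rewrite /d1 /= -rowE !mxE mulrC.
Qed.

(** Injective modules have flat dimension at most one. *)
Definition injectives_fd1 : Prop :=
  forall (S F E : lmodType R) (i : {linear S -> F}) (p : {linear F -> E}),
  short_exact i p -> flat F -> injective_module E -> flat S.

(** By duality with [E], vanishing of [Ext^2(M, R)] makes [R^a -> R^b -> R^c] exact
  with coefficients in [E], that is [Tor_2(M, E) = 0].  Lifting to [F] then
  corrects a solution found in [F] into one in [S]. *)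
Lemma ext2_fd1 : left_kernels -> ext2_vanishes -> injectives_fd1.
Proof.
move=> ker ext S F E i p [ii ps exi] /flat_equational eF iE.
apply/flat_equational => b n s D hs.
have [c [A1 ex1]] := ker _ _ D; have [a [A2 ex2]] := ker _ _ A1.
have col := ext _ _ _ _ _ _ _ ex2 ex1.
have [|f hf] := equational_exact (s := fun k => i (s k)) eF ex1.
  by move=> j; rewrite -act_lin hs linear0.
have pf k : act (fun r => p (f r)) A1 k = 0.
  by rewrite -act_lin -hf (exact_comp0 _ exi).
have [|g hg] := injective_extend (phi := combo (fun r => p (f r)))
    (psi := mulmxr A2^T) iE.
  move=> x /= /col [y <-]; rewrite -combo_act comboE big1 // => k _.
  by rewrite pf scaler0.
have [g' hg'] := choice (fun k => ps (g (delta_mx 0 k))).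
have /choice [t ht] : forall r, exists x, i x = f r - act g' A2 r.
  move=> r; apply/exi; rewrite linearB act_lin; apply/eqP; rewrite subr_eq0; apply/eqP.
  rewrite (eq_act _ _ hg') act_delta rowE -[_ *m _]/(mulmxr A2^T (delta_mx 0 r)) hg.
  by rewrite combo_row.
exists c, A1, t; split; first exact: row_exact_mul.
move=> k; apply: ii; rewrite hf act_lin (eq_act _ _ ht) actB act_mul.
by rewrite (row_exact_mul ex2) act0 subr0.
Qed.

Lemma flat_pair (A B : lmodType R) : flat A -> flat B -> flat (A * B)%type.
Proof.
move=> /flat_equational eA /flat_equational eB; apply/flat_equational => b n s D hs.
have [|a [P [t [hP ht]]]] := eA b n (fun i => (s i).1) D.
  move=> j; rewrite -(act_lin (fst : {linear (A * B)%type -> A})) hs; exact: linear0.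
have [|c [Q [u [hQ hu]]]] := eB b n (fun i => (s i).2) D.
  move=> j; rewrite -(act_lin (snd : {linear (A * B)%type -> B})) hs; exact: linear0.
exists (a + c)%N, (col_mx P Q), (fun k => match split k with
  inl k => (t k, 0) | inr k => (0, u k) end); split.
  by rewrite mul_col_mx hP hQ col_mx0.
move=> i; apply/pair_eqP/andP; split; apply/eqP.
  rewrite ht (act_lin (fst : {linear (A * B)%type -> A})) /act big_split_ord /=.
  rewrite [X in _ + X]big1 ?addr0 => [|k _].
    by apply: eq_bigr => k _; rewrite col_mxEu (unsplitK (inl k)).
  by rewrite (unsplitK (inr k)) scaler0.
rewrite hu (act_lin (snd : {linear (A * B)%type -> B})) /act big_split_ord /=.
rewrite [X in X + _]big1 ?add0r => [|k _].
  by apply: eq_bigr => k _; rewrite col_mxEd (unsplitK (inr k)).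
by rewrite (unsplitK (inl k)) scaler0.
Qed.

Lemma lin_pair_exists (N A B : lmodType R) (j : {linear N -> A}) :
  exists f : {linear N -> (A * B)%type}, forall n, f n = (j n, 0).
Proof.
apply: (lin_of_rel (G := fun n x => x = (j n, 0))) => [n|n x y -> ->|c n n' x y -> ->] //.
  by exists (j n, 0).
by apply/pair_eqP/andP; split; apply/eqP; rewrite /= ?linearP ?scaler0 ?addr0.
Qed.

(** The class of submodules of flat modules is continued to the right by embedding
  the quotient [Y = F / N] in an injective [E] and using the horseshoe lemma: the
  middle kernel is flat because [E] has flat dimension at most one.  Tensor
  exactness is [Tor_1(N, I) = Tor_2(F / N, I) = 0]. *)
Lemma fd1_GF : injectives_fd1 -> forall (F N : lmodType R) (j : {linear N -> F}),
  flat F -> injective j -> Gorenstein_flat N.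
Proof.
move=> fd F N j fF ij.
pose cls (N : lmodType R) :=
  exists (F : lmodType R) (j : {linear N -> F}), flat F /\ injective j.
have tor (K P L : lmodType R) (i : {linear K -> P}) (p : {linear P -> L}) :
    short_exact i p -> cls L -> tensor_injective i.
  move=> se [F' [l [fF' il]]] I iI.
  have [F0 [g [pF0 gs]]] := free_cover I; have fF0 := projective_flat pF0.
  have [F1 [f sef]] := short_exact_ker gs; have [fi _ _] := sef.
  have fF1 := fd _ _ _ _ _ sef fF0 iI.
  apply: (tor_balance se sef); first by apply: fF0; case: se.
  apply: lin_eq0_inj => x hx.
  have il1 : injective (tensor_mapr F1 l) by apply/tensor_mapr_inj/fF1.
  apply: (lin_inj_eq0 il1); apply: (lin_inj_eq0 (fF' _ _ _ fi)).
  by rewrite [LHS]tensor_bimap [X in tensor_mapr _ _ X]hx linear0.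
suff : forall N, cls N -> Gorenstein_flat N by apply; exists F, j.
move=> {F N j fF ij} N; apply: GF_build => {N} N cN; last first.
  have [P [p [pP ps]]] := free_cover N; have [K [i se]] := short_exact_ker ps.
  exists P, K, i, p; split=> //; [exact: projective_flat| |exact: tor se cN].
  by exists P, i; split; [apply: projective_flat|case: se].
have [F [j [fF ij]]] := cN.
have [Y [q [_ qs exq]]] := short_exact_coker ij.
have [E [e [iE ie]]] := enough_injectives Y.
have [Y' [r [_ rs exr]]] := short_exact_coker ie.
have [F' [t [pF' ts]]] := free_cover Y'.
have [t' ht'] := pF' _ _ r t rs.
pose FF : lmodType R := (F * F')%type.
(* The horseshoe lemma for [0 -> Y -> E -> Y' -> 0], [Y] being covered by [F]
   and [Y'] by [F']. *)
pose m : {linear FF -> E} :=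
  (e \o q \o (fst : {linear FF -> F})) \+ (t' \o (snd : {linear FF -> F'})).
have mE x : m x = e (q x.1) + t' x.2 by [].
have ms : surj m.
  move=> z; have [y hy] := ts (r z).
  have /exr [w hw] : r (z - t' y) = 0 by rewrite linearB ht' hy subrr.
  have [x hx] := qs w.
  by exists (x, y); rewrite mE /= hx hw subrK.
have [L [l seL]] := short_exact_ker ms; have [il _ exl] := seL.
have fL : flat L.
  by apply: fd seL _ iE; apply: flat_pair => //; apply: projective_flat.
have [C [c seC]] := short_exact_ker ts; have [ic _ exc] := seC.
have [j0 hj0] := lin_pair_exists F' j.
have [|u hu] := factor_inj (f := j0) il.
  by move=> n; apply/exl; rewrite mE hj0 /= (exact_comp0 _ exq) !linear0 addr0.
pose l2 : {linear L -> F'} := (snd : {linear FF -> F'}) \o l.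
have tl2 x : t (l2 x) = 0.
  have := exact_comp0 x exl; rewrite mE => /eqP; rewrite addrC addr_eq0 => /eqP h.
  by rewrite -ht' [t' _]h linearN (exact_comp0 _ exr) oppr0.
have [|v hv] := factor_inj (f := l2) ic; first by move=> x; apply/exc.
have cC : cls C by exists F', c; split=> //; apply: projective_flat.
have se : short_exact u v.
  split.
  - by apply: lin_eq0_inj => n hn; apply: (lin_inj_eq0 ij);
      have := hu n; rewrite hn linear0 hj0 => -[].
  - move=> y; have h0 : r (t' (c y)) = 0 by rewrite ht' (exact_comp0 _ exc).
    have [w hw] := (exr _).1 h0; have [x hx] := qs w.
    have /exl [z hz] : m (- x, c y) = 0 by rewrite mE /= !linearN hx hw addNr.
    by exists z; apply: ic; rewrite hv /l2 /= hz.
  - move=> x; split=> [hx|[n <-]]; last first.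
      by apply: ic; rewrite hv /l2 /= hu hj0 linear0.
    have l20 : (l x).2 = 0 by rewrite -[(l x).2]/(l2 x) -hv hx linear0.
    have : q (l x).1 = 0.
      apply: (lin_inj_eq0 ie); have := exact_comp0 x exl.
      by rewrite mE l20 linear0 addr0.
    move=> /exq [n hn]; exists n; apply: il; rewrite hu hj0.
    by rewrite hn -l20; case: (l x).
exists L, C, u, v; split=> //; exact: tor se cC.
Qed.

(** A submodule [K] of [R^n] is Gorenstein flat, hence [Tor_1(K, E) = 0]; by balance
  [K (x) S] embeds in [K (x) F], hence in [R^n (x) F]. *)
Lemma GF_fd1 :
  (forall (F N : lmodType R) (j : {linear N -> F}),
     flat F -> injective j -> Gorenstein_flat N) -> injectives_fd1.
Proof.
move=> hG S F E i p se fF iE; have [ii _ _] := se.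
apply/flat_equational/equational_test => n K j ij.
have fR : flat 'rV[R]_n by apply/projective_flat/rV_projective.
have [B [[fl _] [eB em _ _] [k [ik hk]] hT]] := hG _ _ _ fR ij.
have [eT _ _ _] := hT E iE.
have [|p0 hp0] := factor_inj (f := mmap B) ik; first by move=> x; apply/hk; exists x.
have p0s : surj p0.
  move=> y; have [x hx] := (hk (k y)).1 (ex_intro _ y erefl).
  by exists x; apply: ik; rewrite hp0.
have [K1 [i1 se1]] := short_exact_ker p0s; have [ii1 _ ex1] := se1.
have [|u hu] := factor_inj (f := lmap B 0) ii1.
  by move=> x; apply/ex1; apply: ik; rewrite hp0 linear0 (exact_comp0 _ em).
have us : surj u.
  move=> y; have /em [x hx] : mmap B (i1 y) = 0.
    by rewrite -hp0 (exact_comp0 _ ex1) linear0.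
  by exists x; apply: ii1; rewrite hu.
have tor : injective (tensor_map i1 E).
  apply: lin_eq0_inj => z hz; have [w hw] := tensor_map_surj (V := E) us z.
  have /(eT 0%N) [w' hw'] : tensor_map (lmap B 0) E w = 0.
    by rewrite (tensor_map_comp w (fun a => esym (hu a))) hw.
  rewrite -hw -hw'; have [c hc] := lin_comp u (lmap B 1).
  rewrite -[LHS](tensor_map_comp (h := c)) //; apply: tensor_map0 => x.
  by apply: ii1; rewrite hc hu (exact_comp0 _ (eB 0%N)) linear0.
have bal : injective (tensor_map i K).
  by apply: (tor_balance se se1) => //; apply: fl.
apply: lin_eq0_inj => x hx.
have bal' : injective (tensor_mapr K i) by apply/tensor_mapr_inj.
apply: (lin_inj_eq0 bal'); apply: (lin_inj_eq0 (fF _ _ _ ij)).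
by rewrite [LHS]tensor_bimap [X in tensor_mapr _ _ X]hx linear0.
Qed.

(** Embed the cokernel of the transpose of [A1] in an injective [E].  Flatness of [S]
  and [F] gives exactness of [E^a -> E^b -> E^c], so the class of [v], seen in
  [E], is a combination of the entries of [A2 v = 0]. *)
Lemma fd1_ext2 : injectives_fd1 -> ext2_vanishes.
Proof.
move=> fd a b c n A2 A1 D ex2 ex1 v; split=> [hv|[x <-]]; last first.
  by rewrite -mulmxA -trmx_mul (row_exact_mul ex2) trmx0 mulmx0.
have [Y [q [qs hq]]] := coker_presents A1^T.
have [E [e [iE ie]]] := enough_injectives Y.
have [F [p [pF ps]]] := free_cover E; have [S [i se]] := short_exact_ker ps.
have [ii _ exi] := se.
have fS := fd _ _ _ _ _ se (projective_flat pF) iE.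
have [eq heq] := lin_comp e q.
have [f hf] := choice (fun r => ps (eq (delta_mx 0 r))).
have /choice [t ht] : forall k, exists x, i x = act f A1 k.
  move=> k; apply/exi; rewrite act_lin (eq_act _ _ hf) act_delta heq.
  rewrite (_ : q _ = 0) ?linear0 //; apply/hq.
  by exists (delta_mx 0 k); rewrite -rowE.
have [|t' ht'] := equational_exact (s := t) ((flat_equational _).1 fS) ex1.
  move=> j; apply: ii; rewrite act_lin (eq_act _ _ ht) act_mul linear0.
  by rewrite (row_exact_mul ex1) act0.
have [|g hg] := equational_exact (s := fun r => f r - i (t' r))
    (projective_equational pF) ex2.
  move=> k; rewrite actB -ht ht' act_lin subrr //.
apply/hq; apply: (lin_inj_eq0 ie); rewrite -heq rV_combo.
have fE r : eq (delta_mx 0 r) = act (fun l => p (g l)) A2 r.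
  by rewrite -act_lin -hg linearB (exact_comp0 _ exi) subr0 hf.
by rewrite (eq_combo _ fE) combo_act hv linear0.
Qed.

(** The class of finitely generated submodules of free modules is continued to the
  left by kernels of matrices.  To the right, generators of the dual of [K] embed
  it in a free module [R^s]; the quotient embeds again in a free module because
  the transposed matrices form a resolution with vanishing [Ext^2]. *)
Lemma ext2_GP : left_kernels -> ext2_vanishes ->
  forall (K : lmodType R) b n (D : 'M[R]_(b, n)) (j : {linear K -> 'rV[R]_n}),
  injective j -> (forall u, (exists k, j k = u) <-> exists x, x *m D = u) ->
  Gorenstein_projective K.
Proof.
move=> ker ext K b n D j ij hj.
pose cls (K : lmodType R) := exists b n (D : 'M[R]_(b, n)) (j : {linear K -> 'rV[R]_n}),
  injective j /\ forall u, (exists k, j k = u) <-> exists x, x *m D = u.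
suff : forall K, cls K -> Gorenstein_projective K by apply; exists b, n, D, j.
have cover (N : lmodType R) b' n' (D' : 'M[R]_(b', n')) (l : {linear N -> 'rV[R]_n'}) :
    injective l -> (forall u, (exists k, l k = u) <-> exists x, x *m D' = u) ->
    exists p : {linear 'rV[R]_b' -> N}, surj p /\ forall x, l (p x) = x *m D'.
  move=> il hl; have [|p hp] := factor_inj (f := mulmxr D') il.
    by move=> x; apply/hl; exists x.
  exists p; split=> // y; have [x hx] := (hl (l y)).1 (ex_intro _ y erefl).
  by exists x; apply: il; rewrite hp.
move=> {K b n D j ij hj} K; apply: GP_build => {K} K [b [n [D [j [ij hj]]]]].
  have [p [ps hp]] := cover _ _ _ _ _ ij hj.
  have [b1 [A1 ex1]] := ker _ _ D.
  have pA1 : presents A1 p.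
    split=> // u; rewrite -ex1 -hp; split=> [->|h]; first exact: linear0.
    exact: lin_inj_eq0 h.
  have [s [E1 exE1]] := ker _ _ A1^T.
  have exB : row_exact A1 E1^T.
    move=> u; split=> [hu|[x <-]]; last first.
      by rewrite -mulmxA -[A1]trmxK -trmx_mul (row_exact_mul exE1) trmx0 mulmx0.
    apply/ex1; have [|X hX] := row_exact_factor (B := D^T) exE1.
      by rewrite -trmx_mul (row_exact_mul ex1) trmx0.
    by rewrite -[D]trmxK hX trmx_mul mulmxA hu mul0mx.
  have [l [il lp iml]] := presents_embed pA1 exB.
  have [C [q se]] := short_exact_coker il; have [_ qs exq] := se.
  exists 'rV[R]_s, C, l, q; split=> //; first exact: rV_projective.
    have [t [E2 exE2]] := ker _ _ E1.
    have col : row_exact E1^T E2^T by have := ext _ _ _ _ _ _ _ exE2 exE1.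
    have qB : presents E1^T q by split=> // u; rewrite exq.
    have [l' [il' _ iml']] := presents_embed qB col.
    by exists s, t, E2^T, l'.
  move=> Q /projective_equational eQ h.
  by apply: (extend_rV (D := E1^T) (C := A1^T) h eQ il iml); rewrite trmxK.
have [p [ps hp]] := cover _ _ _ _ _ ij hj.
have [K1 [i se]] := short_exact_ker ps; have [ii _ exi] := se.
have [b1 [A1 ex1]] := ker _ _ D; have [b2 [A2 ex2]] := ker _ _ A1.
have imi u : (exists k, i k = u) <-> exists x, x *m A1 = u.
  rewrite -(exi u) -(ex1 u) -hp; split=> [->|h]; first exact: linear0.
  exact: lin_inj_eq0 h.
exists 'rV[R]_b, K1, i, p; split=> //; first exact: rV_projective.
  by exists b1, b, A1, i.
move=> Q /projective_equational eQ h.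
exact: (extend_rV (D := A1) (C := A2^T) h eQ ii imi (ext _ _ _ _ _ _ _ ex2 ex1)).
Qed.

Lemma G_11_ring_iff : coherent R -> (G_nd_ring R 1 1 <-> G_semi_hereditary R).
Proof.
move=> co; have ker := coherent_left_kernels co; split=> [hG|[_ hG]].
  by split=> //; apply/fd1_GF/ext2_fd1/G_11_ring_ext2.
have ext := fd1_ext2 (GF_fd1 hG).
move=> M /n_presented1P [m [n [A [p [ps hp]]]]]; apply/Gpd_le.
have [K [i se]] := short_exact_ker ps; have [ii _ exi] := se.
apply: (Gproj_resolution_succ _ se); first exact/projective_GP/rV_projective.
apply/Gproj_resolution0; apply: (ext2_GP ker ext (D := A) ii) => u.
by rewrite -hp; symmetry.
Qed.

End Coherence.

Section Noetherian.
Variable R : comPzRingType.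

(** By induction on [n]: generators of the ideal of first coordinates are lifted,
  and the vectors with zero first coordinate are generated by induction. *)
Lemma noetherian_submodule : noetherian R -> forall n (S : 'rV[R]_n -> Prop),
  submodule S -> exists a (A : 'M[R]_(a, n)), forall u, S u <-> exists x, x *m A = u.
Proof.
move=> no; elim=> [|n ih] S hS.
  exists 0%N, 0 => u; split=> [_|_]; last by rewrite (rV0_eq0 u); apply: hS.1.
  by exists 0; rewrite mul0mx (rV0_eq0 u).
have row0S (S' := fun v : 'rV[R]_n => S (row_mx (0 : 'rV[R]_1) v)) : submodule S'.
  split=> [|c v w hv hw]; rewrite /S'; first by rewrite row_mx0; apply: hS.1.
  have <- : c *: row_mx (0 : 'rV[R]_1) v + row_mx 0 w = row_mx 0 (c *: v + w).
    by rewrite scale_row_mx add_row_mx scaler0 addr0.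
  exact: (hS.2 c _ _ hv hw).
have [a [A hA]] := ih _ row0S.
pose I (r : R^o) := exists2 u, S u & u 0 0 = r.
have hI : submodule I.
  split=> [|c _ _ [u hu <-] [v hv <-]]; first by exists 0; [apply: hS.1|rewrite mxE].
  by exists (c *: u + v); [apply: hS.2|rewrite !mxE].
have [J [j [ij hj]]] := sub_exists hI.
have /n_presented0P [k [f fs]] := no J j ij.
have /choice [w hw] : forall i : 'I_k, exists u, S u /\ u 0 0 = j (f (delta_mx 0 i)).
  move=> i; have [u hu e] := (hj (j (f (delta_mx 0 i)))).2 (ex_intro _ _ erefl).
  by exists u.
pose W : 'M[R]_(k, 1 + n) := \matrix_i w i.
pose A' : 'M[R]_(a, 1 + n) := row_mx 0 A.
have SW x : S (x *m W).
  rewrite mulmx_sum_row; apply: (submodule_sum _ hS) => i _.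
  by apply: (submoduleZ _ hS); rewrite rowK; case: (hw i).
have SA x : S (x *m A').
  rewrite mul_mx_row mulmx0; apply/hA; by exists x.
exists (k + a)%N, (col_mx W A') => u; split=> [hu|[x <-]]; last first.
  by rewrite -[x]hsubmxK mul_row_col; apply: (submoduleD hS).
have [y hy] := (hj (u 0 0)).1 (ex_intro2 _ _ u hu erefl).
have [x hx] := fs y.
have W0 : (x *m W) 0 0 = u 0 0.
  rewrite -hy -hx rV_combo combo_lin comboE mxE; apply: eq_bigr => i _.
  by rewrite mxE; case: (hw i) => _ ->.
pose v : 'rV[R]_(1 + n) := u - x *m W.
have Sv : S v by apply: (submoduleB hS).
have v0 : lsubmx v = 0.
  apply/matrixP => s t; rewrite !ord1 !mxE.
  have -> : lshift n (0 : 'I_1) = 0 :> 'I_(1 + n) by apply/val_inj.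
  by have := W0; rewrite mxE => ->; rewrite subrr.
have /hA [z hz] : S (row_mx (0 : 'rV[R]_1) (rsubmx v)) by rewrite -v0 hsubmxK.
have zA : z *m A' = v by rewrite /A' mul_mx_row mulmx0 hz -v0 hsubmxK.
by exists (row_mx x z); rewrite mul_row_col zA /v addrC subrK.
Qed.

Lemma noetherian_n_presented n (M : lmodType R) :
  noetherian R -> n_presented 0 M -> n_presented n M.
Proof.
move=> no /n_presented0P [k0 [eps es]].
have sub := noetherian_submodule no.
have [a0 [A0 hA0]] := sub _ _ (submodule_ker eps).
have /choice_dep [next hnext] : forall X : {a : nat & {b : nat & 'M[R]_(a, b)}},
    exists Y : {c : nat & 'M[R]_(c, projT1 X)},
    row_exact (projT2 Y) (projT2 (projT2 X)).
  move=> [a [b A]] /=.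
  have [c [C hC]] := sub _ _ (submodule_ker (mulmxr A : {linear 'rV[R]_a -> 'rV[R]_b})).
  by exists (existT _ c C).
pose st := nat_rect (fun _ => {a : nat & {b : nat & 'M[R]_(a, b)}})
  (existT _ a0 (existT _ k0 A0))
  (fun _ X => existT _ (projT1 (next X)) (existT _ (projT1 X) (projT2 (next X)))).
pose k i := projT1 (projT2 (st i)).
pose dF i : {linear 'rV[R]_(k i.+1) -> 'rV[R]_(k i)} := mulmxr (projT2 (projT2 (st i))).
exists k, eps, dF; split=> [//|_ u|i _ u]; [exact: hA0|exact: (hnext (st i))].
Qed.

End Noetherian.

Theorem theorem2p2 (R : comPzRingType) (n d : nat) :
  (G_nd_ring R 0 0 <-> G_semisimple R) /\
  (G_nd_ring R 0 1 <-> G_hereditary R) /\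
  (G_nd_ring R 0 d <-> dim_le (Ggldim R) d) /\
  (G_nd_ring R 1 0 <-> G_von_Neumann_regular R) /\
  (coherent R -> (G_nd_ring R 1 1 <-> G_semi_hereditary R)) /\
  (G_nd_domain R 0 1 <-> G_Dedekind R) /\
  (coherent R -> (G_nd_domain R 1 1 <-> G_Pruefer R)) /\
  (noetherian R -> (G_nd_ring R n d <-> dim_le (Ggldim R) d)).
Proof.
have G0 e : G_nd_ring R 0 e <-> dim_le (Ggldim R) e by rewrite G_0d_ring_iff Ggldim_le.
have hereditary : G_nd_ring R 0 1 <-> G_hereditary R := G0 1%N.
split; first by rewrite G_0d_ring_iff semisimple_iff.
do 2!split=> //; split; first exact: G_10_ring_iff.
split; first exact: G_11_ring_iff.
split; first by split=> -[/hereditary h dom].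
split; first by move=> /G_11_ring_iff h; split=> -[/h hR dom].
move=> no; rewrite -G0; split=> h M hM; apply: h.
  exact: noetherian_n_presented.
by apply/n_presented0P; case: hM => k [eps [_ [es _ _]]]; exists (k 0%N), eps.
Qed.
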